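(* Let $q\in(0,1)$ and $\alpha>-1$. The characteristic function of the Jacobi operator $\tilde J^{(\alpha)}$ equals $$\tilde{\mathfrak{F}}^{(\alpha)}(z)={}_0\phi_1\big(-;q^{\alpha+2};q,-q^{\alpha+2}z\big)=\frac{(q;q)_\infty}{(q^{\alpha+2};q)_\infty}\,z^{-(\alpha+1)/2}J_{\alpha+1}^{(2)}(2\sqrt z;q).$$
   Context: Fix $q\in(0,1)$ and $\alpha>-1$. $(a;q)_n=\prod_{k=0}^{n-1}(1-aq^k)$ for $n\in\mathbb{N}_0\cup\{\infty\}$. The basic hypergeometric function is ${}_0\phi_1(-;b;q,x)=\sum_{k=0}^\infty\frac{q^{k(k-1)}}{(b;q)_k(q;q)_k}x^k$, and the Jackson $q$-Bessel function is $$J_\nu^{(2)}(x;q)=\frac{(q^{\nu+1};q)_\infty}{(q;q)_\infty}\Big(\frac x2\Big)^\nu{}_0\phi_1\Big(-;q^{\nu+1};q,-\frac{q^{\nu+1}x^2}{4}\Big).$$ Put $$\gamma(u,v;q)=\frac{(q^u;q)_\infty}{(q^{u+v};q)_\infty},\qquad r_n^{(\alpha)}=\frac{1-\gamma(n+1,\alpha+1;q)}{1-\gamma(n,\alpha+1;q)},\quad n\ge0$$ (note $\gamma(0,\alpha+1;q)=0$), and $$\tilde\lambda_n^{(\alpha)}=\frac{q^{-2n-\alpha-1}(1-q^{n+\alpha+1})}{r_n^{(\alpha)}},\qquad\tilde\mu_n^{(\alpha)}=q^{-2n-\alpha}(1-q^n)\,r_n^{(\alpha)},\quad n\ge0 .$$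 The Jacobi operator $\tilde J^{(\alpha)}$ is the closure in $\ell^2(\mathbb{N}_0)$ of the action on finitely supported sequences of the infinite symmetric tridiagonal matrix with diagonal entries $\tilde\lambda_n^{(\alpha)}+\tilde\mu_n^{(\alpha)}$ and off-diagonal entries $\sqrt{\tilde\lambda_n^{(\alpha)}\tilde\mu_{n+1}^{(\alpha)}}$. It is self-adjoint and positive with trace class inverse, and its spectrum consists of simple eigenvalues $0<\zeta_1^{(\alpha)}<\zeta_2^{(\alpha)}<\cdots$ with $\sum_k1/\zeta_k^{(\alpha)}<\infty$. Its characteristic function is the entire function $\tilde{\mathfrak{F}}^{(\alpha)}(z)=\prod_{k=1}^\infty\big(1-z/\zeta_k^{(\alpha)}\big)$. *)

(* Defs.v *)
From Stdlib Require Export Reals.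
From Coquelicot Require Export Coquelicot.

Open Scope R_scope.

Fixpoint qpoch (a q : R) (n : nat) : R :=
  match n with
  | O => 1
  | S m => qpoch a q m * (1 - a * q ^ m)
  end.

Definition qpoch_inf (a q : R) : R := real (Lim_seq (fun n => qpoch a q n)).

(* Coquelicot's [Series] is real-valued; a complex series is summed
   componentwise. *)
Definition CSeries (a : nat -> C) : C :=
  (Series (fun k => Re (a k)), Series (fun k => Im (a k))).

Definition phi01 (b q : R) (x : C) : C :=
  CSeries (fun k =>
    Cmult (RtoC (q ^ (k * (k - 1)) / (qpoch b q k * qpoch q q k))) (Cpow x k)).

(* Principal argument, in (-PI, PI], of a nonzero complex number. *)
Definition Carg (z : C) : R :=
  if Rle_dec 0 (Im z) then acos (Re z / Cmod z) else - acos (Re z / Cmod z).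

(* Principal value of z ^ s for a real exponent s; meaningful for z <> 0 only. *)
Definition Crpow (z : C) (s : R) : C :=
  Cmult (RtoC (Rpower (Cmod z) s)) (cos (s * Carg z), sin (s * Carg z)).

Definition Csqrt (z : C) : C := Crpow z (1 / 2).

Definition qBesselJ2 (nu q : R) (x : C) : C :=
  Cmult
    (Cmult (RtoC (qpoch_inf (Rpower q (nu + 1)) q / qpoch_inf q q))
           (Crpow (Cdiv x (RtoC 2)) nu))
    (phi01 (Rpower q (nu + 1)) q
       (Copp (Cdiv (Cmult (RtoC (Rpower q (nu + 1))) (Cpow x 2)) (RtoC 4)))).

Definition l2 (u : nat -> C) : Prop := ex_series (fun n => Cmod (u n) ^ 2).

Definition l2norm (u : nat -> C) : R :=
  sqrt (Series (fun n => Cmod (u n) ^ 2)).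

Definition seq_sub (u v : nat -> C) : nat -> C := fun n => Cminus (u n) (v n).

Definition seq_scal (z : C) (u : nat -> C) : nat -> C := fun n => Cmult z (u n).

(* An unbounded operator on complex l^2(N), given by its graph: [T u v] means
   that [u] lies in the domain of [T] and [T u = v]. *)
Definition operator := (nat -> C) -> (nat -> C) -> Prop.

Definition op_closure (T : operator) : operator := fun u v =>
  l2 u /\ l2 v /\
  exists us vs : nat -> nat -> C,
    (forall k, T (us k) (vs k)) /\
    is_lim_seq (fun k => l2norm (seq_sub (us k) u)) 0 /\
    is_lim_seq (fun k => l2norm (seq_sub (vs k) v)) 0.

(* T - z maps dom T onto l^2 and has a bounded inverse (the bound also gives
   injectivity). *)
Definition in_resolvent_set (T : operator) (z : C) : Prop :=
  (forall f, l2 f ->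
     exists u v, T u v /\ forall n, seq_sub v (seq_scal z u) n = f n) /\
  (exists M : R, forall u v, T u v ->
     l2norm u <= M * l2norm (seq_sub v (seq_scal z u))).

Definition spectrum (T : operator) (z : C) : Prop := ~ in_resolvent_set T z.

Definition eigenvector (T : operator) (z : C) (u : nat -> C) : Prop :=
  T u (seq_scal z u) /\ exists n, u n <> RtoC 0.

Definition simple_eigenvalue (T : operator) (z : C) : Prop :=
  exists u, eigenvector T z u /\
    forall w, eigenvector T z w -> exists c : C, forall n, w n = Cmult c (u n).

(* [zeta k] is the (k+1)-st point of the spectrum. *)
Definition spectral_enumeration (T : operator) (zeta : nat -> R) : Prop :=
  0 < zeta 0%nat /\
  (forall k, zeta k < zeta (S k)) /\
  (forall z : C, spectrum T z <-> exists k, z = RtoC (zeta k)) /\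
  (forall k, simple_eigenvalue T (RtoC (zeta k))) /\
  ex_series (fun k => / zeta k).

Fixpoint Cprod (f : nat -> C) (n : nat) : C :=
  match n with
  | O => RtoC 1
  | S m => Cmult (Cprod f m) (f m)
  end.

(* F(z) = prod_k (1 - z / zeta_k).  The enumeration is determined by the
   spectrum of [T], so there is at most one such F. *)
Definition is_characteristic_function (T : operator) (F : C -> C) : Prop :=
  exists zeta, spectral_enumeration T zeta /\
    forall z : C,
      filterlim
        (Cprod (fun k => Cminus (RtoC 1) (Cdiv z (RtoC (zeta k)))))
        eventually (locally (F z)).

Definition fin_supp (u : nat -> C) : Prop :=
  exists N, forall n, (N <= n)%nat -> u n = RtoC 0.

(* Action of the symmetric tridiagonal matrix with diagonal [a] and
   off-diagonal [b], where [b n] is the entry at (n, n+1) and (n+1, n). *)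
Definition jacobi_action (a b : nat -> R) (u : nat -> C) (n : nat) : C :=
  Cplus
    (Cplus (match n with
            | O => RtoC 0
            | S m => Cmult (RtoC (b m)) (u m)
            end)
           (Cmult (RtoC (a n)) (u n)))
    (Cmult (RtoC (b n)) (u (S n))).

Definition jacobi_operator (a b : nat -> R) : operator :=
  op_closure (fun u v => fin_supp u /\ forall n, v n = jacobi_action a b u n).

Definition qgamma (q u v : R) : R :=
  qpoch_inf (Rpower q u) q / qpoch_inf (Rpower q (u + v)) q.

Definition rcoef (q alpha : R) (n : nat) : R :=
  (1 - qgamma q (INR n + 1) (alpha + 1)) / (1 - qgamma q (INR n) (alpha + 1)).

Definition lambda_t (q alpha : R) (n : nat) : R :=
  Rpower q (- 2 * INR n - alpha - 1) * (1 - Rpower q (INR n + alpha + 1))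
  / rcoef q alpha n.

Definition mu_t (q alpha : R) (n : nat) : R :=
  Rpower q (- 2 * INR n - alpha) * (1 - q ^ n) * rcoef q alpha n.

Definition Jtilde (q alpha : R) : operator :=
  jacobi_operator
    (fun n => lambda_t q alpha n + mu_t q alpha n)
    (fun n => sqrt (lambda_t q alpha n * mu_t q alpha (S n))).

(* Main.v *)
(** For the rates [lam], [mu] of the theorem, the Jacobi matrix is diagonally
    similar to the birth-and-death operator
    [(L y) n = lam n (y n - y (n+1)) + mu n (y n - y (n-1))].  Let [Qn z] be the
    solution of [L y = z y] with [y 0 = 1].  By Sturm's theorem
    [Qn z n = prod_(k < n) (1 - z x_(n,k))] with interlacing [x_(n,k)], so
    [x_(n,k)] increases with [n] to a limit [x_k]; as [Qn (-1)] is bounded the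
    [x_k] are summable, and dominated convergence turns [Qn z n -> F z] into
    [F z = prod_k (1 - z x_k)].  If [F z = 0] then [Qn z] decays so fast that it
    is an eigenvector, and the Christoffel-Darboux formula shows that the zero is
    simple; if [F z <> 0] then a second, decaying solution exists and variation
    of parameters gives a bounded resolvent.  So [F] is the characteristic
    function.  It remains to compute [F]: the dual recurrence, satisfied by the
    weighted partial sums of [Qn z], is up to the gauge factor
    [1 - gamma (n+1)] the recurrence of the q-Laguerre polynomials of order
    [alpha + 1], whose explicit coefficients converge to those of [0phi1]. *)

Require Import Defs.
From Stdlib Require Import Lra Lia ClassicalEpsilon FunctionalExtensionality.
Open Scope R_scope.

(** * Sums, products and limits *)

(** Every spectral statement is reduced to the asymptotics of solutions of one three-term
    recurrence, governed by the orders [bdpi n ~ q^(-n)] and [lam n, mu n ~ q^(-2n)]. A vector lies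
    in the domain of the closure once its boundary terms [b n * u n] and [b n * u (n+1)] vanish at
    infinity, and [b n] grows like [q^(-2n)]; this is why the decay of [Qn] at a zero of [F] is
    bootstrapped to order [q^(3n)]. Symmetrization multiplies by [sqrt (bdpi n)], of order
    [q^(-n/2)], hence the powers of [h = sqrt q]. Interlacing survives the limit only as a weak
    inequality, so that two [x_k] might merge; the double zero argument excludes this. The gauge
    factor has its origin in the recurrence itself: [1 - gamma (n+1)] solves the q-Laguerre
    recurrence at [z = 0], and [Qn z n] is, up to normalization, the Casoratian of this solution
    with the q-Laguerre polynomials. Both terms of the Casoratian have limits, in the ratio [1 : q],
    so that they do not cancel. *)

Fixpoint Rsum (f : nat -> R) (n : nat) : R :=
  match n with O => 0 | S m => Rsum f m + f m end.

Fixpoint Csum (f : nat -> C) (n : nat) : C :=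
  match n with O => RtoC 0 | S m => Cplus (Csum f m) (f m) end.

Lemma Rsum_sum_n f n : sum_n f n = Rsum f (S n).
Proof.
  induction n as [|n IH].
  - rewrite sum_O; simpl; symmetry; apply Rplus_0_l.
  - rewrite sum_Sn, IH. reflexivity.
Qed.

Lemma Rsum_le f g n : (forall k, (k < n)%nat -> f k <= g k) -> Rsum f n <= Rsum g n.
Proof.
  induction n as [|n IH]; intros H; simpl; [lra|].
  assert (Rsum f n <= Rsum g n) by (apply IH; intros; apply H; lia).
  assert (f n <= g n) by (apply H; lia). lra.
Qed.

Lemma Rsum_ext f g n : (forall k, (k < n)%nat -> f k = g k) -> Rsum f n = Rsum g n.
Proof.
  intros H; apply Rle_antisym; apply Rsum_le; intros k Hk; rewrite (H k Hk); lra.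
Qed.

Lemma Rsum_nonneg f n : (forall k, (k < n)%nat -> 0 <= f k) -> 0 <= Rsum f n.
Proof.
  induction n as [|n IH]; intros H; simpl; [lra|].
  assert (0 <= Rsum f n) by (apply IH; intros; apply H; lia).
  assert (0 <= f n) by (apply H; lia). lra.
Qed.

Lemma Rsum_mono f m n : (forall k, 0 <= f k) -> (m <= n)%nat -> Rsum f m <= Rsum f n.
Proof.
  intros Hf H; induction H as [|n H IH]; [lra|]. simpl; specialize (Hf n); lra.
Qed.

Lemma Rsum_scal c f n : Rsum (fun k => c * f k) n = c * Rsum f n.
Proof. induction n as [|n IH]; simpl; [ring|rewrite IH; ring]. Qed.

Lemma is_series_Rsum f l : is_series f l <-> is_lim_seq (Rsum f) l.
Proof.
  split; intros H.
  - apply is_lim_seq_incr_1. eapply is_lim_seq_ext; [|exact H].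
    intros n; apply Rsum_sum_n.
  - apply is_lim_seq_incr_1 in H. red.
    eapply is_lim_seq_ext in H; [exact H|]. intros n; symmetry; apply Rsum_sum_n.
Qed.

Lemma is_lim_Rsum_Series f : ex_series f -> is_lim_seq (Rsum f) (Series f).
Proof. intros H; apply is_series_Rsum, Series_correct, H. Qed.

Lemma ex_series_bounded f M :
  (forall k, 0 <= f k) -> (forall n, Rsum f n <= M) -> ex_series f.
Proof.
  intros Hf HM.
  assert (H : ex_finite_lim_seq (Rsum f)).
  { apply ex_finite_lim_seq_incr with M; auto.
    intros n; simpl; specialize (Hf n); lra. }
  destruct H as [l Hl]. exists l. apply is_series_Rsum; exact Hl.
Qed.

Lemma ex_series_Rmult c (f : nat -> R) : ex_series f -> ex_series (fun k => c * f k).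
Proof. intros H; exact (@ex_series_scal R_AbsRing R_NormedModule c f H). Qed.

Lemma Rsum_le_Series f n :
  (forall k, 0 <= f k) -> ex_series f -> Rsum f n <= Series f.
Proof.
  intros Hf H. apply (is_lim_seq_incr_compare (Rsum f)).
  - apply is_lim_Rsum_Series, H.
  - intros k; simpl; specialize (Hf k); lra.
Qed.

Lemma Series_nonneg f : (forall k, 0 <= f k) -> ex_series f -> 0 <= Series f.
Proof. intros Hf H; exact (Rsum_le_Series f 0 Hf H). Qed.

Lemma Series_tail f n : ex_series f ->
  Series (fun k => f (n + k)%nat) = Series f - Rsum f n.
Proof.
  intros H. destruct n as [|n].
  - simpl. rewrite Rminus_0_r. reflexivity.
  - rewrite (Series_incr_n f (S n)); [|lia|exact H]. simpl pred.
    rewrite <- sum_n_Reals, Rsum_sum_n. ring.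
Qed.

Lemma Series_finite f n : (forall k, (n <= k)%nat -> f k = 0) ->
  is_series f (Rsum f n).
Proof.
  intros H. apply is_series_Rsum.
  apply is_lim_seq_ext_loc with (fun _ => Rsum f n); [|apply is_lim_seq_const].
  exists n. intros m Hm. induction Hm as [|m Hm IH]; [reflexivity|].
  simpl; rewrite <- IH, (H m Hm); ring.
Qed.

Lemma is_lim_seq_squeeze0 u v :
  (forall n, 0 <= u n <= v n) -> is_lim_seq v 0 -> is_lim_seq u 0.
Proof.
  intros H Hv. apply is_lim_seq_le_le with (fun _ => 0) v; auto.
  apply is_lim_seq_const.
Qed.

Lemma is_lim_seq_plus0 u v :
  is_lim_seq u 0 -> is_lim_seq v 0 -> is_lim_seq (fun n => u n + v n) 0.
Proof.
  intros Hu Hv. replace (Finite 0) with (Finite (0 + 0)) by (f_equal; ring).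
  apply is_lim_seq_plus'; assumption.
Qed.

Lemma is_lim_seq_scal0 c u : is_lim_seq u 0 -> is_lim_seq (fun n => c * u n) 0.
Proof.
  intros Hu. replace (Finite 0) with (Rbar_mult c 0) by (simpl; f_equal; ring).
  apply is_lim_seq_scal_l; assumption.
Qed.

Lemma is_lim_seq_0_eps u : (forall n, 0 <= u n) ->
  (forall eps, 0 < eps -> eventually (fun n => u n <= eps)) -> is_lim_seq u 0.
Proof.
  intros Hu H. apply is_lim_seq_spec. intros eps.
  destruct (H (eps / 2)) as [N HN]; [destruct eps; simpl; lra|].
  exists N; intros n Hn. specialize (HN n Hn). specialize (Hu n).
  rewrite Rminus_0_r, Rabs_right by lra. destruct eps; simpl in *; lra.
Qed.

Lemma is_lim_seq_0_eventually u eps : is_lim_seq u 0 -> 0 < eps ->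
  eventually (fun n => Rabs (u n) < eps).
Proof.
  intros Hu He. apply is_lim_seq_spec in Hu. destruct (Hu (mkposreal eps He)) as [N HN].
  exists N; intros n Hn. specialize (HN n Hn). rewrite Rminus_0_r in HN. exact HN.
Qed.

Lemma is_lim_seq_eq u l1 l2 : is_lim_seq u (Finite l1) -> is_lim_seq u (Finite l2) -> l1 = l2.
Proof.
  intros H1 H2. apply is_lim_seq_unique in H1. apply is_lim_seq_unique in H2.
  congruence.
Qed.

(** Beyond a cutoff [K] the tail of [M] bounds all rows at once, and the finitely many remaining
    columns tend to 0. *)
Lemma tannery_0 (d : nat -> nat -> R) (M : nat -> R) :
  (forall k, is_lim_seq (fun n => d n k) 0) ->
  (forall n k, 0 <= d n k <= M k) -> ex_series M ->
  is_lim_seq (fun n => Series (d n)) 0.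
Proof.
  intros Hlim Hb HM.
  assert (Hex : forall n, ex_series (d n)).
  { intros n. apply @ex_series_le with M; auto.
    intros k; unfold norm; simpl; unfold abs; simpl.
    destruct (Hb n k); rewrite Rabs_right; lra. }
  apply is_lim_seq_0_eps.
  { intros n; apply Series_nonneg; auto. intros; apply Hb. }
  intros eps He.
  assert (Ht : is_lim_seq (fun K => Series M - Rsum M K) 0).
  { replace (Finite 0) with (Finite (Series M - Series M)) by (f_equal; ring).
    apply is_lim_seq_minus'; [apply is_lim_seq_const|apply is_lim_Rsum_Series, HM]. }
  destruct (is_lim_seq_0_eventually _ (eps / 2) Ht) as [K HK]; [lra|].
  specialize (HK K (le_n K)).
  assert (Hs : is_lim_seq (fun n => Rsum (d n) K) 0).
  { clear HK. induction K as [|K IH]; simpl; [apply is_lim_seq_const|].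
    apply is_lim_seq_plus0; auto. }
  destruct (is_lim_seq_0_eventually _ (eps / 2) Hs) as [N HN]; [lra|].
  exists N; intros n Hn. specialize (HN n Hn).
  assert (Htl : Series (fun k => d n (K + k)%nat) <= Series (fun k => M (K + k)%nat)).
  { apply Series_le; [intros; apply Hb|]. apply ex_series_incr_n, HM. }
  rewrite !Series_tail in Htl by auto.
  apply Rabs_def2 in HK. apply Rabs_def2 in HN. lra.
Qed.

(** [tannery_0] applied to [Rabs (a n k - l k)]: the bound by [M] passes to the limit [l], so
    [2 * M] dominates. *)
Lemma tannery (a : nat -> nat -> R) (l M : nat -> R) :
  (forall k, is_lim_seq (fun n => a n k) (l k)) ->
  (forall n k, Rabs (a n k) <= M k) -> ex_series M ->
  is_lim_seq (fun n => Series (a n)) (Series l).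
Proof.
  intros Hlim Hb HM.
  assert (Hl : forall k, Rabs (l k) <= M k).
  { intros k. refine (is_lim_seq_le (fun n => Rabs (a n k)) (fun _ => M k) (Rabs (l k)) (M k) _ _ _).
    - intros n; apply Hb.
    - apply (is_lim_seq_abs _ (l k)), Hlim.
    - apply is_lim_seq_const. }
  assert (Hex : forall b : nat -> R, (forall k, Rabs (b k) <= M k) -> ex_series b).
  { intros b H. apply @ex_series_le with M; auto. }
  assert (H0 : is_lim_seq (fun n => Series (fun k => Rabs (a n k - l k))) 0).
  { apply tannery_0 with (fun k => 2 * M k).
    - intros k. apply (is_lim_seq_abs_0 (fun n => a n k - l k)).
      replace (Finite 0) with (Finite (l k - l k)) by (f_equal; ring).
      apply is_lim_seq_minus'; [apply Hlim|apply is_lim_seq_const].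
    - intros n k. split; [apply Rabs_pos|].
      unfold Rminus. eapply Rle_trans; [apply Rabs_triang|]. rewrite Rabs_Ropp.
      specialize (Hb n k); specialize (Hl k); lra.
    - apply ex_series_Rmult, HM. }
  assert (H1 : is_lim_seq (fun n => Series (a n) - Series l) 0).
  { apply is_lim_seq_abs_0.
    apply is_lim_seq_squeeze0 with (2 := H0). intros n; split; [apply Rabs_pos|].
    rewrite <- Series_minus by auto.
    apply Series_Rabs.
    apply @ex_series_le with (fun k => 2 * M k).
    - intros k. unfold norm; simpl; unfold abs; simpl. rewrite Rabs_Rabsolu.
      unfold Rminus. eapply Rle_trans; [apply Rabs_triang|]. rewrite Rabs_Ropp.
      specialize (Hb n k); specialize (Hl k); lra.
    - apply ex_series_Rmult, HM. }
  replace (Finite (Series l)) with (Finite (0 + Series l)) by (f_equal; ring).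
  eapply is_lim_seq_ext; [|apply is_lim_seq_plus'; [exact H1|apply (is_lim_seq_const (Series l))]].
  intros n; simpl; ring.
Qed.

(** Complex convergence is recorded through a real sequence of distances, so that squeezing and the
    real limit lemmas apply; [Clim_filterlim] turns it into a filter limit when the product formula
    is delivered. *)
Definition Clim (c : nat -> C) (l : C) : Prop :=
  is_lim_seq (fun n => Cmod (Cminus (c n) l)) 0.

Lemma Clim_const l : Clim (fun _ => l) l.
Proof.
  red. apply is_lim_seq_ext with (fun _ => 0); [|apply is_lim_seq_const].
  intros n. replace (l - l)%C with (RtoC 0) by ring. now rewrite Cmod_0.
Qed.

Lemma Clim_ext_loc c d l :
  eventually (fun n => c n = d n) -> Clim c l -> Clim d l.
Proof.
  intros [N HN] H. red. eapply is_lim_seq_ext_loc; [|exact H].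
  exists N; intros n Hn. simpl. now rewrite HN.
Qed.

Lemma Clim_ext c d l : (forall n, c n = d n) -> Clim c l -> Clim d l.
Proof. intros H; apply Clim_ext_loc; exists O; intros; apply H. Qed.

Lemma Clim_Cmod c l : Clim c l -> is_lim_seq (fun n => Cmod (c n)) (Cmod l).
Proof.
  intros H.
  assert (H1 : is_lim_seq (fun n => Cmod (c n) - Cmod l) 0).
  { apply is_lim_seq_abs_0. apply is_lim_seq_squeeze0 with (2 := H).
    intros n; split; [apply Rabs_pos|].
    assert (T1 := Cmod_triangle (c n - l) l). assert (T2 := Cmod_triangle (- (c n - l)) (c n)).
    rewrite Cmod_opp in T2.
    replace (c n - l + l)%C with (c n) in T1 by ring.
    replace (- (c n - l) + c n)%C with l in T2 by ring.
    apply Rabs_le; lra. }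
  replace (Finite (Cmod l)) with (Finite (0 + Cmod l)) by (f_equal; ring).
  eapply is_lim_seq_ext; [|apply is_lim_seq_plus'; [exact H1|apply (is_lim_seq_const (Cmod l))]].
  intros n; simpl; ring.
Qed.

Lemma Clim_bounded c l : Clim c l -> exists M, 0 < M /\ forall n, Cmod (c n) <= M.
Proof.
  intros H. apply Clim_Cmod in H.
  destruct (filterlim_bounded (fun n => Cmod (c n))) as [M HM].
  { exists (Cmod l). exact H. }
  exists (Rabs M + 1). split; [assert (0 <= Rabs M) by apply Rabs_pos; lra|].
  intros n; specialize (HM n). unfold norm in HM; simpl in HM; unfold abs in HM; simpl in HM.
  assert (M <= Rabs M) by apply Rle_abs.
  assert (Cmod (c n) <= Rabs (Cmod (c n))) by apply Rle_abs. lra.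
Qed.

Lemma Clim_plus c d l m : Clim c l -> Clim d m ->
  Clim (fun n => Cplus (c n) (d n)) (Cplus l m).
Proof.
  intros Hc Hd. red.
  eapply is_lim_seq_squeeze0; [|apply is_lim_seq_plus0; [exact Hc|exact Hd]].
  intros n; split; [apply Cmod_ge_0|].
  replace (c n + d n - (l + m))%C with ((c n - l) + (d n - m))%C by ring.
  apply Cmod_triangle.
Qed.

Lemma Clim_mult c d l m : Clim c l -> Clim d m ->
  Clim (fun n => Cmult (c n) (d n)) (Cmult l m).
Proof.
  intros Hc Hd. destruct (Clim_bounded _ _ Hd) as [M [HM0 HM]]. red.
  eapply is_lim_seq_squeeze0;
    [|apply is_lim_seq_plus0; [apply (is_lim_seq_scal0 M), Hc|apply (is_lim_seq_scal0 (Cmod l)), Hd]].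
  intros n; split; [apply Cmod_ge_0|].
  replace (c n * d n - l * m)%C with ((c n - l) * d n + l * (d n - m))%C by ring.
  eapply Rle_trans; [apply Cmod_triangle|]. rewrite !Cmod_mult.
  apply Rplus_le_compat; [|lra].
  rewrite Rmult_comm. apply Rmult_le_compat_r; [apply Cmod_ge_0|apply HM].
Qed.

Lemma Clim_opp c l : Clim c l -> Clim (fun n => Copp (c n)) (Copp l).
Proof.
  intros H. red. eapply is_lim_seq_ext; [|exact H]. intros n; simpl.
  rewrite <- (Cmod_opp (c n - l)). f_equal; ring.
Qed.

Lemma Clim_minus c d l m : Clim c l -> Clim d m ->
  Clim (fun n => Cminus (c n) (d n)) (Cminus l m).
Proof. intros Hc Hd; apply Clim_plus; [|apply Clim_opp]; assumption. Qed.

Lemma Clim_unique c l m : Clim c l -> Clim c m -> l = m.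
Proof.
  intros H1 H2. assert (H := Clim_minus _ _ _ _ H1 H2).
  assert (H3 : Clim (fun _ => RtoC 0) (l - m)%C).
  { eapply Clim_ext; [|exact H]. intros n; simpl; ring. }
  apply Clim_Cmod in H3. rewrite Cmod_0 in H3.
  assert (E : 0 = Cmod (l - m)).
  { apply (is_lim_seq_eq (fun _ => 0)); [apply is_lim_seq_const|exact H3]. }
  symmetry in E. apply Cmod_eq_0 in E. replace l with (l - m + m)%C by ring. rewrite E; ring.
Qed.

Lemma Clim_0_Cmod c : is_lim_seq (fun n => Cmod (c n)) 0 -> Clim c (RtoC 0).
Proof.
  intros H. red. eapply is_lim_seq_ext; [|exact H]. intros n; simpl. f_equal; ring.
Qed.

Lemma Clim_incr_1 c l : Clim c l <-> Clim (fun n => c (S n)) l.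
Proof.
  unfold Clim. apply (is_lim_seq_incr_1 (fun n => Cmod (c n - l))).
Qed.

Lemma Cmod_le_abs z : Cmod z <= Rabs (Re z) + Rabs (Im z).
Proof.
  replace z with (RtoC (Re z) + (Ci * RtoC (Im z)))%C at 1.
  - eapply Rle_trans; [apply Cmod_triangle|]. rewrite Cmod_mult, !Cmod_R, Cmod_Ci. lra.
  - destruct z as [x y]. unfold Ci, RtoC, Cplus, Cmult; simpl. f_equal; ring.
Qed.

Lemma im_le_Cmod z : Rabs (Im z) <= Cmod z.
Proof. eapply Rle_trans; [|apply Rmax_Cmod]. apply Rmax_r. Qed.

Lemma Clim_components c l :
  is_lim_seq (fun n => Re (c n)) (Re l) -> is_lim_seq (fun n => Im (c n)) (Im l) -> Clim c l.
Proof.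
  intros H1 H2. red.
  assert (D : forall f : C -> R, is_lim_seq (fun n => f (c n)) (f l) ->
    is_lim_seq (fun n => Rabs (f (c n) - f l)) 0).
  { intros f H. apply (is_lim_seq_abs_0 (fun n => f (c n) - f l)).
    replace (Finite 0) with (Finite (f l - f l)) by (f_equal; ring).
    apply is_lim_seq_minus'; [exact H|apply is_lim_seq_const]. }
  eapply is_lim_seq_squeeze0; [|apply is_lim_seq_plus0; [apply (D Re H1)|apply (D Im H2)]].
  intros n; split; [apply Cmod_ge_0|]. eapply Rle_trans; [apply Cmod_le_abs|].
  apply Rle_refl.
Qed.

Lemma Clim_RtoC u l : is_lim_seq u (Finite l) -> Clim (fun n => RtoC (u n)) (RtoC l).
Proof.
  intros H; apply Clim_components; simpl; [exact H|apply is_lim_seq_const].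
Qed.

Lemma Clim_filterlim c l : Clim c l -> filterlim c eventually (locally l).
Proof.
  intros H P [eps HP].
  destruct (is_lim_seq_0_eventually _ eps H) as [N HN]; [apply cond_pos|].
  exists N. intros n Hn. apply HP. apply C_NormedModule_mixin_compat1.
  specialize (HN n Hn). rewrite Rabs_right in HN; [exact HN|].
  apply Rle_ge, Cmod_ge_0.
Qed.

(** With [e n = K / (1 - rho) * rho ^ n], whose decrements are exactly [K * rho ^ n], the sequences
    [u n - e n] and [u n + e n] are adjacent; their common limit lies between them for every [n]. *)
Lemma Rgeom_cauchy (u : nat -> R) K rho : 0 <= rho < 1 ->
  (forall n, Rabs (u (S n) - u n) <= K * rho ^ n) ->
  exists l, forall n, Rabs (u n - l) <= K / (1 - rho) * rho ^ n.
Proof.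
  intros Hr H. set (K' := K / (1 - rho)). set (e := fun n => K' * rho ^ n).
  assert (HE : forall n, e n - e (S n) = K * rho ^ n).
  { intros n; unfold e, K'; simpl; field; lra. }
  assert (H1 : forall n, u n - e n <= u (S n) - e (S n)).
  { intros n. specialize (H n); specialize (HE n). apply Rabs_le_between in H. lra. }
  assert (H2 : forall n, u (S n) + e (S n) <= u n + e n).
  { intros n. specialize (H n); specialize (HE n). apply Rabs_le_between in H. lra. }
  assert (He : is_lim_seq e 0).
  { apply (is_lim_seq_scal0 K' (fun n => rho ^ n)). apply is_lim_seq_geom.
    rewrite Rabs_right; lra. }
  destruct (ex_lim_seq_adj (fun n => u n - e n) (fun n => u n + e n)) as [[l1 L1] [[l2 L2] E]]; auto.
  { eapply is_lim_seq_ext; [|apply (is_lim_seq_scal0 2 e He)]. intros n; simpl; ring. }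
  rewrite (is_lim_seq_unique _ _ L1), (is_lim_seq_unique _ _ L2) in E. injection E as E; subst l2.
  exists l1. intros n.
  assert (A1 := is_lim_seq_incr_compare _ _ L1 H1 n).
  assert (A2 := is_lim_seq_decr_compare _ _ L2 H2 n). simpl in A1, A2.
  fold (e n). apply Rabs_le_between. lra.
Qed.

(** The factor 2 comes from adding the bounds for real and imaginary parts. *)
Lemma Cgeom_cauchy (u : nat -> C) K rho : 0 <= rho < 1 ->
  (forall n, Cmod (u (S n) - u n) <= K * rho ^ n) ->
  exists l, forall n, Cmod (u n - l) <= 2 * K / (1 - rho) * rho ^ n.
Proof.
  intros Hr H.
  destruct (Rgeom_cauchy (fun n => Re (u n)) K rho Hr) as [x Hx].
  { intros n; eapply Rle_trans; [|apply H]. apply (re_le_Cmod (u (S n) - u n)). }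
  destruct (Rgeom_cauchy (fun n => Im (u n)) K rho Hr) as [y Hy].
  { intros n; eapply Rle_trans; [|apply H]. apply (im_le_Cmod (u (S n) - u n)). }
  exists (x, y). intros n. eapply Rle_trans; [apply Cmod_le_abs|].
  specialize (Hx n); specialize (Hy n).
  replace (2 * K / (1 - rho) * rho ^ n) with (K / (1 - rho) * rho ^ n + K / (1 - rho) * rho ^ n)
    by (field; lra).
  change (Re (u n - (x, y))) with (Re (u n) - x). change (Im (u n - (x, y))) with (Im (u n) - y).
  lra.
Qed.

(** * Estimates for products of complex factors *)

Lemma Cprod_ext f g n : (forall k, (k < n)%nat -> f k = g k) -> Cprod f n = Cprod g n.
Proof.
  induction n as [|n IH]; intros H; simpl; [reflexivity|].
  rewrite IH, (H n); auto.
Qed.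

Lemma one_plus_Rsum_le_Cprod e n : (forall k, 0 <= e k) ->
  1 + Rsum e n <= Cmod (Cprod (fun k => RtoC (1 + e k)) n).
Proof.
  intros He. induction n as [|n IH]; simpl; [rewrite Cmod_1; lra|].
  rewrite Cmod_mult, Cmod_R, Rabs_right by (specialize (He n); lra).
  assert (0 <= Rsum e n) by (apply Rsum_nonneg; auto). specialize (He n). nra.
Qed.

Lemma Cmod_Cprod_le_exp f e n : (forall k, Cmod (f k) <= 1 + e k) ->
  Cmod (Cprod f n) <= exp (Rsum e n).
Proof.
  intros H. induction n as [|n IH]; simpl; [rewrite Cmod_1, exp_0; lra|].
  rewrite Cmod_mult, exp_plus.
  apply Rmult_le_compat; [apply Cmod_ge_0..|exact IH|].
  eapply Rle_trans; [apply H|]. apply exp_ineq1_le.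
Qed.

(** Telescoping, one factor being exchanged at a time; every mixed product is bounded by the
    exponential of the sum of the [e k]. *)
Lemma Cprod_diff_le f g e n E : (forall k, Cmod (f k) <= 1 + e k) ->
  (forall k, Cmod (g k) <= 1 + e k) -> (forall k, 0 <= e k) -> (forall m, Rsum e m <= E) ->
  Cmod (Cprod f n - Cprod g n) <= exp E * Rsum (fun k => Cmod (f k - g k)) n.
Proof.
  intros Hf Hg He HE.
  assert (Main : Cmod (Cprod f n - Cprod g n) <= exp (Rsum e n) * Rsum (fun k => Cmod (f k - g k)) n).
  { induction n as [|n IH]; simpl.
    - replace (1 - 1)%C with (RtoC 0) by ring. rewrite Cmod_0; lra.
    - replace (Cprod f n * f n - Cprod g n * g n)%C
        with ((Cprod f n - Cprod g n) * f n + Cprod g n * (f n - g n))%C by ring.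
      eapply Rle_trans; [apply Cmod_triangle|]. rewrite !Cmod_mult, exp_plus.
      assert (G := Cmod_Cprod_le_exp g e n Hg).
      assert (1 + e n <= exp (e n)) by apply exp_ineq1_le.
      specialize (Hf n). specialize (He n).
      assert (0 <= Cmod (Cprod f n - Cprod g n)) by apply Cmod_ge_0.
      assert (0 <= Cmod (f n - g n)) by apply Cmod_ge_0.
      assert (0 < exp (Rsum e n)) by apply exp_pos.
      assert (0 <= Rsum (fun k => Cmod (f k - g k)) n)
        by (apply Rsum_nonneg; intros; apply Cmod_ge_0).
      rewrite Rmult_plus_distr_l. apply Rplus_le_compat.
      + replace (exp (Rsum e n) * exp (e n) * Rsum (fun k => Cmod (f k - g k)) n)
          with ((exp (Rsum e n) * Rsum (fun k => Cmod (f k - g k)) n) * exp (e n)) by ring.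
        apply Rmult_le_compat; try lra. apply Cmod_ge_0.
      + apply Rmult_le_compat_r; [lra|].
        assert (1 <= exp (e n)) by lra. nra. }
  eapply Rle_trans; [exact Main|]. apply Rmult_le_compat_r.
  - apply Rsum_nonneg; intros; apply Cmod_ge_0.
  - destruct (Rle_lt_or_eq_dec _ _ (HE n)) as [L|L]; [|rewrite L; lra].
    left; apply exp_increasing, L.
Qed.

Lemma Cprod_shift f m n : Cprod f (m + n) = Cmult (Cprod f m) (Cprod (fun k => f (m + k)%nat) n).
Proof.
  induction n as [|n IH].
  - rewrite Nat.add_0_r; simpl; ring.
  - rewrite Nat.add_succ_r; simpl. rewrite IH; ring.
Qed.

(** The Weierstrass inequality. The bound 1 on the partial sums keeps [1 - Rsum e n] non-negative,
    so that the induction may multiply lower bounds. *)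
Lemma Cprod_near_1 f e n : (forall k, Cmod (f k - 1) <= e k) ->
  (forall k, 0 <= e k) -> (forall m, Rsum e m <= 1) -> 1 - Rsum e n <= Cmod (Cprod f n).
Proof.
  intros Hf He H1. induction n as [|n IH]; simpl; [rewrite Cmod_1; lra|].
  rewrite Cmod_mult.
  assert (1 - e n <= Cmod (f n)).
  { assert (T := Cmod_triangle (f n) (- (f n - 1))). rewrite Cmod_opp in T.
    replace (f n + - (f n - 1))%C with (RtoC 1) in T by ring. rewrite Cmod_1 in T.
    specialize (Hf n); lra. }
  assert (B := H1 (S n)). simpl in B.
  assert (0 <= Rsum e n) by (apply Rsum_nonneg; auto). specialize (He n).
  eapply Rle_trans; [|apply Rmult_le_compat with (3 := IH) (4 := H); lra]. nra.
Qed.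

(** Past some index [K] the remaining [e k] sum to at most 1/2, so the tail product has modulus at
    least 1/2; the head is a fixed nonzero product. *)
Lemma Cprod_bounded_below f e : (forall k, f k <> RtoC 0) ->
  (forall k, Cmod (f k - 1) <= e k) -> ex_series e ->
  exists c, 0 < c /\ eventually (fun n => c <= Cmod (Cprod f n)).
Proof.
  intros Hf He Hs.
  assert (He0 : forall k, 0 <= e k) by (intros k; eapply Rle_trans; [apply Cmod_ge_0|apply He]).
  assert (Ht : is_lim_seq (fun K => Series e - Rsum e K) 0).
  { replace (Finite 0) with (Finite (Series e - Series e)) by (f_equal; ring).
    apply is_lim_seq_minus'; [apply is_lim_seq_const|apply is_lim_Rsum_Series, Hs]. }
  destruct (is_lim_seq_0_eventually _ (1 / 2) Ht) as [K HK]; [lra|].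
  specialize (HK K (le_n K)). apply Rabs_def2 in HK.
  assert (Hsum : forall m, Rsum (fun k => e (K + k)%nat) m <= 1 / 2).
  { intros m. eapply Rle_trans.
    - apply Rsum_le_Series; [intros; apply He0|apply ex_series_incr_n, Hs].
    - rewrite Series_tail by exact Hs. lra. }
  assert (Hp : forall n, 0 < Cmod (Cprod f n)).
  { induction n as [|n IH]; simpl; [rewrite Cmod_1; lra|].
    rewrite Cmod_mult. apply Rmult_lt_0_compat; [exact IH|]. apply Cmod_gt_0, Hf. }
  exists (Cmod (Cprod f K) * (1 / 2)). split; [specialize (Hp K); lra|].
  exists K. intros n Hn. replace n with (K + (n - K))%nat by lia.
  rewrite Cprod_shift, Cmod_mult. apply Rmult_le_compat_l; [left; apply Hp|].
  assert (A := Cprod_near_1 (fun k => f (K + k)%nat) (fun k => e (K + k)%nat) (n - K)).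
  simpl in A. specialize (Hsum (n - K)%nat) as Hs1.
  enough (1 - Rsum (fun k => e (K + k)%nat) (n - K) <= Cmod (Cprod (fun k => f (K + k)%nat) (n - K))) by lra.
  apply A; auto. intros m; specialize (Hsum m); lra.
Qed.

(** * Sturm interlacing *)

(* [is_poly n l f]: [f] is a real polynomial of degree at most [n] whose
   coefficient of degree [n] is [l] (possibly [0]). *)
Fixpoint is_poly (n : nat) (l : R) (f : C -> C) : Prop :=
  match n with
  | O => forall z, f z = RtoC l
  | S m => exists (c : R) (g : C -> C),
      is_poly m l g /\ forall z, f z = Cplus (RtoC c) (Cmult z (g z))
  end.

Lemma is_poly_ext n l f g : (forall z, f z = g z) -> is_poly n l f -> is_poly n l g.
Proof.
  intros E; destruct n as [|n]; simpl.
  - intros H z; rewrite <- E; auto.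
  - intros (c & h & Hh & H); exists c, h; split; [exact Hh|].
    intros z; rewrite <- E; auto.
Qed.

Lemma is_poly_scal n a l f : is_poly n l f -> is_poly n (a * l) (fun z => Cmult (RtoC a) (f z)).
Proof.
  revert f; induction n as [|n IH]; simpl; intros f.
  - intros H z; now rewrite H, RtoC_mult.
  - intros (c & h & Hh & H). exists (a * c), (fun z => Cmult (RtoC a) (h z)).
    split; [apply IH, Hh|]. intros z; rewrite H, RtoC_mult; ring.
Qed.

Lemma is_poly_plus n l m f g : is_poly n l f -> is_poly n m g ->
  is_poly n (l + m) (fun z => Cplus (f z) (g z)).
Proof.
  revert f g; induction n as [|n IH]; simpl; intros f g.
  - intros H1 H2 z; now rewrite H1, H2, RtoC_plus.
  - intros (c & h & Hh & H) (d & k & Hk & H').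
    exists (c + d), (fun z => Cplus (h z) (k z)).
    split; [apply IH; assumption|]. intros z; rewrite H, H', RtoC_plus; ring.
Qed.

Lemma is_poly_weaken n l f : is_poly n l f -> is_poly (S n) 0 f.
Proof.
  revert f; induction n as [|n IH]; intros f.
  - intros H. exists l, (fun _ => RtoC 0). split; [intros z; reflexivity|].
    intros z; rewrite (H z); ring.
  - intros (c & h & Hh & H). exists c, h. split; [apply IH, Hh|exact H].
Qed.

Lemma is_poly_mulX n l f : is_poly n l f -> is_poly (S n) l (fun z => Cmult z (f z)).
Proof. intros H; exists 0, f; split; [exact H|]. intros z; ring. Qed.

(** Holds at 0 as well, where both inverses are 0 by convention. *)
Lemma RtoC_Rinv x : RtoC (/ x) = Cinv (RtoC x).
Proof.
  destruct (Req_dec x 0) as [->|H]; [|apply RtoC_inv, H].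
  unfold RtoC, Cinv; simpl. rewrite Rinv_0. f_equal; unfold Rdiv; ring.
Qed.

(** With [f z = c + z * h z] the difference is [(z - r) * h z + r * (h z - h r)], so the quotient is
    [h] plus [r] times the quotient for [h]; the latter has lower degree and leaves the leading
    coefficient alone. *)
Lemma is_poly_divided_difference n l f (r : R) : is_poly (S n) l f ->
  exists g, is_poly n l g /\
    forall z, Cminus (f z) (f (RtoC r)) = Cmult (Cminus z (RtoC r)) (g z).
Proof.
  revert f; induction n as [|n IH]; intros f (c & h & Hh & H).
  - exists h. split; [exact Hh|]. intros z. rewrite !H, !(Hh _). ring.
  - destruct (IH h Hh) as (g & Hg & E).
    exists (fun z => Cplus (h z) (Cmult (RtoC r) (g z))). split.
    + replace l with (l + r * 0) by ring.
      apply is_poly_plus; [exact Hh|].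
      apply (is_poly_ext (S n) (r * 0) (fun z => Cmult (RtoC r) (g z))); [reflexivity|].
      apply is_poly_scal. apply is_poly_weaken with l, Hg.
    + intros z. rewrite !H.
      replace (h z) with (h z - h (RtoC r) + h (RtoC r))%C at 1 by ring.
      replace (c + z * (h z - h r + h r) - (c + r * h r))%C
        with ((z - r) * h r + z * (h z - h r))%C by ring.
      replace (h z) with (h z - h (RtoC r) + h (RtoC r))%C at 2 by ring.
      rewrite E. ring.
Qed.

Lemma is_poly_real n l f (x : R) : is_poly n l f -> f (RtoC x) = RtoC (Re (f (RtoC x))).
Proof.
  revert f; induction n as [|n IH]; simpl; intros f.
  - intros H; rewrite H; reflexivity.
  - intros (c & h & Hh & H). rewrite H, (IH h Hh).
    rewrite <- RtoC_mult, <- RtoC_plus. reflexivity.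
Qed.

Lemma is_poly_continuity n l f : is_poly n l f -> continuity (fun x => Re (f (RtoC x))).
Proof.
  revert f; induction n as [|n IH]; simpl; intros f.
  - intros H x. apply continuity_pt_ext with (fun _ => l).
    + intros y; rewrite H; reflexivity.
    + apply continuity_pt_const. intros u v; reflexivity.
  - intros (c & h & Hh & H) x.
    apply continuity_pt_ext with (fun y => c + y * Re (h (RtoC y))).
    + intros y; rewrite H, (is_poly_real _ _ h y Hh).
      rewrite <- RtoC_mult, <- RtoC_plus. reflexivity.
    + apply (continuity_pt_plus (fun _ => c) (fun y => y * Re (h (RtoC y)))).
      * apply continuity_pt_const. intros u v; reflexivity.
      * apply (continuity_pt_mult (fun y => y) (fun y => Re (h (RtoC y)))).
        -- apply continuity_pt_id.
        -- apply (IH h Hh).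
Qed.

Lemma RtoC_neq_0 x : x <> 0 -> RtoC x <> RtoC 0.
Proof. intros H E; apply H; exact (f_equal fst E). Qed.

Lemma Cprod_neq_0 f n : (forall k, (k < n)%nat -> f k <> RtoC 0) -> Cprod f n <> RtoC 0.
Proof.
  induction n as [|n IH]; intros H; simpl; [apply RtoC_neq_0; lra|].
  apply Cmult_neq_0; [apply IH; intros; apply H; lia|apply H; lia].
Qed.

Lemma Cprod_zero f n k : (k < n)%nat -> f k = RtoC 0 -> Cprod f n = RtoC 0.
Proof.
  intros Hk E; induction n as [|n IH]; simpl; [lia|].
  destruct (Nat.eq_dec k n) as [->|]; [rewrite E; ring|]. rewrite IH by lia; ring.
Qed.

(** Factors are parametrized by the reciprocal of the zero: [w k = 0] then stands for an absent zero
    and gives the factor 1, and zeros that decrease with the degree become increasing bounded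
    sequences. *)
Definition zfac (w : nat -> R) (z : C) (k : nat) : C := Cminus (RtoC 1) (Cmult z (RtoC (w k))).

Lemma zfac_zero w k : w k <> 0 -> zfac w (RtoC (/ w k)) k = RtoC 0.
Proof. intros H; unfold zfac. rewrite RtoC_Rinv. field. apply RtoC_neq_0, H. Qed.

(** Roots are divided out one by one, distinctness keeping the earlier factors nonzero at the next
    root. Each division multiplies the leading coefficient by [- / w m]; the sign is recorded
    because [sturm_step] deduces from it that the last zero is positive. *)
Lemma is_poly_factor_roots m : forall n l f (w : nat -> R), is_poly (m + n) l f ->
  (forall k, (k < m)%nat -> 0 < w k) ->
  (forall j k, (j < k)%nat -> (k < m)%nat -> w k < w j) ->
  (forall k, (k < m)%nat -> f (RtoC (/ w k)) = RtoC 0) -> l <> 0 ->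
  exists g l', is_poly n l' g /\ (forall z, f z = Cmult (Cprod (zfac w z) m) (g z)) /\
    0 < (-1) ^ m * l * l'.
Proof.
  induction m as [|m IH]; intros n l f w Hf Hw Hd Hz Hl.
  - exists f, l. split; [exact Hf|]. split; [intros z; simpl; ring|].
    simpl. assert (0 < l * l) by (apply Rsqr_pos_lt in Hl; exact Hl). lra.
  - destruct (IH (S n) l f w) as (g & l' & Hg & E & Hs).
    + rewrite Nat.add_succ_r; exact Hf.
    + intros; apply Hw; lia.
    + intros; apply Hd; lia.
    + intros; apply Hz; lia.
    + exact Hl.
    + assert (Hwm : 0 < w m) by (apply Hw; lia).
      assert (G0 : g (RtoC (/ w m)) = RtoC 0).
      { assert (H := Hz m (Nat.lt_succ_diag_r m)). rewrite E in H.
        assert (P : Cprod (zfac w (RtoC (/ w m))) m <> RtoC 0).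
        { apply Cprod_neq_0. intros k Hk. unfold zfac.
          rewrite <- RtoC_mult, <- RtoC_minus. apply RtoC_neq_0.
          assert (w m < w k) by (apply Hd; lia).
          assert (/ w m * w m = 1) by (field; lra).
          assert (0 < / w m) by (apply Rinv_0_lt_compat; lra). nra. }
        replace (g (RtoC (/ w m)))
          with (/ Cprod (zfac w (RtoC (/ w m))) m * (Cprod (zfac w (RtoC (/ w m))) m * g (RtoC (/ w m))))%C
          by (field; exact P).
        rewrite H. ring. }
      destruct (is_poly_divided_difference n l' g (/ w m) Hg) as (h & Hh & Eh).
      exists (fun z => Cmult (RtoC (- / w m)) (h z)), (- / w m * l').
      split; [apply is_poly_scal, Hh|]. split.
      * intros z. rewrite E. simpl.
        replace (g z) with (g z - g (RtoC (/ w m)))%C by (rewrite G0; ring).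
        rewrite Eh. unfold zfac at 3. rewrite RtoC_opp, RtoC_Rinv. field.
        apply RtoC_neq_0; lra.
      * simpl. assert (0 < / w m) by (apply Rinv_0_lt_compat; lra).
        replace (-1 * (-1) ^ m * l * (- / w m * l')) with (/ w m * ((-1) ^ m * l * l')) by ring.
        apply Rmult_lt_0_compat; assumption.
Qed.

Fixpoint Rprod (f : nat -> R) (n : nat) : R :=
  match n with O => 1 | S m => Rprod f m * f m end.

Lemma Cprod_RtoC f n : Cprod (fun k => RtoC (f k)) n = RtoC (Rprod f n).
Proof. induction n as [|n IH]; simpl; [reflexivity|]. now rewrite IH, RtoC_mult. Qed.

Lemma Cprod_zfac_real w x n :
  Cprod (zfac w (RtoC x)) n = RtoC (Rprod (fun k => 1 - x * w k) n).
Proof.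
  rewrite <- Cprod_RtoC. apply Cprod_ext; intros k _.
  unfold zfac. now rewrite RtoC_minus, RtoC_mult.
Qed.

Lemma Rprod_sign f n j : (j <= n)%nat -> (forall k, (k < j)%nat -> f k < 0) ->
  (forall k, (j <= k)%nat -> (k < n)%nat -> 0 < f k) -> 0 < (-1) ^ j * Rprod f n.
Proof.
  revert j; induction n as [|n IH]; intros j Hj Hneg Hpos.
  - replace j with O by lia. simpl; lra.
  - destruct (Nat.eq_dec j (S n)) as [->|Hjn].
    + simpl. assert (H := IH n (le_n n)).
      replace (-1 * (-1) ^ n * (Rprod f n * f n)) with ((-1) ^ n * Rprod f n * - f n) by ring.
      apply Rmult_lt_0_compat.
      * apply H; [intros; apply Hneg; lia|intros; lia].
      * assert (f n < 0) by (apply Hneg; lia). lra.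
    + simpl. rewrite <- Rmult_assoc. apply Rmult_lt_0_compat.
      * apply IH; [lia|exact Hneg|intros; apply Hpos; lia].
      * apply Hpos; lia.
Qed.

Lemma IVT_open f x y : continuity f -> x < y -> f x * f y < 0 ->
  exists z, x < z < y /\ f z = 0.
Proof.
  intros Hc Hxy Hs.
  destruct (IVT_cor f x y Hc) as [z [Hz E]]; [lra|lra|].
  exists z. split; [|exact E].
  assert (z <> x) by (intros ->; rewrite E in Hs; lra).
  assert (z <> y) by (intros ->; rewrite E in Hs; lra). lra.
Qed.

Lemma pow_m1_sqr k : (-1) ^ k * (-1) ^ k = 1.
Proof. rewrite <- Rpow_mult_distr. replace (-1 * -1) with 1 by ring. apply pow1. Qed.

(** * The polynomials of a birth-and-death operator *)

Section Orthogonal_polynomials.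

Context (lam mu : nat -> R).
Context (lam_pos : forall n, 0 < lam n) (mu_pos : forall n, 0 < mu (S n)).

(** The symmetrizing weights, fixed by detailed balance [lam n * bdpi n = mu (S n) * bdpi (S n)] and
    [bdpi 0 = 1]. *)
Fixpoint bdpi (n : nat) : R :=
  match n with O => 1 | S m => bdpi m * lam m / mu (S m) end.

(* [QR z n] is the pair of [Q_n z] and [sum_(j <= n) bdpi j * Q_j z]. *)
Fixpoint QR (z : C) (n : nat) : C * C :=
  match n with
  | O => (RtoC 1, RtoC 1)
  | S m =>
      let q := Cminus (fst (QR z m)) (Cdiv (Cmult z (snd (QR z m))) (RtoC (lam m * bdpi m))) in
      (q, Cplus (snd (QR z m)) (Cmult (RtoC (bdpi (S m))) q))
  end.

Definition Qn (z : C) (n : nat) : C := fst (QR z n).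
Definition Rn (z : C) (n : nat) : C := snd (QR z n).

Lemma bdpi_pos n : 0 < bdpi n.
Proof.
  induction n as [|n IH]; simpl; [lra|].
  apply Rdiv_lt_0_compat; [apply Rmult_lt_0_compat; auto|apply mu_pos].
Qed.

Lemma lampi_pos n : 0 < lam n * bdpi n.
Proof. apply Rmult_lt_0_compat; [apply lam_pos|apply bdpi_pos]. Qed.

Lemma Qn_S z n : Qn z (S n) = Cminus (Qn z n) (Cdiv (Cmult z (Rn z n)) (RtoC (lam n * bdpi n))).
Proof. reflexivity. Qed.

Lemma Rn_S z n : Rn z (S n) = Cplus (Rn z n) (Cmult (RtoC (bdpi (S n))) (Qn z (S n))).
Proof. reflexivity. Qed.

Lemma lampi_mupi n : lam n * bdpi n = mu (S n) * bdpi (S n).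
Proof. simpl. field. specialize (mu_pos n); lra. Qed.

Lemma Qn_diff z n :
  Cmult (RtoC (lam n * bdpi n)) (Cminus (Qn z n) (Qn z (S n))) = Cmult z (Rn z n).
Proof.
  rewrite Qn_S. field. apply RtoC_neq_0. assert (H := lampi_pos n); lra.
Qed.

(** Difference of [Qn_diff] at [S n] and at [n], divided by [bdpi (S n)]. *)
Lemma Qn_rec z n :
  Cplus (Cmult (RtoC (lam (S n))) (Cminus (Qn z (S n)) (Qn z (S (S n)))))
        (Cmult (RtoC (mu (S n))) (Cminus (Qn z (S n)) (Qn z n))) = Cmult z (Qn z (S n)).
Proof.
  assert (H1 := Qn_diff z (S n)). assert (H0 := Qn_diff z n).
  rewrite Rn_S in H1. rewrite lampi_mupi in H0.
  assert (Hp : RtoC (bdpi (S n)) <> RtoC 0).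
  { apply RtoC_neq_0. assert (P := bdpi_pos (S n)); lra. }
  rewrite RtoC_mult in H0, H1.
  assert (E : (RtoC (bdpi (S n)) * (RtoC (lam (S n)) * (Qn z (S n) - Qn z (S (S n))) +
     RtoC (mu (S n)) * (Qn z (S n) - Qn z n)) = RtoC (bdpi (S n)) * (z * Qn z (S n)))%C).
  { transitivity ((RtoC (lam (S n)) * RtoC (bdpi (S n)) * (Qn z (S n) - Qn z (S (S n))))
      - (RtoC (mu (S n)) * RtoC (bdpi (S n)) * (Qn z n - Qn z (S n))))%C; [ring|].
    rewrite H1, H0. ring. }
  apply (f_equal (fun u => Cmult (/ RtoC (bdpi (S n))) u)) in E.
  rewrite !Cmult_assoc, Cinv_l, !Cmult_1_l in E by exact Hp. exact E.
Qed.

(** [Qn] and [Rn] feed each other, so their degrees are carried together; the leading coefficient of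
    [Qn] is multiplied by [- / lam n] at each step, whence its alternating sign. *)
Lemma Qn_poly n : exists l, is_poly n l (fun z => Qn z n) /\
  is_poly n (bdpi n * l) (fun z => Rn z n) /\ 0 < (-1) ^ n * l.
Proof.
  induction n as [|n (l & HQ & HR & Hs)].
  - exists 1. split; [intros z; reflexivity|]. split; [|simpl; lra].
    intros z; simpl. rewrite Rmult_1_l; reflexivity.
  - assert (P := bdpi_pos n). assert (L := lam_pos n).
    set (l' := - / (lam n * bdpi n) * (bdpi n * l)).
    assert (HQ' : is_poly (S n) l' (fun z => Qn z (S n))).
    { apply is_poly_ext with (fun z => Cplus (Qn z n)
        (Cmult (RtoC (- / (lam n * bdpi n))) (Cmult z (Rn z n)))).
      - intros z. rewrite Qn_S, RtoC_opp, RtoC_Rinv. unfold Cdiv. ring.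
      - replace l' with (0 + l') by ring. apply is_poly_plus.
        + apply is_poly_weaken with l, HQ.
        + apply is_poly_scal, is_poly_mulX, HR. }
    exists l'. split; [exact HQ'|]. split.
    + apply is_poly_ext with (fun z => Cplus (Rn z n) (Cmult (RtoC (bdpi (S n))) (Qn z (S n)))).
      * intros z; symmetry; apply Rn_S.
      * replace (bdpi (S n) * l') with (0 + bdpi (S n) * l') by ring. apply is_poly_plus.
        -- apply is_poly_weaken with (bdpi n * l), HR.
        -- apply is_poly_scal, HQ'.
    + unfold l'. simpl. replace (-1 * (-1) ^ n * (- / (lam n * bdpi n) * (bdpi n * l)))
        with ((-1) ^ n * l * / lam n) by (field; lra).
      apply Rmult_lt_0_compat; [exact Hs|]. apply Rinv_0_lt_compat, L.
Qed.

Lemma Qn_at_0 n : Qn (RtoC 0) n = RtoC 1.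
Proof.
  induction n as [|n IH]; [reflexivity|]. rewrite Qn_S, IH. unfold Cdiv. ring.
Qed.

(* Up to index [n], [w] lists the reciprocals of the zeros of [Qn _ n]. *)
Definition zeros (n : nat) (w : nat -> R) : Prop :=
  (forall k, (k < n)%nat -> 0 < w k) /\ (forall k, (n <= k)%nat -> w k = 0) /\
  (forall z, Qn z n = Cprod (zfac w z) n).

(** Read for reciprocals in decreasing order: each zero of the lower degree separates two
    consecutive zeros of the next degree. *)
Definition interlace (n : nat) (x y : nat -> R) : Prop :=
  forall k, (k < n)%nat -> x k < y k /\ y (S k) < x k.

Lemma interlace_decr n x y : interlace n x y ->
  forall j k, (j < k)%nat -> (k <= n)%nat -> y k < y j.
Proof.
  intros H j k Hjk. induction Hjk as [|k Hjk IH]; intros Hk.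
  - destruct (H j Hk); lra.
  - assert (y k < y j) by (apply IH; lia). destruct (H k Hk); lra.
Qed.

(** At a zero [/ y k] of degree [S n] the recurrence reduces to a negative multiple of the value in
    degree [n], whose sign is known from interlacing. So the next polynomial alternates in sign at
    [0, / y 0, ..., / y n], which yields [n + 1] roots; the last one is read off the remaining
    linear factor. *)
Lemma sturm_step n x y : zeros n x -> zeros (S n) y -> interlace n x y ->
  exists w, zeros (S (S n)) w /\ interlace (S n) y w.
Proof.
  intros (Hx & _ & Ex) (Hy & _ & Ey) HI.
  assert (Hdec := interlace_decr n x y HI).
  destruct (Qn_poly (S (S n))) as (l & Hpoly & _ & Hlead).
  set (f := fun s => Re (Qn (RtoC s) (S (S n)))).
  assert (fC : forall s, Qn (RtoC s) (S (S n)) = RtoC (f s)).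
  { intros s. exact (is_poly_real _ _ (fun z => Qn z (S (S n))) s Hpoly). }
  assert (fcont : continuity f) by exact (is_poly_continuity _ _ _ Hpoly).
  assert (f0 : f 0 = 1) by (unfold f; rewrite Qn_at_0; reflexivity).
  assert (Hsign : forall k, (k <= n)%nat -> 0 < (-1) ^ (S k) * f (/ y k)).
  { intros k Hk.
    assert (Hyk : 0 < y k) by (apply Hy; lia).
    assert (Hiy : 0 < / y k) by (apply Rinv_0_lt_compat; lra).
    assert (E1 : / y k * y k = 1) by (field; lra).
    assert (S1 : 0 < (-1) ^ k * Rprod (fun i => 1 - / y k * x i) n).
    { apply Rprod_sign; [exact Hk|..].
      - intros i Hi. assert (y k < x i); [|nra].
        destruct (HI i) as [_ A]; [lia|].
        destruct (Nat.eq_dec (S i) k) as [<-|Hne]; [exact A|].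
        assert (y k < y (S i)) by (apply Hdec; lia). lra.
      - intros i Hki Hi. assert (x i < y k); [|nra].
        destruct (HI i Hi) as [A _].
        destruct (Nat.eq_dec k i) as [->|Hne]; [exact A|].
        assert (y i < y k) by (apply Hdec; lia). lra. }
    assert (H := Qn_rec (RtoC (/ y k)) n).
    assert (Z : Qn (RtoC (/ y k)) (S n) = RtoC 0).
    { rewrite Ey. apply Cprod_zero with k; [lia|]. apply zfac_zero; lra. }
    rewrite Z, fC, Ex, Cprod_zfac_real in H.
    rewrite <- !RtoC_minus, <- !RtoC_mult, <- RtoC_plus in H.
    apply RtoC_inj in H.
    assert (L := lam_pos (S n)). assert (M := mu_pos n).
    set (P := Rprod _ n) in *.
    assert (E2 : f (/ y k) = - (mu (S n) / lam (S n)) * P) by (field_simplify_eq; lra).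
    rewrite E2. simpl.
    replace (-1 * (-1) ^ k * (- (mu (S n) / lam (S n)) * P))
      with ((mu (S n) / lam (S n)) * ((-1) ^ k * P)) by ring.
    apply Rmult_lt_0_compat; [apply Rdiv_lt_0_compat; assumption|exact S1]. }
  (* The gaps are [(0, / y 0)], where [f 0 = 1] supplies the sign at the left end, and the [n]
     intervals between consecutive [/ y j]. *)
  assert (Hroot : forall k, (k <= n)%nat ->
    exists w, y k < w /\ (forall j, k = S j -> w < y j) /\ f (/ w) = 0).
  { intros k Hk. assert (Hyk : 0 < y k) by (apply Hy; lia).
    assert (Hlt : forall s, 0 < s -> s < / y k -> y k < / s).
    { intros s Hs Hlt. rewrite <- (Rinv_inv (y k)). apply Rinv_lt_contravar; [|exact Hlt].
      apply Rmult_lt_0_compat; [exact Hs|]. apply Rinv_0_lt_compat, Hyk. }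
    assert (Hk1 := Hsign k Hk).
    destruct k as [|j].
    - destruct (IVT_open f 0 (/ y 0%nat) fcont) as (s & [Hs1 Hs2] & Es).
      + apply Rinv_0_lt_compat, Hyk.
      + rewrite f0. simpl in Hk1; lra.
      + exists (/ s). split; [apply Hlt; assumption|]. split; [intros j Hj; discriminate|].
        rewrite Rinv_inv; exact Es.
    - assert (Hyj : 0 < y j) by (apply Hy; lia).
      assert (Hij : 0 < / y j) by (apply Rinv_0_lt_compat, Hyj).
      destruct (IVT_open f (/ y j) (/ y (S j)) fcont) as (s & [Hs1 Hs2] & Es).
      + apply Rinv_lt_contravar; [apply Rmult_lt_0_compat; lra|]. apply Hdec; lia.
      + assert (Hk0 := Hsign j ltac:(lia)).
        assert (Hpp := Rmult_lt_0_compat _ _ Hk0 Hk1). simpl in Hpp.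
        assert (Hm := pow_m1_sqr j).
        replace (-1 * (-1) ^ j * f (/ y j) * (-1 * (-1 * (-1) ^ j) * f (/ y (S j))))
          with (- ((-1) ^ j * (-1) ^ j) * (f (/ y j) * f (/ y (S j)))) in Hpp by ring.
        rewrite Hm in Hpp. lra.
      + exists (/ s). split; [apply Hlt; lra|]. split.
        * intros j' Ej; injection Ej as <-. rewrite <- (Rinv_inv (y j)).
          apply Rinv_lt_contravar; [apply Rmult_lt_0_compat; lra|exact Hs1].
        * rewrite Rinv_inv; exact Es. }
  set (w := fun k => epsilon (inhabits 0) (fun w => y k < w /\ (forall j, k = S j -> w < y j) /\ f (/ w) = 0)).
  assert (Hw : forall k, (k <= n)%nat ->
    y k < w k /\ (forall j, k = S j -> w k < y j) /\ f (/ w k) = 0).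
  { intros k Hk. apply epsilon_spec, Hroot, Hk. }
  assert (Hwpos : forall k, (k < S n)%nat -> 0 < w k).
  { intros k Hk. destruct (Hw k) as [A _]; [lia|]. specialize (Hy k Hk). lra. }
  destruct (is_poly_factor_roots (S n) 1 l (fun z => Qn z (S (S n))) w) as (g & l' & Hg & Eg & Hl').
  - replace (S n + 1)%nat with (S (S n)) by lia. exact Hpoly.
  - exact Hwpos.
  - intros j k Hjk Hk. destruct k as [|k]; [lia|].
    destruct (Hw (S k)) as (_ & A & _); [lia|]. specialize (A k eq_refl).
    destruct (Hw j) as (B & _); [lia|].
    destruct (Nat.eq_dec j k) as [->|Hne]; [lra|].
    assert (y k < y j) by (apply Hdec; lia). lra.
  - intros k Hk. rewrite fC. destruct (Hw k) as (_ & _ & A); [lia|]. now rewrite A.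
  - intros E; rewrite E, Rmult_0_r in Hlead; lra.
  (* The cofactor is linear, [c + z * l']. Evaluation at 0, where every [Qn] is 1, gives [c = 1], so
     the last reciprocal zero is [- l']. *)
  - destruct Hg as (c & h & Hh & Egz).
    assert (Ec : c = 1).
    { assert (A := Eg (RtoC 0)). cbv beta in A.
      rewrite Qn_at_0, Egz, Cprod_zfac_real in A.
      rewrite (Hh _), <- !RtoC_mult, <- RtoC_plus, <- RtoC_mult in A.
      apply RtoC_inj in A.
      assert (P1 : Rprod (fun k => 1 - 0 * w k) (S n) = 1).
      { generalize (S n); intros m; induction m as [|m IHm]; simpl; [reflexivity|].
        rewrite IHm; ring. }
      rewrite P1 in A. lra. }
    subst c. set (t := - l').
    assert (Ht0 : 0 < t).
    { unfold t. simpl in Hl', Hlead. assert (Hm := pow_m1_sqr n).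
      replace (-1 * (-1) ^ n * l * l') with ((-1 * (-1 * (-1) ^ n) * l) * - l') in Hl' by ring.
      destruct (Rlt_or_le 0 (- l')) as [A|A]; [exact A|].
      assert (0 <= (-1 * (-1 * (-1) ^ n) * l) * l') by (apply Rmult_le_pos; lra). lra. }
    (* At [/ y n] the polynomial and the product of its [n + 1] known factors have the same sign, so
       the last factor is positive there: the last zero lies beyond [/ y n]. *)
    assert (Htn : t < y n).
    { assert (A := Hsign n (le_n n)).
      assert (B : f (/ y n) = Rprod (fun k => 1 - / y n * w k) (S n) * (1 - / y n * t)).
      { assert (B := Eg (RtoC (/ y n))). cbv beta in B.
        rewrite fC, Egz, Cprod_zfac_real, (Hh _) in B.
        rewrite <- !RtoC_mult, <- RtoC_plus, <- RtoC_mult in B.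
        apply RtoC_inj in B. rewrite B. unfold t. ring. }
      assert (Hyn : 0 < y n) by (apply Hy; lia).
      assert (Hin : 0 < / y n) by (apply Rinv_0_lt_compat, Hyn).
      assert (E1 : / y n * y n = 1) by (field; lra).
      assert (P : 0 < (-1) ^ (S n) * Rprod (fun k => 1 - / y n * w k) (S n)).
      { apply Rprod_sign; [lia| |intros; lia].
        intros k Hk. destruct (Hw k) as [W _]; [lia|].
        assert (y n <= y k).
        { destruct (Nat.eq_dec k n) as [->|]; [lra|]. left; apply Hdec; lia. }
        nra. }
      rewrite B in A. rewrite <- Rmult_assoc in A.
      destruct (Rlt_or_le t (y n)) as [Q|Q]; [exact Q|].
      assert (1 - / y n * t <= 0) by nra.
      assert (0 <= (-1) ^ S n * Rprod (fun k => 1 - / y n * w k) (S n) * - (1 - / y n * t))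
        by (apply Rmult_le_pos; lra). lra. }
    set (v := fun k => if (k <=? n)%nat then w k else if (k =? S n)%nat then t else 0).
    assert (Hv1 : forall k, (k <= n)%nat -> v k = w k).
    { intros k Hk. unfold v. apply Nat.leb_le in Hk. now rewrite Hk. }
    assert (Hv2 : v (S n) = t).
    { unfold v. destruct (Nat.leb_spec (S n) n); [lia|]. now rewrite Nat.eqb_refl. }
    exists v. split; [split; [|split]|].
    + intros k Hk. destruct (Nat.eq_dec k (S n)) as [->|]; [now rewrite Hv2|].
      rewrite Hv1 by lia. apply Hwpos; lia.
    + intros k Hk. unfold v. destruct (Nat.leb_spec k n); [lia|].
      destruct (Nat.eqb_spec k (S n)); [lia|reflexivity].
    + intros z. assert (A := Eg z). cbv beta in A. rewrite A.
      change (Cprod (zfac v z) (S (S n))) with (Cmult (Cprod (zfac v z) (S n)) (zfac v z (S n))).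
      f_equal.
      * apply Cprod_ext. intros k Hk. unfold zfac. rewrite Hv1 by lia. reflexivity.
      * unfold zfac. rewrite Hv2, Egz, (Hh _). unfold t. rewrite RtoC_opp. ring.
    + intros k Hk. rewrite (Hv1 k) by lia. destruct (Hw k) as (A & _ & _); [lia|].
      split; [exact A|]. destruct (Nat.eq_dec k n) as [->|]; [now rewrite Hv2|].
      rewrite Hv1 by lia. destruct (Hw (S k)) as (_ & B & _); [lia|]. now apply B.
Qed.

(** The list for degree [S m] is chosen relative to that for degree [m], so that interlacing is part
    of the choice; [rzero_spec] carries two consecutive degrees, as [sturm_step] requires. *)
Fixpoint rzero (n : nat) : nat -> R :=
  match n with
  | O => fun _ => 0
  | S m => epsilon (inhabits (fun _ => 0)) (fun w => zeros (S m) w /\ interlace m (rzero m) w)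
  end.

Lemma rzero_spec n : zeros n (rzero n) /\ zeros (S n) (rzero (S n)) /\
  interlace n (rzero n) (rzero (S n)).
Proof.
  induction n as [|n (H0 & H1 & H2)].
  - assert (Z0 : zeros 0 (rzero 0)).
    { split; [intros; lia|]. split; [reflexivity|]. intros z; reflexivity. }
    split; [exact Z0|]. simpl rzero. apply epsilon_spec.
    exists (fun k => match k with O => / lam 0 | S _ => 0 end).
    split; [|intros k Hk; lia].
    split; [|split].
    + intros k Hk. replace k with O by lia. apply Rinv_0_lt_compat, lam_pos.
    + intros k Hk. destruct k; [lia|reflexivity].
    + intros z. rewrite Qn_S. unfold Qn, Rn. simpl. unfold zfac.
      rewrite Rmult_1_r, RtoC_Rinv. field. apply RtoC_neq_0. specialize (lam_pos 0%nat); lra.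
  - split; [exact H1|].
    change (rzero (S (S n))) with (epsilon (inhabits (fun _ => 0))
      (fun w => zeros (S (S n)) w /\ interlace (S n) (rzero (S n)) w)).
    apply epsilon_spec. exact (sturm_step n _ _ H0 H1 H2).
Qed.

Lemma rzero_zeros n : zeros n (rzero n).
Proof. apply rzero_spec. Qed.

Lemma rzero_interlace n : interlace n (rzero n) (rzero (S n)).
Proof. apply rzero_spec. Qed.

Lemma rzero_nonneg n k : 0 <= rzero n k.
Proof.
  destruct (rzero_zeros n) as (A & B & _).
  destruct (Nat.lt_ge_cases k n) as [H|H]; [left; auto|rewrite B; auto; lra].
Qed.

Lemma rzero_incr n k : rzero n k <= rzero (S n) k.
Proof.
  destruct (Nat.lt_ge_cases k n) as [H|H].
  - left; apply (rzero_interlace n k H).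
  - destruct (rzero_zeros n) as (_ & B & _). rewrite B by exact H. apply rzero_nonneg.
Qed.

(** Entries beyond [n] are 0 and contribute factors 1, so products for different degrees can be
    taken over a common range. *)
Lemma Qn_product z n m : (n <= m)%nat -> Qn z n = Cprod (zfac (rzero n) z) m.
Proof.
  destruct (rzero_zeros n) as (_ & B & E). intros H. rewrite E.
  induction H as [|m H IH]; [reflexivity|]. simpl. rewrite <- IH.
  unfold zfac at 3. rewrite B by exact H. ring.
Qed.

(** The other half of interlacing; in the limit it orders the [rlim k], but only weakly. *)
Lemma rzero_le_S_decr n k : rzero (S n) (S k) <= rzero n k.
Proof.
  destruct (Nat.lt_ge_cases k n) as [H|H].
  - left; apply (rzero_interlace n k H).
  - destruct (rzero_zeros (S n)) as (_ & B & _). rewrite B by lia. apply rzero_nonneg.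
Qed.

End Orthogonal_polynomials.

(** * Limits of the zeros *)

Lemma pow_swap x m n : (x ^ m) ^ n = (x ^ n) ^ m.
Proof. rewrite <- !pow_mult. f_equal; lia. Qed.

Lemma RtoC_Csum f n : Csum (fun k => RtoC (f k)) n = RtoC (Rsum f n).
Proof. induction n as [|n IH]; simpl; [reflexivity|]. now rewrite IH, RtoC_plus. Qed.

Lemma ex_series_Rgeom c x : 0 <= x < 1 -> ex_series (fun n => c * x ^ n).
Proof.
  intros H. apply ex_series_Rmult. exists (/ (1 - x)). apply is_series_geom.
  rewrite Rabs_right; lra.
Qed.

Lemma is_lim_seq_inv_S : is_lim_seq (fun m => / (INR m + 1)) 0.
Proof.
  assert (H : is_lim_seq (fun m => / INR m) 0).
  { apply (is_lim_seq_inv INR p_infty); [apply is_lim_seq_INR|discriminate]. }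
  apply is_lim_seq_incr_1 in H. eapply is_lim_seq_ext; [|exact H].
  intros m; cbv beta. now rewrite S_INR.
Qed.

Section Limit_of_zeros.

Context (lam mu : nat -> R).
Context (lam_pos : forall n, 0 < lam n) (mu_pos : forall n, 0 < mu (S n)).
Context (F : C -> C) (HF : forall z, Clim (Qn lam mu z) (F z)).

Local Notation Q := (Qn lam mu).
Local Notation P := (Rn lam mu).
Local Notation wt := (bdpi lam mu).
Local Notation x := (rzero lam mu).

(** At [z = -1] every factor is [1 + x n k], so the product exceeds the sum of the [x n k], while
    its values converge as [n] grows. *)
Lemma rzero_sum_bounded : exists M, 0 < M /\ forall n m, Rsum (x n) m <= M.
Proof.
  destruct (Clim_bounded _ _ (HF (RtoC (-1)))) as (M & M0 & HM).
  exists M. split; [exact M0|]. intros n m.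
  assert (H0 : forall k, 0 <= x n k) by (apply rzero_nonneg; assumption).
  apply Rle_trans with (Rsum (x n) (m + n)).
  - apply Rsum_mono; [exact H0|lia].
  - specialize (HM n). rewrite (Qn_product _ _ lam_pos mu_pos _ n (m + n)) in HM by lia.
    rewrite (Cprod_ext _ (fun k => RtoC (1 + x n k))) in HM.
    + assert (A := one_plus_Rsum_le_Cprod (x n) (m + n) H0). lra.
    + intros k _. unfold zfac. rewrite RtoC_plus. replace (RtoC (-1)) with (- RtoC 1)%C.
      * ring.
      * now rewrite <- RtoC_opp.
Qed.

Definition rlim (k : nat) : R := real (Lim_seq (fun n => x n k)).

Lemma rzero_le_sum n k M : (forall m, Rsum (x n) m <= M) -> x n k <= M.
Proof.
  intros H. specialize (H (S k)). simpl in H.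
  assert (0 <= Rsum (x n) k) by (apply Rsum_nonneg; intros; apply rzero_nonneg; assumption). lra.
Qed.

Lemma rlim_correct k : is_lim_seq (fun n => x n k) (rlim k).
Proof.
  destruct rzero_sum_bounded as (M & _ & HM).
  apply Lim_seq_correct', ex_finite_lim_seq_incr with M.
  - intros n; apply rzero_incr; assumption.
  - intros n; apply rzero_le_sum, HM.
Qed.

Lemma rzero_le_rlim n k : x n k <= rlim k.
Proof.
  apply (is_lim_seq_incr_compare (fun n => x n k)); [apply rlim_correct|].
  intros m; apply rzero_incr; assumption.
Qed.

Lemma rlim_pos k : 0 < rlim k.
Proof.
  apply Rlt_le_trans with (2 := rzero_le_rlim (S k) k).
  destruct (rzero_zeros _ _ lam_pos mu_pos (S k)) as (A & _ & _). apply A; lia.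
Qed.

Lemma rlim_decr_weak k : rlim (S k) <= rlim k.
Proof.
  assert (H1 := rlim_correct (S k)). apply is_lim_seq_incr_1 in H1.
  refine (is_lim_seq_le _ _ _ _ _ H1 (rlim_correct k)).
  intros n; apply rzero_le_S_decr; assumption.
Qed.

Lemma ex_series_rlim : ex_series rlim.
Proof.
  destruct rzero_sum_bounded as (M & _ & HM).
  apply ex_series_bounded with M; [intros; left; apply rlim_pos|].
  intros m.
  assert (L : is_lim_seq (fun n => Rsum (x n) m) (Rsum rlim m)).
  { induction m as [|m IH]; simpl; [apply is_lim_seq_const|].
    apply is_lim_seq_plus'; [exact IH|apply rlim_correct]. }
  refine (is_lim_seq_le _ (fun _ => M) _ (Finite M) _ L _); [intros; apply HM|apply is_lim_seq_const].
Qed.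

Lemma rlim_Rsum_le n : Rsum rlim n <= Series rlim.
Proof. apply Rsum_le_Series; [intros; left; apply rlim_pos|apply ex_series_rlim]. Qed.

Lemma Cmod_zfac_le w z k e : 0 <= w k <= e -> Cmod (zfac w z k) <= 1 + Cmod z * e.
Proof.
  intros [H1 H2]. unfold zfac, Cminus. eapply Rle_trans; [apply Cmod_triangle|].
  rewrite Cmod_opp, Cmod_mult, Cmod_1, Cmod_R, Rabs_right by lra.
  apply Rplus_le_compat_l, Rmult_le_compat_l; [apply Cmod_ge_0|exact H2].
Qed.

Lemma Cmod_zfac_rlim z k : Cmod (zfac rlim z k) <= 1 + Cmod z * rlim k.
Proof. apply Cmod_zfac_le. split; [left; apply rlim_pos|lra]. Qed.

Lemma Rsum_rlim_scal z n : Rsum (fun k => Cmod z * rlim k) n <= Cmod z * Series rlim.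
Proof.
  rewrite Rsum_scal. apply Rmult_le_compat_l; [apply Cmod_ge_0|apply rlim_Rsum_le].
Qed.

(** Uniform both in [n] and on discs, because [rlim] dominates the reciprocal zeros of every degree;
    [rlim_decr] varies [z] and [n] together. *)
Lemma Qn_locally_bounded rho : exists M, 0 < M /\
  forall z n, Cmod z <= rho -> Cmod (Q z n) <= M.
Proof.
  exists (exp (rho * Series rlim)). split; [apply exp_pos|]. intros z n Hz.
  rewrite (Qn_product _ _ lam_pos mu_pos _ n n) by lia.
  eapply Rle_trans.
  - apply Cmod_Cprod_le_exp with (e := fun k => Cmod z * rlim k).
    intros k. apply Cmod_zfac_le. split; [apply rzero_nonneg; assumption|apply rzero_le_rlim].
  - assert (A := Rsum_rlim_scal z n).
    assert (0 <= Series rlim) by (apply Series_nonneg; [intros; left; apply rlim_pos|apply ex_series_rlim]).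
    assert (B : Rsum (fun k => Cmod z * rlim k) n <= rho * Series rlim) by nra.
    destruct (Rle_lt_or_eq_dec _ _ B) as [L|L]; [left; apply exp_increasing, L|rewrite L; lra].
Qed.

(** The partial product and [Q z n] both have [n] factors, and by [Cprod_diff_le] they differ by at
    most a constant times the sum of [rlim k - x n k], which tends to 0 under the dominating series
    [rlim]. *)
Lemma rlim_product z : Clim (Cprod (zfac rlim z)) (F z).
Proof.
  assert (HS := ex_series_rlim).
  assert (D : is_lim_seq (fun n => Series (fun k => rlim k - x n k)) 0).
  { apply tannery_0 with rlim; [| |exact HS].
    - intros k. replace (Finite 0) with (Finite (rlim k - rlim k)) by (f_equal; ring).
      apply is_lim_seq_minus'; [apply is_lim_seq_const|apply rlim_correct].
    - intros n k. assert (A := rzero_le_rlim n k).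
      assert (B := rzero_nonneg _ _ lam_pos mu_pos n k). lra. }
  apply Clim_ext with (fun n => Cplus (Q z n) (Cminus (Cprod (zfac rlim z) n) (Q z n))).
  { intros n; ring. }
  replace (F z) with (F z + 0)%C by ring. apply Clim_plus; [apply HF|].
  apply Clim_0_Cmod.
  eapply is_lim_seq_squeeze0;
    [|apply (is_lim_seq_scal0 (exp (Cmod z * Series rlim) * Cmod z)), D].
  intros n; split; [apply Cmod_ge_0|].
  rewrite (Qn_product _ _ lam_pos mu_pos _ n n) by lia.
  eapply Rle_trans.
  - apply Cprod_diff_le with (e := fun k => Cmod z * rlim k) (E := Cmod z * Series rlim).
    + apply Cmod_zfac_rlim.
    + intros k. apply Cmod_zfac_le. split; [apply rzero_nonneg; assumption|apply rzero_le_rlim].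
    + intros k. apply Rmult_le_pos; [apply Cmod_ge_0|left; apply rlim_pos].
    + apply Rsum_rlim_scal.
  - rewrite Rmult_assoc. apply Rmult_le_compat_l; [left; apply exp_pos|].
    assert (Hd : forall k, 0 <= rlim k - x n k) by (intros k; assert (A := rzero_le_rlim n k); lra).
    rewrite (Rsum_ext _ (fun k => Cmod z * (rlim k - x n k))).
    + rewrite Rsum_scal. apply Rmult_le_compat_l; [apply Cmod_ge_0|].
      apply Rsum_le_Series; [exact Hd|].
      apply @ex_series_le with rlim; [|exact HS]. intros k.
      unfold norm; simpl; unfold abs; simpl. rewrite Rabs_right by (apply Rle_ge, Hd).
      assert (B := rzero_nonneg _ _ lam_pos mu_pos n k). lra.
    + intros k _. unfold zfac.
      replace (1 - z * rlim k - (1 - z * x n k))%C with (- (z * (rlim k - x n k)))%C by ring.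
      rewrite Cmod_opp, Cmod_mult, <- RtoC_minus, Cmod_R, Rabs_right by (apply Rle_ge, Hd).
      reflexivity.
Qed.

(** A product whose factors deviate summably from 1 and never vanish stays away from 0. *)
Lemma F_zero_iff z : F z = RtoC 0 <-> exists k, z = RtoC (/ rlim k).
Proof.
  split.
  - intros E. destruct (excluded_middle_informative (exists k, zfac rlim z k = RtoC 0)) as [[k Hk]|H].
    + exists k. unfold zfac in Hk. assert (Hp := rlim_pos k).
      assert (Hn : RtoC (rlim k) <> RtoC 0) by (apply RtoC_neq_0; lra).
      rewrite RtoC_Rinv. replace z with (z * rlim k * / rlim k)%C by (field; exact Hn).
      replace (z * rlim k)%C with (1 - (1 - z * rlim k))%C by ring. rewrite Hk. field; exact Hn.
    + destruct (Cprod_bounded_below (zfac rlim z) (fun k => Cmod z * rlim k)) as (c & Hc & Hev).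
      * intros k Hk; apply H; exists k; exact Hk.
      * intros k. unfold zfac. replace (1 - z * rlim k - 1)%C with (- (z * rlim k))%C by ring.
        rewrite Cmod_opp, Cmod_mult, Cmod_R, Rabs_right; [lra|]. apply Rle_ge; left; apply rlim_pos.
      * apply ex_series_Rmult, ex_series_rlim.
      * exfalso. assert (L := Clim_Cmod _ _ (rlim_product z)).
        assert (A := is_lim_seq_le_loc (fun _ => c) _ c _ Hev (is_lim_seq_const c) L).
        rewrite E, Cmod_0 in A. simpl in A. lra.
  - intros [k ->]. symmetry. apply (Clim_unique (Cprod (zfac rlim (RtoC (/ rlim k))))).
    + apply Clim_ext_loc with (fun _ => RtoC 0); [|apply Clim_const].
      exists (S k); intros n Hn. symmetry. apply Cprod_zero with k; [lia|].
      apply zfac_zero. assert (Hp := rlim_pos k); lra.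
    + apply rlim_product.
Qed.

(** A repeated reciprocal supplies the factor [zfac rlim z k] twice; the factors before and after it
    are bounded by one exponential each. *)
Lemma F_double_zero_bound k z : rlim (S k) = rlim k ->
  Cmod (F z) <= exp (Cmod z * Series rlim) ^ 2 * Cmod (zfac rlim z k) ^ 2.
Proof.
  intros E. set (B := exp (Cmod z * Series rlim)).
  assert (Hle : forall f n, (forall j, Cmod (f j) <= 1 + Cmod z * rlim (n + j)%nat) ->
    forall m, Cmod (Cprod f m) <= B).
  { intros f n Hf m. eapply Rle_trans; [apply Cmod_Cprod_le_exp with (1 := Hf)|].
    assert (A : Rsum (fun j => Cmod z * rlim (n + j)%nat) m <= Cmod z * Series rlim).
    { rewrite Rsum_scal. apply Rmult_le_compat_l; [apply Cmod_ge_0|].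
      eapply Rle_trans; [apply Rsum_le_Series; [intros; left; apply rlim_pos|apply ex_series_incr_n, ex_series_rlim]|].
      rewrite Series_tail by apply ex_series_rlim.
      assert (0 <= Rsum rlim n) by (apply Rsum_nonneg; intros; left; apply rlim_pos). lra. }
    unfold B. destruct (Rle_lt_or_eq_dec _ _ A) as [L|L]; [left; apply exp_increasing, L|rewrite L; lra]. }
  assert (L := Clim_Cmod _ _ (rlim_product z)).
  assert (L2 := proj1 (is_lim_seq_incr_n _ (S (S k)) _) L).
  refine (is_lim_seq_le _ (fun _ => _) _ (Finite _) _ L2 (is_lim_seq_const _)).
  intros n. rewrite Nat.add_comm, Cprod_shift, Cmod_mult.
  change (Cprod (zfac rlim z) (S (S k)))
    with (Cmult (Cmult (Cprod (zfac rlim z) k) (zfac rlim z k)) (zfac rlim z (S k))).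
  replace (zfac rlim z (S k)) with (zfac rlim z k) by (unfold zfac; rewrite E; reflexivity).
  rewrite !Cmod_mult.
  assert (B1 := Hle (zfac rlim z) O (Cmod_zfac_rlim z) k).
  assert (B2 := Hle (fun j => zfac rlim z (S (S k) + j)%nat) (S (S k))
    (fun j => Cmod_zfac_rlim z (S (S k) + j)) n).
  set (u := Cmod (Cprod (zfac rlim z) k)) in *.
  set (v := Cmod (Cprod (fun j => zfac rlim z (S (S k) + j)%nat) n)) in *.
  set (t := Cmod (zfac rlim z k)).
  assert (0 <= u) by apply Cmod_ge_0. assert (0 <= v) by apply Cmod_ge_0.
  assert (0 <= t) by apply Cmod_ge_0.
  replace (u * t * t * v) with ((u * v) * t ^ 2) by ring.
  apply Rmult_le_compat_r; [apply pow2_ge_0|].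
  simpl. rewrite Rmult_1_r. apply Rmult_le_compat; assumption.
Qed.

(** The Christoffel-Darboux identity in terms of fluxes: [z * P z n] replaces
    [lam n * wt n * (Q z n - Q z (S n))]. The induction rests on [K], in which both sides are the
    same product of two increments. *)
Lemma christoffel_darboux z z' n :
  Cmult (Cminus z z') (Csum (fun j => Cmult (RtoC (wt j)) (Cmult (Q z j) (Q z' j))) (S n)) =
  Cminus (Cmult z (Cmult (P z n) (Q z' n))) (Cmult z' (Cmult (P z' n) (Q z n))).
Proof.
  induction n as [|n IH].
  - simpl. unfold Qn, Rn; simpl. ring.
  - change (Csum ?f (S (S n))) with (Cplus (Csum f (S n)) (f (S n))).
    rewrite Cmult_plus_distr_l, IH, !Rn_S. cbv beta.
    assert (D1 := Qn_diff _ _ lam_pos mu_pos z n). assert (D2 := Qn_diff _ _ lam_pos mu_pos z' n).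
    set (q0 := Q z n) in *. set (q1 := Q z (S n)) in *.
    set (q0' := Q z' n) in *. set (q1' := Q z' (S n)) in *.
    set (p := P z n) in *. set (p' := P z' n) in *. set (w := RtoC (wt (S n))).
    assert (K : (z * p * (q0' - q1') = z' * p' * (q0 - q1))%C).
    { rewrite <- D1, <- D2. ring. }
    replace (z * (p * q0') - z' * (p' * q0) + (z - z') * (w * (q1 * q1')))%C
      with (z * p * (q0' - q1') - z' * p' * (q0 - q1) + z * p * q1' - z' * p' * q1
            + (z - z') * (w * (q1 * q1')))%C by ring.
    rewrite K. ring.
Qed.

(** * Growth of the solutions and simplicity of the zeros of [F] *)

Context (q C0 : R) (hq : 0 < q < 1) (C0_pos : 0 < C0).
Context (wt_le : forall n, wt n <= C0 * / q ^ n).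
Context (lamwt_le : forall n, / (lam n * wt n) <= C0 * (q ^ 3) ^ n).

Lemma qpow_pos n : 0 < q ^ n.
Proof. apply pow_lt; lra. Qed.

(** [Q z] is bounded, so [P z n] is controlled by a geometric sum of weights; [K] is the solution of
    [K * q + C0 * M = K]. *)
Lemma Rn_growth z : exists K, forall n, Cmod (P z n) <= K * / q ^ n.
Proof.
  destruct (Qn_locally_bounded (Cmod z)) as (M & M0 & HM).
  set (K := C0 * M / (1 - q)).
  assert (EK : K * q + C0 * M = K) by (unfold K; field; lra).
  exists K. induction n as [|n IH].
  - unfold Rn; simpl. rewrite Cmod_1. specialize (HM z O (Rle_refl _)).
    unfold Qn in HM; simpl in HM. rewrite Cmod_1 in HM.
    specialize (wt_le O). simpl in wt_le. rewrite Rinv_1 in *.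
    assert (0 < K) by (unfold K; apply Rdiv_lt_0_compat; nra). nra.
  - rewrite Rn_S. eapply Rle_trans; [apply Cmod_triangle|].
    rewrite Cmod_mult, Cmod_R.
    assert (W := bdpi_pos _ _ lam_pos mu_pos (S n)). rewrite Rabs_right by lra.
    specialize (HM z (S n) (Rle_refl _)). specialize (wt_le (S n)).
    assert (0 <= Cmod (Q z (S n))) by apply Cmod_ge_0.
    assert (Hm : wt (S n) * Cmod (Q z (S n)) <= C0 * / q ^ S n * M)
      by (apply Rmult_le_compat; lra).
    assert (Hq := qpow_pos n).
    replace (K * / q ^ S n) with (K * / q ^ n + C0 * / q ^ S n * M); [lra|].
    rewrite <- EK at 2. simpl. field. lra.
Qed.

Lemma Qn_step_le z n B : Cmod (P z n) <= B ->
  Cmod (Q z (S n) - Q z n) <= Cmod z * C0 * (q ^ 3) ^ n * B.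
Proof.
  intros H.
  assert (L := lampi_pos _ _ lam_pos mu_pos n). rewrite Qn_S.
  replace (Q z n - z * P z n / (lam n * wt n)%R - Q z n)%C
    with (- (z * P z n * RtoC (/ (lam n * wt n))))%C.
  - rewrite Cmod_opp, !Cmod_mult, Cmod_R, Rabs_right.
    + replace (Cmod z * C0 * (q ^ 3) ^ n * B) with (Cmod z * (B * (C0 * (q ^ 3) ^ n))) by ring.
      rewrite Rmult_assoc. apply Rmult_le_compat_l; [apply Cmod_ge_0|].
      apply Rmult_le_compat; [apply Cmod_ge_0| |exact H|apply lamwt_le].
      left; apply Rinv_0_lt_compat, L.
    + apply Rle_ge; left; apply Rinv_0_lt_compat, L.
  - rewrite RtoC_Rinv. unfold Cdiv. ring.
Qed.

Lemma Clim_geom_tail u l K rho : 0 <= rho < 1 -> Clim u l ->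
  (forall n, Cmod (u (S n) - u n) <= K * rho ^ n) ->
  forall n, Cmod (u n - l) <= 2 * K / (1 - rho) * rho ^ n.
Proof.
  intros Hr Hl Hs. destruct (Cgeom_cauchy u K rho Hr Hs) as [l' H].
  replace l with l'; [exact H|]. apply (Clim_unique u); [|exact Hl].
  red. eapply is_lim_seq_squeeze0;
    [|apply (is_lim_seq_scal0 (2 * K / (1 - rho)) (fun n => rho ^ n)), is_lim_seq_geom; rewrite Rabs_right; lra].
  intros n; split; [apply Cmod_ge_0|apply H].
Qed.

(** A two-step bootstrap. The crude growth [q^(-n)] of [P z] makes the increments of [Q z] of order
    [q^(2n)], and since the limit is 0 so is [Q z]. Then [wt n * Q z n] is of order [q^n] and
    summable, [P z] is bounded, and the increments improve to order [q^(3n)]. *)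
Lemma Qn_decay z : F z = RtoC 0 ->
  exists K, 0 < K /\ (forall n, Cmod (P z n) <= K) /\ forall n, Cmod (Q z n) <= K * (q ^ 3) ^ n.
Proof.
  intros HFz. assert (HL := HF z). rewrite HFz in HL.
  destruct (Rn_growth z) as [K1 HK1].
  assert (Hp : forall n, 0 < q ^ n) by apply qpow_pos.
  assert (q ^ 2 < 1) by nra. assert (q ^ 3 < 1) by (simpl; nra).
  assert (Hz := Cmod_ge_0 z).
  assert (A1 : forall n, Cmod (Q z (S n) - Q z n) <= Cmod z * C0 * K1 * (q ^ 2) ^ n).
  { intros n. eapply Rle_trans; [apply Qn_step_le, HK1|]. right.
    rewrite !(pow_swap q _ n). field. specialize (Hp n); lra. }
  assert (A2 := Clim_geom_tail _ _ _ (q ^ 2) ltac:(split; [apply pow2_ge_0|assumption]) HL A1).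
  set (K2 := 2 * (Cmod z * C0 * K1) / (1 - q ^ 2)) in A2.
  assert (A3 : forall n, Cmod (Q z n) <= K2 * (q ^ 2) ^ n).
  { intros n. specialize (A2 n). replace (Q z n - 0)%C with (Q z n) in A2 by ring. exact A2. }
  assert (K2pos : 1 <= K2).
  { specialize (A3 O). unfold Qn in A3; simpl in A3. rewrite Cmod_1 in A3. lra. }
  set (K3 := C0 * K2 / (1 - q)).
  assert (K3pos : 0 < K3) by (unfold K3; apply Rdiv_lt_0_compat; nra).
  assert (C01 : 1 <= C0) by (specialize (wt_le O); simpl in wt_le; rewrite Rinv_1 in wt_le; lra).
  (* The factor [1 - q ^ S n] is a partial geometric sum; with it the induction closes for the fixed
     constant [K3]. *)
  assert (A4 : forall n, Cmod (P z n) <= K3 * (1 - q ^ S n)).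
  { induction n as [|n IH].
    - unfold Rn; simpl. rewrite Cmod_1.
      replace (K3 * (1 - q * 1)) with (C0 * K2) by (unfold K3; field; lra). nra.
    - rewrite Rn_S. eapply Rle_trans; [apply Cmod_triangle|].
      rewrite Cmod_mult, Cmod_R.
      assert (W := bdpi_pos _ _ lam_pos mu_pos (S n)). rewrite Rabs_right by lra.
      specialize (A3 (S n)). specialize (wt_le (S n)).
      assert (0 <= Cmod (Q z (S n))) by apply Cmod_ge_0.
      assert (Hm : wt (S n) * Cmod (Q z (S n)) <= C0 * / q ^ S n * (K2 * (q ^ 2) ^ S n))
        by (apply Rmult_le_compat; lra).
      replace (C0 * / q ^ S n * (K2 * (q ^ 2) ^ S n)) with (C0 * K2 * q ^ S n) in Hm.
      + replace (K3 * (1 - q ^ S (S n))) with (K3 * (1 - q ^ S n) + C0 * K2 * q ^ S n); [lra|].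
        unfold K3. change (q ^ S (S n)) with (q * q ^ S n). field. lra.
      + rewrite pow_swap. field. specialize (Hp (S n)); lra. }
  assert (A5 : forall n, Cmod (P z n) <= K3).
  { intros n. specialize (A4 n). specialize (Hp (S n)). nra. }
  assert (A6 : forall n, Cmod (Q z (S n) - Q z n) <= Cmod z * C0 * K3 * (q ^ 3) ^ n).
  { intros n. eapply Rle_trans; [apply Qn_step_le, A5|]. right; ring. }
  assert (A7 := Clim_geom_tail _ _ _ (q ^ 3) ltac:(split; [left; apply Hp|assumption]) HL A6).
  set (K4 := 2 * (Cmod z * C0 * K3) / (1 - q ^ 3)) in A7.
  exists (K3 + Rabs K4). assert (0 <= Rabs K4) by apply Rabs_pos.
  split; [lra|]. split.
  - intros n. specialize (A5 n); lra.
  - intros n. specialize (A7 n). replace (Q z n - 0)%C with (Q z n) in A7 by ring.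
    eapply Rle_trans; [exact A7|]. apply Rmult_le_compat_r; [apply pow_le; left; apply Hp|].
    assert (K4 <= Rabs K4) by apply Rle_abs. lra.
Qed.

(* At a double zero [zeta] of [F] the right side of the Christoffel-Darboux
   formula is [O((s - zeta)^2)] as [n] tends to infinity, whereas the sum on the
   left tends to [sum_j wt j * Q zeta j ^ 2 >= 1] as [s] tends to [zeta]. *)
Lemma rlim_decr k : rlim (S k) < rlim k.
Proof.
  destruct (Rle_lt_or_eq_dec _ _ (rlim_decr_weak k)) as [L|E]; [exact L|exfalso].
  set (X := rlim k) in *. assert (X0 : 0 < X) by apply rlim_pos.
  set (zeta := / X). assert (zeta0 : 0 < zeta) by (apply Rinv_0_lt_compat, X0).
  assert (HFz : F (RtoC zeta) = RtoC 0) by (apply F_zero_iff; exists k; reflexivity).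
  destruct (Qn_decay _ HFz) as (K & K0 & HP & HQ).
  destruct (Qn_locally_bounded (zeta + 1)) as (M & M0 & HM).
  set (r := fun s n => Re (Q (RtoC s) n)).
  assert (rC : forall s n, Q (RtoC s) n = RtoC (r s n)).
  { intros s n. destruct (Qn_poly _ _ lam_pos mu_pos n) as (l & Hl & _).
    exact (is_poly_real _ _ (fun z => Q z n) s Hl). }
  assert (rcont : forall n, continuity (fun s => r s n)).
  { intros n. destruct (Qn_poly _ _ lam_pos mu_pos n) as (l & Hl & _).
    exact (is_poly_continuity _ _ _ Hl). }
  (* These points approach [zeta] from the right and do not exceed [zeta + 1], so that [M] bounds
     all [Q] at them. *)
  set (s := fun m : nat => zeta + / (INR m + 1)).
  assert (sp : forall m, 0 < / (INR m + 1) <= 1).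
  { intros m. assert (0 <= INR m) by apply pos_INR. split; [apply Rinv_0_lt_compat; lra|].
    rewrite <- Rinv_1. apply Rinv_le_contravar; lra. }
  assert (sl : is_lim_seq (fun m => / (INR m + 1)) 0).
  { apply is_lim_seq_inv_S. }
  assert (sM : forall m n, Rabs (r (s m) n) <= M).
  { intros m n. rewrite <- Cmod_R, <- rC. apply HM. rewrite Cmod_R.
    specialize (sp m). unfold s. rewrite Rabs_right; lra. }
  assert (rz : forall n, Rabs (r zeta n) <= K * (q ^ 3) ^ n).
  { intros n. rewrite <- Cmod_R, <- rC. apply HQ. }
  set (a := fun m j => wt j * (r zeta j * r (s m) j)).
  set (al := fun j => wt j * (r zeta j * r zeta j)).
  assert (wpos : forall j, 0 < wt j) by (apply bdpi_pos; assumption).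
  (* [M + K] covers both uses: [r (s m) j] is bounded by [M] and [r zeta j] by [K]. *)
  assert (dom : forall j b, Rabs b <= M + K ->
    Rabs (wt j * (r zeta j * b)) <= C0 * K * (M + K) * (q ^ 2) ^ j).
  { intros j b Hb. rewrite !Rabs_mult, (Rabs_right (wt j)) by (specialize (wpos j); lra).
    replace (C0 * K * (M + K) * (q ^ 2) ^ j) with ((C0 * / q ^ j) * (K * (q ^ 3) ^ j * (M + K))).
    - apply Rmult_le_compat; [left; apply wpos| |apply wt_le|].
      + apply Rmult_le_pos; apply Rabs_pos.
      + apply Rmult_le_compat; [apply Rabs_pos..|apply rz|exact Hb].
    - rewrite !(pow_swap q _ j). field. assert (Hp := qpow_pos j); lra. }
  assert (q2 : 0 <= q ^ 2 < 1) by (split; [apply pow2_ge_0|nra]).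
  assert (dom_a : forall m j, Rabs (a m j) <= C0 * K * (M + K) * (q ^ 2) ^ j).
  { intros m j. apply dom. specialize (sM m j). lra. }
  assert (dom_al : forall j, Rabs (al j) <= C0 * K * (M + K) * (q ^ 2) ^ j).
  { intros j. apply dom. eapply Rle_trans; [apply rz|].
    assert ((q ^ 3) ^ j <= 1); [|nra].
    rewrite <- (pow1 j). apply pow_incr. split; [left; apply qpow_pos|simpl; nra]. }
  assert (exg := ex_series_Rgeom (C0 * K * (M + K)) (q ^ 2) q2).
  assert (exa : forall m, ex_series (a m)).
  { intros m. apply @ex_series_le with (2 := exg). apply dom_a. }
  assert (T1 : is_lim_seq (fun m => Series (a m)) (Series al)).
  { apply tannery with (2 := dom_a); [|exact exg]. intros j. unfold a, al.
    assert (Hsl : is_lim_seq s zeta).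
    { replace (Finite zeta) with (Finite (zeta + 0)) by (f_equal; ring).
      apply is_lim_seq_plus'; [apply is_lim_seq_const|exact sl]. }
    assert (Hr := is_lim_seq_continuous (fun t => r t j) s zeta (rcont j zeta) Hsl).
    apply (is_lim_seq_scal_l _ (wt j) (Finite (r zeta j * r zeta j))).
    apply (is_lim_seq_scal_l _ (r zeta j) (Finite (r zeta j))). exact Hr. }
  assert (T2 : 1 <= Series al).
  { assert (Hal : forall j, 0 <= al j).
    { intros j. apply Rmult_le_pos; [left; apply wpos|]. apply Rle_0_sqr. }
    assert (exal : ex_series al) by (apply @ex_series_le with (2 := exg), dom_al).
    assert (A := Rsum_le_Series al 1 Hal exal). simpl in A.
    replace (al 0%nat) with 1 in A; [lra|]. unfold al, r, Qn; simpl. ring. }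
  assert (sX : forall m, Cmod (zfac rlim (RtoC (s m)) k) = X * / (INR m + 1)).
  { intros m. unfold zfac. fold X. rewrite <- RtoC_mult, <- RtoC_minus, Cmod_R.
    unfold s. replace (1 - (zeta + / (INR m + 1)) * X) with (- (X * / (INR m + 1))).
    - rewrite Rabs_Ropp, Rabs_right; [reflexivity|]. specialize (sp m). nra.
    - unfold zeta. assert (0 <= INR m) by apply pos_INR. field. lra. }
  set (D := zeta * K * exp ((zeta + 1) * Series rlim) ^ 2 * X ^ 2).
  assert (T3 : forall m, Rabs (Series (a m)) <= D * / (INR m + 1)).
  { intros m. assert (Hsm := sp m).
    assert (Hs1 : Cmod (RtoC (s m)) <= zeta + 1).
    { rewrite Cmod_R. unfold s. rewrite Rabs_right; lra. }
    (* [K'] depends on [m], harmlessly: [n] tends to infinity first, and the term with [K'] carries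
       [(q ^ 2) ^ n]. *)
    destruct (Rn_growth (RtoC (s m))) as [K' HK'].
    assert (Hfin : forall n, / (INR m + 1) * Rabs (Rsum (a m) (S n)) <=
      zeta * K * Cmod (Q (RtoC (s m)) n) + Cmod (RtoC (s m)) * K' * K * (q ^ 2) ^ n).
    { intros n. assert (A := christoffel_darboux (RtoC zeta) (RtoC (s m)) n).
      rewrite (Rsum_ext _ (fun j => wt j * (r zeta j * r (s m) j))) by reflexivity.
      apply (f_equal Cmod) in A. rewrite Cmod_mult in A.
      rewrite <- RtoC_minus, Cmod_R in A.
      replace (zeta - s m) with (- / (INR m + 1)) in A by (unfold s; ring).
      rewrite Rabs_Ropp, (Rabs_right (/ (INR m + 1))) in A by lra.
      rewrite <- Cmod_R, <- RtoC_Csum.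
      assert (Ec : forall N, Csum (fun j => RtoC (wt j * (r zeta j * r (s m) j))) N =
        Csum (fun j => (wt j * (Q (RtoC zeta) j * Q (RtoC (s m)) j))%C) N).
      { induction N as [|N IHN]; [reflexivity|]. simpl. rewrite IHN, !rC, !RtoC_mult. reflexivity. }
      rewrite Ec, A. unfold Cminus. eapply Rle_trans; [apply Cmod_triangle|].
      rewrite Cmod_opp, !Cmod_mult. apply Rplus_le_compat.
      - rewrite Cmod_R, Rabs_right by lra. rewrite Rmult_assoc.
        apply Rmult_le_compat_l; [lra|]. apply Rmult_le_compat_r; [apply Cmod_ge_0|apply HP].
      - rewrite !Rmult_assoc. apply Rmult_le_compat_l; [apply Cmod_ge_0|].
        replace (K' * (K * (q ^ 2) ^ n)) with ((K' * / q ^ n) * (K * (q ^ 3) ^ n)).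
        + apply Rmult_le_compat; [apply Cmod_ge_0..|apply HK'|apply HQ].
        + rewrite !(pow_swap q _ n). field. assert (Hp := qpow_pos n); lra. }
    assert (Lim1 : is_lim_seq (fun n => / (INR m + 1) * Rabs (Rsum (a m) (S n)))
      (/ (INR m + 1) * Rabs (Series (a m)))).
    { apply (is_lim_seq_scal_l _ _ (Finite (Rabs (Series (a m))))).
      apply (is_lim_seq_abs _ (Finite (Series (a m)))).
      apply (is_lim_seq_incr_1 (Rsum (a m))), is_lim_Rsum_Series, exa. }
    assert (Lim2 : is_lim_seq (fun n => zeta * K * Cmod (Q (RtoC (s m)) n)
        + Cmod (RtoC (s m)) * K' * K * (q ^ 2) ^ n) (zeta * K * Cmod (F (RtoC (s m))) + 0)).
    { apply is_lim_seq_plus'.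
      - apply (is_lim_seq_scal_l _ _ (Finite (Cmod (F (RtoC (s m)))))). apply Clim_Cmod, HF.
      - apply is_lim_seq_scal0, is_lim_seq_geom. rewrite Rabs_right; lra. }
    assert (A := is_lim_seq_le _ _ _ _ Hfin Lim1 Lim2). simpl in A. rewrite Rplus_0_r in A.
    assert (B := F_double_zero_bound k (RtoC (s m)) E). rewrite sX in B.
    assert (Bexp : exp (Cmod (RtoC (s m)) * Series rlim) ^ 2 <= exp ((zeta + 1) * Series rlim) ^ 2).
    { apply pow_incr. split; [left; apply exp_pos|].
      assert (0 <= Series rlim) by (apply Series_nonneg; [intros; left; apply rlim_pos|apply ex_series_rlim]).
      destruct (Rle_lt_or_eq_dec (Cmod (RtoC (s m)) * Series rlim) ((zeta + 1) * Series rlim)) as [G|G].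
      - apply Rmult_le_compat_r; assumption.
      - left; apply exp_increasing, G.
      - rewrite G; lra. }
    set (i := / (INR m + 1)) in *.
    assert (B' : Cmod (F (RtoC (s m))) <= exp ((zeta + 1) * Series rlim) ^ 2 * (X * i) ^ 2).
    { eapply Rle_trans; [exact B|]. apply Rmult_le_compat_r; [apply pow2_ge_0|exact Bexp]. }
    (* Division by [i], the distance from [s m] to [zeta], leaves one factor [i] of the quadratic
       bound. *)
    apply Rmult_le_reg_l with i; [lra|].
    eapply Rle_trans; [exact A|].
    replace (i * (D * i)) with (zeta * K * (exp ((zeta + 1) * Series rlim) ^ 2 * (X * i) ^ 2))
      by (unfold D; ring).
    apply Rmult_le_compat_l; [|exact B']. apply Rmult_le_pos; lra. }
  assert (T4 : is_lim_seq (fun m => Series (a m)) 0).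
  { apply is_lim_seq_abs_0. eapply is_lim_seq_squeeze0; [|apply (is_lim_seq_scal0 D), sl].
    intros m; split; [apply Rabs_pos|apply T3]. }
  assert (T5 := is_lim_seq_eq _ _ _ T1 T4). lra.
Qed.

End Limit_of_zeros.

(** * Closures of Jacobi matrices *)

Lemma is_lim_seq_sqrt_0 u : (forall n, 0 <= u n) -> is_lim_seq u 0 ->
  is_lim_seq (fun n => sqrt (u n)) 0.
Proof.
  intros Hu H. rewrite <- sqrt_0.
  apply (is_lim_seq_continuous sqrt); [apply continuity_pt_sqrt; lra|exact H].
Qed.

Lemma Cmod_plus_sqr a b : Cmod (Cplus a b) ^ 2 <= 2 * Cmod a ^ 2 + 2 * Cmod b ^ 2.
Proof.
  assert (T := Cmod_triangle a b). assert (0 <= Cmod (a + b)) by apply Cmod_ge_0.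
  apply Rle_trans with ((Cmod a + Cmod b) ^ 2); [apply pow_incr; lra|].
  assert (0 <= (Cmod a - Cmod b) ^ 2) by apply pow2_ge_0. nra.
Qed.

Lemma ex_series_sqr_le (u v : nat -> C) c : l2 v ->
  (forall n, Cmod (u n) ^ 2 <= c * Cmod (v n) ^ 2) -> l2 u.
Proof.
  intros Hv H. apply @ex_series_le with (fun n => c * Cmod (v n) ^ 2).
  - intros n. unfold norm; simpl norm; unfold abs; simpl abs.
    rewrite Rabs_right; [apply H|]. apply Rle_ge, pow2_ge_0.
  - apply ex_series_Rmult, Hv.
Qed.

Lemma l2_scal c u : l2 u -> l2 (fun n => Cmult c (u n)).
Proof.
  intros H. apply ex_series_sqr_le with (v := u) (c := Cmod c ^ 2); [exact H|].
  intros n. rewrite Cmod_mult, Rpow_mult_distr. lra.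
Qed.

Lemma l2_plus u v : l2 u -> l2 v -> l2 (fun n => Cplus (u n) (v n)).
Proof.
  intros Hu Hv.
  apply @ex_series_le with (fun n => 2 * Cmod (u n) ^ 2 + 2 * Cmod (v n) ^ 2).
  - intros n. unfold norm; simpl norm; unfold abs; simpl abs.
    rewrite Rabs_right; [apply Cmod_plus_sqr|]. apply Rle_ge, pow2_ge_0.
  - apply (@ex_series_plus R_AbsRing R_NormedModule (fun n => 2 * Cmod (u n) ^ 2)
      (fun n => 2 * Cmod (v n) ^ 2)); apply ex_series_Rmult; assumption.
Qed.

Lemma l2_ext u v : (forall n, u n = v n) -> l2 u -> l2 v.
Proof. intros E. apply ex_series_ext; intros n; now rewrite E. Qed.

Lemma l2_sub u v : l2 u -> l2 v -> l2 (seq_sub u v).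
Proof.
  intros Hu Hv. apply l2_ext with (fun n => Cplus (u n) (Cmult (Copp (RtoC 1)) (v n))).
  - intros n. unfold seq_sub. ring.
  - apply l2_plus; [exact Hu|apply l2_scal, Hv].
Qed.

Lemma l2_fin_supp u : fin_supp u -> l2 u.
Proof.
  intros [N H]. eexists. apply Series_finite with (n := N).
  intros k Hk. cbv beta. rewrite (H k Hk), Cmod_0. ring.
Qed.

Lemma l2_term u n : l2 u -> Cmod (u n) <= l2norm u.
Proof.
  intros H. unfold l2norm.
  rewrite <- (sqrt_pow2 (Cmod (u n))) by apply Cmod_ge_0.
  apply sqrt_le_1_alt.
  assert (Hp : forall k, 0 <= Cmod (u k) ^ 2) by (intros; apply pow2_ge_0).
  assert (A := Rsum_le_Series _ (S n) Hp H).
  change (Rsum ?f (S n)) with (Rsum f n + f n) in A. cbv beta in A.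
  assert (B := Rsum_nonneg (fun k => Cmod (u k) ^ 2) n (fun k _ => Hp k)). lra.
Qed.

Lemma l2_lim_0 u : l2 u -> is_lim_seq (fun n => Cmod (u n)) 0.
Proof.
  intros H. apply ex_series_lim_0 in H. apply is_lim_seq_sqrt_0 in H.
  - eapply is_lim_seq_ext; [|exact H]. intros n; cbv beta. apply sqrt_pow2, Cmod_ge_0.
  - intros n; apply pow2_ge_0.
Qed.

Lemma l2norm_nonneg u : 0 <= l2norm u.
Proof. apply sqrt_pos. Qed.

Lemma l2_geom u K rho : 0 <= rho < 1 -> 0 <= K -> (forall n, Cmod (u n) <= K * rho ^ n) ->
  l2 u /\ l2norm u <= sqrt (/ (1 - rho ^ 2)) * K.
Proof.
  intros Hr HK H.
  assert (Hr2 : 0 <= rho ^ 2 < 1) by (split; [apply pow2_ge_0|nra]).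
  assert (Hs : forall n, Cmod (u n) ^ 2 <= K ^ 2 * (rho ^ 2) ^ n).
  { intros n. rewrite pow_swap, <- Rpow_mult_distr. apply pow_incr.
    split; [apply Cmod_ge_0|apply H]. }
  assert (Hg := ex_series_Rgeom (K ^ 2) (rho ^ 2) Hr2).
  split.
  - apply @ex_series_le with (2 := Hg). intros n. unfold norm; simpl norm; unfold abs; simpl abs.
    rewrite Rabs_right; [apply Hs|]. apply Rle_ge, pow2_ge_0.
  - unfold l2norm. apply Rle_trans with (sqrt (/ (1 - rho ^ 2) * K ^ 2)).
    + apply sqrt_le_1_alt. eapply Rle_trans.
      * apply Series_le with (2 := Hg). intros n. split; [apply pow2_ge_0|apply Hs].
      * rewrite Series_scal_l, Series_geom; [lra|]. rewrite Rabs_right; lra.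
    + rewrite sqrt_mult_alt by (left; apply Rinv_0_lt_compat; lra). rewrite sqrt_pow2 by exact HK. lra.
Qed.

Section Jacobi_closure.

Context (a b : nat -> R).

Local Notation J := (jacobi_action a b).

Lemma jacobi_action_fin_supp u : fin_supp u -> fin_supp (J u).
Proof.
  intros [N H]. exists (S N). intros n Hn. unfold jacobi_action.
  destruct n as [|m]; [lia|]. rewrite (H m), (H (S m)), (H (S (S m))) by lia. ring.
Qed.

(** Norm convergence implies convergence of each coordinate, and a row has at most three entries, so
    the matrix action passes to the closure. *)
Lemma jacobi_operator_action u v : jacobi_operator a b u v -> forall n, v n = J u n.
Proof.
  intros (Hu & Hv & us & vs & HT & Lu & Lv) n.
  assert (Hus : forall k, fin_supp (us k)) by (intros k; apply HT).
  assert (Cu : forall m, Clim (fun k => us k m) (u m)).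
  { intros m. red. apply is_lim_seq_squeeze0 with (2 := Lu).
    intros k; split; [apply Cmod_ge_0|]. apply (l2_term (seq_sub (us k) u) m).
    apply l2_sub; [apply l2_fin_supp, Hus|exact Hu]. }
  assert (Cv : Clim (fun k => vs k n) (v n)).
  { red. apply is_lim_seq_squeeze0 with (2 := Lv).
    intros k; split; [apply Cmod_ge_0|]. apply (l2_term (seq_sub (vs k) v) n).
    apply l2_sub; [|exact Hv]. apply l2_ext with (J (us k)).
    - intros m; symmetry; apply HT.
    - apply l2_fin_supp, jacobi_action_fin_supp, Hus. }
  apply (Clim_unique (fun k => vs k n)); [exact Cv|].
  apply Clim_ext with (fun k => J (us k) n); [intros k; symmetry; apply HT|].
  unfold jacobi_action. apply Clim_plus; [apply Clim_plus|].
  - destruct n; [apply Clim_const|apply Clim_mult; [apply Clim_const|apply Cu]].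
  - apply Clim_mult; [apply Clim_const|apply Cu].
  - apply Clim_mult; [apply Clim_const|apply Cu].
Qed.

Definition cut (N : nat) (u : nat -> C) : nat -> C :=
  fun n => if (n <? N)%nat then u n else RtoC 0.

Lemma cut_lt N u n : (n < N)%nat -> cut N u n = u n.
Proof. intros H; unfold cut. apply Nat.ltb_lt in H. now rewrite H. Qed.

Lemma cut_ge N u n : (N <= n)%nat -> cut N u n = RtoC 0.
Proof. intros H; unfold cut. apply Nat.ltb_ge in H. now rewrite H. Qed.

(** As [wN] vanishes from [N] on, the tail of the difference is the tail of [w], and only finitely
    many entries remain to be compared. *)
Lemma l2norm_sub_cut w wN N : l2 w -> (forall n, (N <= n)%nat -> wN n = RtoC 0) ->
  l2norm (seq_sub wN w) = sqrt (Rsum (fun n => Cmod (seq_sub wN w n) ^ 2) N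
     + (Series (fun n => Cmod (w n) ^ 2) - Rsum (fun n => Cmod (w n) ^ 2) N)).
Proof.
  intros Hw H. unfold l2norm. f_equal.
  assert (Hd : l2 (seq_sub wN w)) by (apply l2_sub; [apply l2_fin_supp; exists N|]; assumption).
  rewrite <- Series_tail by exact Hw.
  rewrite (Series_ext (fun k => Cmod (w (N + k)%nat) ^ 2)
    (fun k => Cmod (seq_sub wN w (N + k)%nat) ^ 2)).
  - rewrite (Series_tail (fun n => Cmod (seq_sub wN w n) ^ 2)) by exact Hd. ring.
  - intros k. unfold seq_sub. rewrite H by lia.
    replace (0 - w (N + k)%nat)%C with (- w (N + k)%nat)%C by ring. now rewrite Cmod_opp.
Qed.

Lemma Series_remainder_lim w : l2 w ->
  is_lim_seq (fun N => Series (fun n => Cmod (w n) ^ 2) - Rsum (fun n => Cmod (w n) ^ 2) N) 0.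
Proof.
  intros H. set (s := Series _). replace (Finite 0) with (Finite (s - s)) by (f_equal; ring).
  apply is_lim_seq_minus'; [apply is_lim_seq_const|apply is_lim_Rsum_Series, H].
Qed.

(** The image of the truncation [cut (S N) u] agrees with [v] in the rows below [N], lacks
    [b N * u (S N)] in row [N], is [b N * u N] in row [S N] and vanishes beyond. The two limit
    hypotheses therefore make it converge to [v]. *)
Lemma jacobi_operator_intro u v : l2 u -> l2 v -> (forall n, v n = J u n) ->
  is_lim_seq (fun n => Cmod (Cmult (RtoC (b n)) (u n))) 0 ->
  is_lim_seq (fun n => Cmod (Cmult (RtoC (b n)) (u (S n)))) 0 ->
  jacobi_operator a b u v.
Proof.
  intros Hu Hv E L0 L1. split; [exact Hu|]. split; [exact Hv|].
  exists (fun N => cut (S N) u), (fun N => J (cut (S N) u)).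
  assert (HC : forall N, fin_supp (cut (S N) u)).
  { intros N; exists (S N). intros n Hn; apply cut_ge, Hn. }
  split; [|split].
  - intros N. split; [apply HC|reflexivity].
  - eapply is_lim_seq_ext.
    { intros N. symmetry. apply (l2norm_sub_cut u _ (S N) Hu). intros n; apply cut_ge. }
    apply is_lim_seq_sqrt_0.
    + intros N. apply Rplus_le_le_0_compat; [apply Rsum_nonneg; intros; apply pow2_ge_0|].
      rewrite <- Series_tail by exact Hu. apply Series_nonneg; [intros; apply pow2_ge_0|].
      apply (ex_series_incr_n (fun n => Cmod (u n) ^ 2) (S N)), Hu.
    + eapply is_lim_seq_ext; [|apply (proj1 (is_lim_seq_incr_1 _ _) (Series_remainder_lim u Hu))].
      intros N; cbv beta.
      rewrite (Rsum_ext (fun n => Cmod (seq_sub (cut (S N) u) u n) ^ 2) (fun _ => 0 * 0)).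
      * rewrite Rsum_scal. ring.
      * intros n Hn. unfold seq_sub. rewrite cut_lt by exact Hn.
        replace (u n - u n)%C with (RtoC 0) by ring. rewrite Cmod_0. ring.
  - assert (HJ : forall N n, (S (S N) <= n)%nat -> J (cut (S N) u) n = RtoC 0).
    { intros N n Hn. unfold jacobi_action. destruct n as [|m]; [lia|].
      rewrite !cut_ge by lia. ring. }
    eapply is_lim_seq_ext.
    { intros N. symmetry. apply (l2norm_sub_cut v _ (S (S N)) Hv). apply HJ. }
    apply is_lim_seq_sqrt_0.
    + intros N. apply Rplus_le_le_0_compat; [apply Rsum_nonneg; intros; apply pow2_ge_0|].
      rewrite <- Series_tail by exact Hv. apply Series_nonneg; [intros; apply pow2_ge_0|].
      apply (ex_series_incr_n (fun n => Cmod (v n) ^ 2) (S (S N))), Hv.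
    + assert (R2 := proj1 (is_lim_seq_incr_1 _ _) (proj1 (is_lim_seq_incr_1 _ _)
        (Series_remainder_lim v Hv))). cbv beta in R2.
      apply is_lim_seq_plus0; [|exact R2].
      apply is_lim_seq_ext with (fun N => Cmod (b N * u (S N))%C ^ 2
        + Cmod (b N * u N - v (S N))%C ^ 2).
      * intros N. simpl Rsum.
        rewrite (Rsum_ext _ (fun _ => 0 * 0)); [rewrite Rsum_scal|].
        -- replace (seq_sub (J (cut (S N) u)) v N) with (- (b N * u (S N)))%C.
           ++ replace (seq_sub (J (cut (S N) u)) v (S N)) with (b N * u N - v (S N))%C.
              ** rewrite Cmod_opp. ring.
              ** unfold seq_sub, jacobi_action. rewrite (cut_lt (S N) u N) by lia.
                 rewrite !cut_ge by lia. ring.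
           ++ unfold seq_sub. rewrite E. unfold jacobi_action.
              rewrite (cut_lt (S N) u N), (cut_ge (S N) u (S N)) by lia.
              destruct N; [|rewrite cut_lt by lia]; ring.
        -- intros n Hn. unfold seq_sub. rewrite E. unfold jacobi_action.
           rewrite (cut_lt (S N) u n), (cut_lt (S N) u (S n)) by lia.
           replace (match n with O => RtoC 0 | S m => (b m * cut (S N) u m)%C end)
             with (match n with O => RtoC 0 | S m => (b m * u m)%C end).
           ++ unfold Cminus. rewrite Cplus_opp_r, Cmod_0. ring.
           ++ destruct n; [reflexivity|]. rewrite cut_lt by lia. reflexivity.
      * assert (Lv : is_lim_seq (fun N => Cmod (b N * u N - v (S N))) 0).
        { eapply is_lim_seq_squeeze0.
          2:{ apply is_lim_seq_plus0; [exact L0|].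
              exact (proj1 (is_lim_seq_incr_1 (fun n => Cmod (v n)) _) (l2_lim_0 v Hv)). }
          intros N; split; [apply Cmod_ge_0|]. unfold Cminus.
          eapply Rle_trans; [apply Cmod_triangle|]. rewrite Cmod_opp. lra. }
        assert (Sq : forall w, is_lim_seq w 0 -> is_lim_seq (fun n : nat => w n ^ 2) 0).
        { intros w Hw. replace (Finite 0) with (Finite (0 * (0 * 1))) by (f_equal; ring).
          apply is_lim_seq_mult'; [exact Hw|].
          apply is_lim_seq_mult'; [exact Hw|apply is_lim_seq_const]. }
        apply is_lim_seq_plus0; apply Sq; assumption.
Qed.

(** Row [n] can be solved for [e (S n)] because [b n] is nonzero, so vanishing propagates
    upwards. *)
Lemma jacobi_homogeneous_0 z e : (forall n, b n <> 0) ->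
  (forall n, J e n = Cmult z (e n)) -> e 0%nat = RtoC 0 -> forall n, e n = RtoC 0.
Proof.
  intros Hb HJ H0.
  assert (Hs : forall n, e n = RtoC 0 ->
    match n with O => RtoC 0 | S m => Cmult (RtoC (b m)) (e m) end = RtoC 0 -> e (S n) = RtoC 0).
  { intros n En Em. specialize (HJ n). unfold jacobi_action in HJ. rewrite Em, En in HJ.
    assert (Hbn := RtoC_neq_0 _ (Hb n)).
    replace (e (S n)) with (/ b n * (0 + a n * 0 + b n * e (S n)))%C by (field; exact Hbn).
    rewrite HJ. ring. }
  assert (A : forall n, e n = RtoC 0 /\ e (S n) = RtoC 0).
  { induction n as [|n [IH1 IH2]].
    - split; [exact H0|]. apply Hs; [exact H0|reflexivity].
    - split; [exact IH2|]. apply Hs; [exact IH2|]. rewrite IH1; ring. }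
  intros n; apply A.
Qed.

End Jacobi_closure.

(** * The spectrum of a birth-and-death operator *)

(** Once [e] is below [eps * (1 - h) / 2] the forcing contributes at most [eps / 2], while the value
    at the starting index is damped by [h ^ j]. *)
Lemma contraction_lim_0 t e h : 0 < h < 1 -> (forall n, 0 <= t n) ->
  (forall n, t (S n) <= h * t n + e n) -> is_lim_seq e 0 -> is_lim_seq t 0.
Proof.
  intros Hh Ht Hs He. apply is_lim_seq_0_eps; [exact Ht|]. intros eps Heps.
  assert (He' : 0 < eps * (1 - h) / 2) by nra.
  destruct (is_lim_seq_0_eventually e _ He He') as [N HN].
  assert (A : forall j, t (N + j)%nat <= h ^ j * t N + eps / 2).
  { induction j as [|j IH].
    - rewrite Nat.add_0_r. simpl. lra.
    - rewrite Nat.add_succ_r. specialize (Hs (N + j)%nat).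
      assert (B := HN (N + j)%nat ltac:(lia)). apply Rabs_def2 in B. simpl. nra. }
  assert (G : is_lim_seq (fun j => t N * h ^ j) 0).
  { apply is_lim_seq_scal0, is_lim_seq_geom. rewrite Rabs_right; lra. }
  destruct (is_lim_seq_0_eventually _ (eps / 2) G) as [N' HN']; [lra|].
  exists (N + N')%nat. intros n Hn. replace n with (N + (n - N))%nat by lia.
  eapply Rle_trans; [apply A|]. assert (B := HN' (n - N)%nat ltac:(lia)).
  apply Rabs_def2 in B. lra.
Qed.

Section Spectrum.

Context (lam mu : nat -> R).
Context (lam_pos : forall n, 0 < lam n) (mu_pos : forall n, 0 < mu (S n)) (mu_0 : mu 0%nat = 0).
Context (F : C -> C) (HF : forall z, Clim (Qn lam mu z) (F z)).
Context (h C0 : R) (hh : 0 < h < 1) (C0_pos : 0 < C0).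

Local Notation Q := (Qn lam mu).
Local Notation P := (Rn lam mu).
Local Notation wt := (bdpi lam mu).

Context (wt_le : forall n, wt n <= C0 * / (h ^ 2) ^ n).
Context (wt_ge : forall n, / C0 * / (h ^ 2) ^ n <= wt n).
Context (lamwt_le : forall n, / (lam n * wt n) <= C0 * ((h ^ 2) ^ 3) ^ n).
Context (lam_le : forall n, lam n <= C0 * / (h ^ 4) ^ n).
Context (mu_le : forall n, mu (S n) <= C0 * / (h ^ 4) ^ n).

Local Notation a := (fun n => lam n + mu n).
Local Notation b := (fun n => sqrt (lam n * mu (S n))).
Local Notation J := (jacobi_action a b).

(** Bounds are stated in powers of [h] because conjugation by [sqrt (wt n)], of order [q^(-n/2)],
    would otherwise bring in half-integral exponents. *)
Let q := h ^ 2.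

Local Lemma q_range : 0 < q < 1.
Proof. unfold q; simpl; nra. Qed.

Local Lemma h_pow n : 0 < h ^ n.
Proof. apply pow_lt; lra. Qed.

(* Conjugation by [sgm] turns the Jacobi matrix into the birth-and-death
   operator [y |-> lam n (y n - y (n+1)) + mu n (y n - y (n-1))]. *)
Definition sgm (n : nat) : R := (-1) ^ n * sqrt (wt n).

Lemma sgm_sqr n : sgm n * sgm n = wt n.
Proof.
  unfold sgm. replace ((-1) ^ n * sqrt (wt n) * ((-1) ^ n * sqrt (wt n)))
    with (((-1) ^ n * (-1) ^ n) * (sqrt (wt n) * sqrt (wt n))) by ring.
  rewrite pow_m1_sqr, sqrt_sqrt; [ring|]. left; apply bdpi_pos; assumption.
Qed.

Lemma Rabs_sgm n : Rabs (sgm n) = sqrt (wt n).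
Proof.
  unfold sgm. rewrite Rabs_mult, pow_1_abs, Rmult_1_l.
  apply Rabs_right, Rle_ge, sqrt_pos.
Qed.

Lemma sgm_neq_0 n : sgm n <> 0.
Proof.
  intros E. assert (A := sgm_sqr n). rewrite E in A.
  assert (B := bdpi_pos _ _ lam_pos mu_pos n). lra.
Qed.

Lemma sgm_le n : Rabs (sgm n) <= sqrt C0 * / h ^ n.
Proof.
  rewrite Rabs_sgm. assert (Hn := h_pow n).
  replace (sqrt C0 * / h ^ n) with (sqrt (C0 * / (h ^ 2) ^ n)).
  - apply sqrt_le_1_alt, wt_le.
  - rewrite pow_swap, sqrt_mult_alt by lra. f_equal.
    rewrite sqrt_inv, sqrt_pow2 by lra. reflexivity.
Qed.

Lemma sgm_ge n : sqrt (/ C0) <= Rabs (sgm n).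
Proof.
  rewrite Rabs_sgm. apply sqrt_le_1_alt. eapply Rle_trans; [|apply wt_ge].
  assert (0 < / C0) by (apply Rinv_0_lt_compat; lra).
  assert (1 <= / (h ^ 2) ^ n); [|nra].
  rewrite <- Rinv_1. apply Rinv_le_contravar.
  - apply pow_lt, pow_lt; lra.
  - rewrite <- (pow1 n). apply pow_incr. assert (A := q_range). unfold q in A. lra.
Qed.

(** Detailed balance under the square root gives the modulus; the sign [(-1) ^ n] reconciles the
    positive off-diagonal entries of the matrix with the negative ones of the birth-and-death
    operator. *)
Lemma b_sgm_S n : b n * sgm (S n) = - lam n * sgm n.
Proof.
  unfold sgm. assert (L := lam_pos n). assert (M := mu_pos n).
  assert (W := bdpi_pos _ _ lam_pos mu_pos n). assert (W' := bdpi_pos _ _ lam_pos mu_pos (S n)).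
  assert (E : sqrt (lam n * mu (S n)) * sqrt (wt (S n)) = lam n * sqrt (wt n)).
  { rewrite <- sqrt_mult_alt by nra.
    rewrite <- (sqrt_square (lam n)) at 2 by lra.
    rewrite <- sqrt_mult_alt by nra. f_equal. simpl. field. lra. }
  simpl pow. cbv beta.
  transitivity (- (-1) ^ n * (sqrt (lam n * mu (S n)) * sqrt (wt (S n)))); [ring|].
  rewrite E. ring.
Qed.

Lemma b_sgm n : b n * sgm n = - mu (S n) * sgm (S n).
Proof.
  unfold sgm. assert (L := lam_pos n). assert (M := mu_pos n).
  assert (W := bdpi_pos _ _ lam_pos mu_pos n). assert (W' := bdpi_pos _ _ lam_pos mu_pos (S n)).
  assert (E : sqrt (lam n * mu (S n)) * sqrt (wt n) = mu (S n) * sqrt (wt (S n))).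
  { rewrite <- sqrt_mult_alt by nra.
    rewrite <- (sqrt_square (mu (S n))) at 2 by lra.
    rewrite <- sqrt_mult_alt by nra. f_equal. simpl. field. lra. }
  simpl pow. cbv beta.
  transitivity ((-1) ^ n * (sqrt (lam n * mu (S n)) * sqrt (wt n))); [ring|].
  rewrite E. ring.
Qed.

Lemma b_pos n : 0 < b n.
Proof. apply sqrt_lt_R0, Rmult_lt_0_compat; auto. Qed.

Lemma b_le n : b n <= C0 * / (h ^ 4) ^ n.
Proof.
  assert (Hp : 0 < / (h ^ 4) ^ n) by (apply Rinv_0_lt_compat, pow_lt, h_pow).
  rewrite <- (sqrt_square (C0 * / (h ^ 4) ^ n)) by nra.
  apply sqrt_le_1_alt. specialize (lam_le n); specialize (mu_le n).
  assert (L := lam_pos n). assert (M := mu_pos n).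
  apply Rmult_le_compat; lra.
Qed.

(* The increments of [flux y] are [wt n] times the birth-and-death operator
   applied to [y]. *)
Definition flux (y : nat -> C) (n : nat) : C :=
  Cmult (RtoC (lam n * wt n)) (Cminus (y n) (y (S n))).

Lemma jacobi_flux_0 y :
  J (fun n => Cmult (RtoC (sgm n)) (y n)) 0%nat = flux y 0.
Proof.
  unfold jacobi_action, flux. rewrite mu_0.
  assert (E := b_sgm_S 0). apply (f_equal RtoC) in E. rewrite !RtoC_mult, RtoC_opp in E.
  rewrite (Cmult_assoc (RtoC (sqrt _)) (RtoC (sgm 1))), E.
  replace (sgm 0) with 1 by (unfold sgm; simpl; rewrite sqrt_1; ring).
  simpl bdpi. rewrite Rmult_1_r, Rplus_0_r. ring.
Qed.

(** The extra factor [sgm (S n)] turns the conjugated row into one weighted by [wt (S n)], and in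
    this form it is a difference of fluxes. *)
Lemma jacobi_flux_S y n :
  Cmult (RtoC (sgm (S n))) (J (fun n => Cmult (RtoC (sgm n)) (y n)) (S n))
  = Cminus (flux y (S n)) (flux y n).
Proof.
  unfold jacobi_action, flux.
  assert (E1 := b_sgm_S (S n)). apply (f_equal RtoC) in E1. rewrite !RtoC_mult, RtoC_opp in E1.
  assert (E2 := b_sgm n). apply (f_equal RtoC) in E2. rewrite !RtoC_mult, RtoC_opp in E2.
  rewrite (Cmult_assoc (RtoC (sqrt _)) (RtoC (sgm (S (S n))))), E1.
  rewrite (Cmult_assoc (RtoC (sqrt _)) (RtoC (sgm n))), E2.
  rewrite (lampi_mupi _ _ mu_pos n).
  rewrite <- (sgm_sqr (S n)). rewrite !RtoC_mult, RtoC_plus. ring.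
Qed.

(** * Formal eigenvectors and the zeros of [F] *)

Definition pvec (z : C) (n : nat) : C := Cmult (RtoC (sgm n)) (Q z n).

Lemma flux_Q z n : flux (Q z) n = Cmult z (P z n).
Proof. apply Qn_diff; assumption. Qed.

Lemma sgm_cancel n u v : Cmult (RtoC (sgm n)) u = Cmult (RtoC (sgm n)) v -> u = v.
Proof.
  intros E. assert (H := RtoC_neq_0 _ (sgm_neq_0 n)).
  replace u with (/ sgm n * (sgm n * u))%C by (field; exact H).
  rewrite E. field; exact H.
Qed.

Lemma sgm_0 : sgm 0 = 1.
Proof. unfold sgm; simpl; rewrite sqrt_1; ring. Qed.

Lemma pvec_eigen z n : J (pvec z) n = Cmult z (pvec z n).
Proof.
  destruct n as [|n].
  - unfold pvec. rewrite jacobi_flux_0, flux_Q, sgm_0. unfold Rn, Qn; simpl; ring.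
  - apply (sgm_cancel (S n)). unfold pvec. rewrite jacobi_flux_S, !flux_Q, Rn_S.
    rewrite <- (sgm_sqr (S n)), RtoC_mult. ring.
Qed.

Lemma pvec_0 z : pvec z 0 = RtoC 1.
Proof. unfold pvec. rewrite sgm_0. unfold Qn; simpl. ring. Qed.

Lemma jacobi_action_minus (u v : nat -> C) c n :
  J (fun n => Cminus (u n) (Cmult c (v n))) n = Cminus (J u n) (Cmult c (J v n)).
Proof. unfold jacobi_action. destruct n; ring. Qed.

(** Subtracting [w 0] times [pvec z], whose first entry is 1, leaves a solution with first entry
    0. *)
Lemma formal_eigen_unique z w : (forall n, J w n = Cmult z (w n)) ->
  forall n, w n = Cmult (w 0%nat) (pvec z n).
Proof.
  intros H n. set (e := fun n => Cminus (w n) (Cmult (w 0%nat) (pvec z n))).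
  assert (E : e n = RtoC 0).
  { apply (jacobi_homogeneous_0 a b z e).
    - intros k. assert (B := b_pos k); lra.
    - intros k. unfold e. rewrite jacobi_action_minus, H, pvec_eigen. ring.
    - unfold e. rewrite pvec_0. ring. }
  unfold e in E. replace (w n) with (w n - w 0%nat * pvec z n + w 0%nat * pvec z n)%C by ring.
  rewrite E. ring.
Qed.

(** [Q z n] is of order [h^(6n)] and [sgm n] of order [h^(-n)], so [pvec z n] is of order [h^(5n)].
    This beats the growth [h^(-4n)] of [b n], and the boundary terms tend to 0. *)
Lemma eigenvector_at_zero z : F z = RtoC 0 ->
  eigenvector (jacobi_operator a b) z (pvec z).
Proof.
  intros HFz. assert (Hq := q_range).
  destruct (Qn_decay lam mu lam_pos mu_pos F HF q C0 Hq C0_pos wt_le lamwt_le z HFz)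
    as (K & K0 & _ & HQ).
  assert (S0 : 0 < sqrt C0) by (apply sqrt_lt_R0; lra).
  assert (Hp : forall n, Cmod (pvec z n) <= sqrt C0 * K * (h ^ 5) ^ n).
  { intros n. unfold pvec. rewrite Cmod_mult, Cmod_R.
    replace (sqrt C0 * K * (h ^ 5) ^ n) with (sqrt C0 * / h ^ n * (K * (q ^ 3) ^ n)).
    - apply Rmult_le_compat; [apply Rabs_pos|apply Cmod_ge_0|apply sgm_le|apply HQ].
    - unfold q. rewrite <- (pow_mult h 2 3), !(pow_swap h _ n). simpl Nat.mul. field.
      assert (A := h_pow n); lra. }
  assert (h5 : 0 <= h ^ 5 < 1).
  { split; [left; apply h_pow|]. apply pow_lt_1_compat; [lra|lia]. }
  assert (l2p : l2 (pvec z)).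
  { apply (l2_geom _ (sqrt C0 * K) (h ^ 5)); [exact h5|nra|exact Hp]. }
  assert (Hb : forall n u B, Cmod u <= B * (h ^ 5) ^ n -> 0 <= B ->
     0 <= Cmod (Cmult (RtoC (b n)) u) <= C0 * B * h ^ n).
  { intros n u B Hu HB. split; [apply Cmod_ge_0|].
    rewrite Cmod_mult, Cmod_R, Rabs_right by (apply Rle_ge; left; apply b_pos).
    replace (C0 * B * h ^ n) with (C0 * / (h ^ 4) ^ n * (B * (h ^ 5) ^ n)).
    - apply Rmult_le_compat; [left; apply b_pos|apply Cmod_ge_0|apply b_le|exact Hu].
    - rewrite !(pow_swap h _ n). field. assert (A := h_pow n); lra. }
  assert (Lh : forall c, is_lim_seq (fun n => c * h ^ n) 0).
  { intros c. apply is_lim_seq_scal0, is_lim_seq_geom. rewrite Rabs_right; lra. }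
  split.
  - apply jacobi_operator_intro.
    + exact l2p.
    + apply l2_scal, l2p.
    + intros n. rewrite pvec_eigen. reflexivity.
    + apply is_lim_seq_squeeze0 with (2 := Lh (C0 * (sqrt C0 * K))).
      intros n. apply Hb; [apply Hp|nra].
    + apply is_lim_seq_squeeze0 with (2 := Lh (C0 * (sqrt C0 * K))).
      intros n. apply Hb; [|nra]. eapply Rle_trans; [apply Hp|].
      change ((h ^ 5) ^ S n) with (h ^ 5 * (h ^ 5) ^ n).
      assert (0 < (h ^ 5) ^ n) by apply pow_lt, h_pow.
      apply Rmult_le_compat_l; [nra|]. nra.
  - exists 0%nat. rewrite pvec_0. apply RtoC_neq_0; lra.
Qed.

Lemma eigenvalue_simple z : F z = RtoC 0 -> simple_eigenvalue (jacobi_operator a b) z.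
Proof.
  intros H. exists (pvec z). split; [apply eigenvector_at_zero, H|].
  intros w [Hw _]. exists (w 0%nat). apply formal_eigen_unique.
  intros n. symmetry. exact (jacobi_operator_action a b _ _ Hw n).
Qed.

Lemma eigenvalue_in_spectrum z : F z = RtoC 0 -> spectrum (jacobi_operator a b) z.
Proof.
  intros H [_ [M HM]].
  destruct (eigenvector_at_zero z H) as [HT [n Hn]].
  assert (A := HM _ _ HT). unfold l2norm at 2 in A.
  rewrite (Series_ext _ (fun n => 0 * 0)) in A.
  - rewrite Series_scal_l, Rmult_0_l, sqrt_0, Rmult_0_r in A.
    assert (B := l2_term (pvec z) n (proj1 HT)).
    apply Hn, Cmod_eq_0. assert (Hc := Cmod_ge_0 (pvec z n)). lra.
  - intros m. unfold seq_sub. replace (_ - _)%C with (RtoC 0) by ring. rewrite Cmod_0. ring.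
Qed.

(* The solution with [y 0 = 0] of the equation for [n >= 1], paired with its
   flux. *)
Fixpoint PD (z : C) (n : nat) : C * C :=
  match n with
  | O => (RtoC 0, RtoC 1)
  | S m =>
      let p := Cminus (fst (PD z m)) (Cdiv (snd (PD z m)) (RtoC (lam m * wt m))) in
      (p, Cplus (snd (PD z m)) (Cmult z (Cmult (RtoC (wt (S m))) p)))
  end.

Lemma PD_diff z n :
  Cmult (RtoC (lam n * wt n)) (Cminus (fst (PD z n)) (fst (PD z (S n)))) = snd (PD z n).
Proof.
  simpl. field. apply RtoC_neq_0. assert (A := lampi_pos _ _ lam_pos mu_pos n). lra.
Qed.

Lemma PD_S z n : snd (PD z (S n)) =
  Cplus (snd (PD z n)) (Cmult z (Cmult (RtoC (wt (S n))) (fst (PD z (S n))))).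
Proof. reflexivity. Qed.

(** The discrete Wronskian of the two solutions, written with fluxes; its constant value is fixed by
    the initial data [(0, 1)] of [PD] and [Q z 0 = 1]. *)
Lemma PD_wronskian z n :
  Cminus (Cmult (snd (PD z n)) (Q z n)) (Cmult z (Cmult (P z n) (fst (PD z n)))) = RtoC 1.
Proof.
  induction n as [|n IH].
  - unfold Qn, Rn; simpl; ring.
  - assert (D1 := PD_diff z n). assert (D2 := Qn_diff _ _ lam_pos mu_pos z n).
    rewrite PD_S, Rn_S. rewrite <- IH. clear IH.
    set (p := fst (PD z n)) in *. set (p' := fst (PD z (S n))) in *.
    set (d := snd (PD z n)) in *.
    transitivity (d * Q z (S n) - (z * P z n) * p')%C; [ring|].
    transitivity (d * Q z n - (z * P z n) * p)%C; [|ring].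
    assert (E : (d * (Q z n - Q z (S n)) = (z * P z n) * (p - p'))%C).
    { rewrite <- D1, <- D2. ring. }
    replace (Q z (S n)) with (Q z n - (Q z n - Q z (S n)))%C by ring.
    replace p' with (p - (p - p'))%C by ring.
    transitivity (d * Q z n - z * P z n * p - d * (Q z n - Q z (S n)) + z * P z n * (p - p'))%C; [ring|].
    rewrite E. ring.
Qed.

Lemma Qn_bounded_below z : F z <> RtoC 0 ->
  exists c N, 0 < c /\ forall n, (N <= n)%nat -> c <= Cmod (Q z n).
Proof.
  intros H. apply Cmod_gt_0 in H. assert (L := Clim_Cmod _ _ (HF z)).
  exists (Cmod (F z) / 2).
  assert (L' : is_lim_seq (fun n => Cmod (Q z n) - Cmod (F z)) 0).
  { replace (Finite 0) with (Finite (Cmod (F z) - Cmod (F z))) by (f_equal; ring).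
    apply is_lim_seq_minus'; [exact L|apply is_lim_seq_const]. }
  destruct (is_lim_seq_0_eventually _ (Cmod (F z) / 2) L') as [N HN]; [lra|].
  exists N. split; [lra|]. intros n Hn. specialize (HN n Hn). apply Rabs_def2 in HN. lra.
Qed.

(* Subtracting from [PD] the limit of its ratio to [Q] leaves the solution that
   decays at infinity. *)
Lemma decaying_solution z : F z <> RtoC 0 -> exists (Y D : nat -> C) (K : R), 0 < K /\
  (forall n, Cmod (Y n) <= K * (h ^ 6) ^ n) /\
  (forall n, flux Y n = D n) /\
  (forall n, D (S n) = Cplus (D n) (Cmult z (Cmult (RtoC (wt (S n))) (Y (S n))))) /\
  D 0%nat = Cplus (RtoC 1) (Cmult z (Y 0%nat)) /\
  (forall n, Cminus (Cmult (D n) (Q z n)) (Cmult z (Cmult (P z n) (Y n))) = RtoC 1).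
Proof.
  intros H. destruct (Qn_bounded_below z H) as (c & N & Hc & HN).
  destruct (Clim_bounded _ _ (HF z)) as (M & M0 & HM).
  (* [Q z] may vanish at finitely many indices, so ratios are formed only from [N] on. *)
  assert (Q0 : forall n, (N <= n)%nat -> Q z n <> RtoC 0).
  { intros n Hn. apply Cmod_gt_0. specialize (HN n Hn). lra. }
  set (t := fun j => Cdiv (fst (PD z (N + j))) (Q z (N + j))).
  assert (h6 : 0 <= h ^ 6 < 1).
  { split; [left; apply h_pow|]. apply pow_lt_1_compat; [lra|lia]. }
  (* By the Wronskian, consecutive ratios differ by [- 1 / (lam n * wt n * Q z n * Q z (S n))],
     which is of order [h^(6n)]. *)
  assert (Hstep : forall j, Cmod (t (S j) - t j) <= (/ c * / c * C0 * (h ^ 6) ^ N) * (h ^ 6) ^ j).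
  { intros j. unfold t. rewrite Nat.add_succ_r. set (n := (N + j)%nat).
    assert (Hn : (N <= n)%nat) by (unfold n; lia).
    assert (A1 := Q0 n Hn). assert (A2 := Q0 (S n) ltac:(lia)).
    assert (L := lampi_pos _ _ lam_pos mu_pos n).
    assert (E : (fst (PD z (S n)) / Q z (S n) - fst (PD z n) / Q z n
       = - (RtoC (/ (lam n * wt n)) * (/ Q z n * / Q z (S n))))%C).
    { assert (W := PD_wronskian z n). rewrite <- (PD_diff z n) in W.
      assert (D2 := Qn_diff _ _ lam_pos mu_pos z n).
      set (p := fst (PD z n)) in *. set (p' := fst (PD z (S n))) in *.
      assert (W2 : (RtoC (lam n * wt n) * (p * Q z (S n) - p' * Q z n) = 1)%C).
      { rewrite <- W. rewrite (Cmult_assoc z), <- D2. ring. }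
      rewrite RtoC_Rinv. set (l := RtoC (lam n * wt n)) in *.
      assert (l0 : l <> RtoC 0) by (apply RtoC_neq_0; lra).
      replace (/ l * (/ Q z n * / Q z (S n)))%C
        with (/ l * (/ Q z n * / Q z (S n)) * 1)%C by ring.
      rewrite <- W2. field. repeat split; assumption. }
    rewrite E, Cmod_opp, !Cmod_mult, !Cmod_inv, Cmod_R by assumption.
    rewrite Rabs_right by (apply Rle_ge; left; apply Rinv_0_lt_compat, L).
    assert (B1 : / Cmod (Q z n) <= / c) by (apply Rinv_le_contravar; auto).
    assert (B2 : / Cmod (Q z (S n)) <= / c) by (apply Rinv_le_contravar; auto).
    assert (G1 : 0 < / Cmod (Q z n)) by (apply Rinv_0_lt_compat, Cmod_gt_0, A1).
    assert (G2 : 0 < / Cmod (Q z (S n))) by (apply Rinv_0_lt_compat, Cmod_gt_0, A2).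
    assert (G3 : 0 < / (lam n * wt n)) by (apply Rinv_0_lt_compat, L).
    replace (/ c * / c * C0 * (h ^ 6) ^ N * (h ^ 6) ^ j)
      with ((C0 * ((h ^ 2) ^ 3) ^ n) * (/ c * / c)).
    - apply Rmult_le_compat; [lra|nra|apply lamwt_le|]. apply Rmult_le_compat; lra.
    - unfold n. rewrite <- (pow_mult h 2 3). simpl Nat.mul. rewrite pow_add. ring. }
  destruct (Cgeom_cauchy t _ _ h6 Hstep) as [xi Hxi].
  set (Y := fun n => Cminus (fst (PD z n)) (Cmult xi (Q z n))).
  set (D := fun n => Cminus (snd (PD z n)) (Cmult xi (Cmult z (P z n)))).
  set (K1 := 2 * (/ c * / c * C0 * (h ^ 6) ^ N) / (1 - h ^ 6)) in Hxi.
  assert (BY : forall j, Cmod (Y (N + j)%nat) <= M * Rabs K1 * (h ^ 6) ^ j).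
  { intros j. replace (Y (N + j)%nat) with (Q z (N + j) * (t j - xi))%C.
    - rewrite Cmod_mult, Rmult_assoc. apply Rmult_le_compat; [apply Cmod_ge_0..|apply HM|].
      eapply Rle_trans; [apply Hxi|]. apply Rmult_le_compat_r; [apply pow_le; apply h6|apply Rle_abs].
    - unfold Y, t. field. apply Q0; lia. }
  (* The indices below [N] are absorbed into the constant. *)
  assert (Hhead : forall m, exists K, 0 < K /\ forall n, (n < m)%nat -> Cmod (Y n) <= K * (h ^ 6) ^ n).
  { induction m as [|m (K & K0 & HK)]; [exists 1; split; [lra|intros; lia]|].
    assert (Hp : 0 < (h ^ 6) ^ m) by apply pow_lt, h_pow.
    exists (K + Cmod (Y m) * / (h ^ 6) ^ m).
    assert (0 <= Cmod (Y m) * / (h ^ 6) ^ m).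
    { apply Rmult_le_pos; [apply Cmod_ge_0|left; apply Rinv_0_lt_compat, Hp]. }
    split; [lra|]. intros n Hn. destruct (Nat.eq_dec n m) as [->|].
    - rewrite Rmult_plus_distr_r. rewrite Rmult_assoc, Rinv_l by lra. nra.
    - eapply Rle_trans; [apply HK; lia|]. apply Rmult_le_compat_r; [|lra].
      left; apply pow_lt, h_pow. }
  destruct (Hhead N) as (K2 & K20 & HK2).
  assert (HpN : 0 < (h ^ 6) ^ N) by apply pow_lt, h_pow.
  assert (HK3 : 0 <= M * Rabs K1 * / (h ^ 6) ^ N).
  { apply Rmult_le_pos; [apply Rmult_le_pos; [lra|apply Rabs_pos]|left; apply Rinv_0_lt_compat, HpN]. }
  exists Y, D, (K2 + M * Rabs K1 * / (h ^ 6) ^ N). split; [lra|]. split; [|split; [|split; [|split]]].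
  - intros n. assert (Hpn : 0 < (h ^ 6) ^ n) by apply pow_lt, h_pow.
    destruct (Nat.lt_ge_cases n N) as [Hn|Hn].
    + specialize (HK2 n Hn). nra.
    + replace n with (N + (n - N))%nat at 1 by lia. eapply Rle_trans; [apply BY|].
      rewrite Rmult_plus_distr_r.
      replace (M * Rabs K1 * / (h ^ 6) ^ N * (h ^ 6) ^ n) with (M * Rabs K1 * (h ^ 6) ^ (n - N)).
      * nra.
      * replace n with (N + (n - N))%nat at 2 by lia. rewrite pow_add. field. lra.
  - intros n. unfold flux, Y, D. rewrite <- PD_diff, <- (Qn_diff _ _ lam_pos mu_pos z n). ring.
  - intros n. unfold D, Y. rewrite PD_S, Rn_S. ring.
  - unfold D, Y. unfold Rn, Qn; simpl. ring.
  - intros n. unfold D, Y. rewrite <- (PD_wronskian z n). ring.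
Qed.

(* Variation of parameters: [u = sgm * (Y * A + Qn z * B)] with [A n] a sum over
   [m <= n] and [B n] a sum over [m > n]. *)
Lemma resolvent_solution z : F z <> RtoC 0 -> exists K, 0 < K /\
  forall f, l2 f -> exists u,
    (forall n, J u n = Cplus (Cmult z (u n)) (f n)) /\
    (forall n, Cmod (u n) <= K * l2norm f * (h ^ 4) ^ n) /\
    is_lim_seq (fun n => Cmod (u n) * / (h ^ 4) ^ n) 0.
Proof.
  intros H. destruct (decaying_solution z H) as (Y & D & KY & KY0 & HY & HD & HDS & HD0 & HW).
  destruct (Clim_bounded _ _ (HF z)) as (M & M0 & HM).
  set (s0 := sqrt C0). assert (s00 : 0 < s0) by (apply sqrt_lt_R0; lra).
  (* [KA] and [KB] are geometric sums: they bound [A n * h ^ n] and [B n / (h ^ 5) ^ n] in units of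
     the norm of [f]. The 2 in [KB] is that of [Cgeom_cauchy]. *)
  set (KA := s0 * M / (1 - h)). set (KB := 2 * (s0 * KY) / (1 - h ^ 5)).
  assert (h5 : 0 <= h ^ 5 < 1).
  { split; [left; apply h_pow|]. apply pow_lt_1_compat; [lra|lia]. }
  assert (KA0 : 0 < KA) by (unfold KA; apply Rdiv_lt_0_compat; nra).
  assert (KB0 : 0 < KB) by (unfold KB; apply Rdiv_lt_0_compat; nra).
  exists (s0 * (KY * KA + M * KB)). split.
  { apply Rmult_lt_0_compat; [lra|]. apply Rplus_lt_0_compat; apply Rmult_lt_0_compat; lra. } intros f Hf.
  set (phi := l2norm f). assert (phi0 : 0 <= phi) by apply l2norm_nonneg.
  assert (Hphi : forall n, Cmod (f n) <= phi) by (intros n; apply l2_term, Hf).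
  set (A := fun n => Csum (fun m => Cmult (RtoC (sgm m)) (Cmult (Q z m) (f m))) (S n)).
  set (G := fun n => Csum (fun m => Cmult (RtoC (sgm m)) (Cmult (Y m) (f m))) n).
  assert (termA : forall n, Cmod (RtoC (sgm n) * (Q z n * f n)) <= s0 * M * Cmod (f n) * / h ^ n).
  { intros n. rewrite !Cmod_mult, Cmod_R. assert (Hs := sgm_le n). fold s0 in Hs.
    replace (s0 * M * Cmod (f n) * / h ^ n) with (s0 * / h ^ n * (M * Cmod (f n))) by ring.
    apply Rmult_le_compat; [apply Rabs_pos| |exact Hs|].
    - apply Rmult_le_pos; apply Cmod_ge_0.
    - apply Rmult_le_compat_r; [apply Cmod_ge_0|apply HM]. }
  assert (termG : forall n, Cmod (RtoC (sgm n) * (Y n * f n)) <= s0 * KY * Cmod (f n) * (h ^ 5) ^ n).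
  { intros n. rewrite !Cmod_mult, Cmod_R. assert (Hs := sgm_le n). fold s0 in Hs.
    replace (s0 * KY * Cmod (f n) * (h ^ 5) ^ n)
      with (s0 * / h ^ n * (KY * (h ^ 6) ^ n * Cmod (f n))).
    - apply Rmult_le_compat; [apply Rabs_pos| |exact Hs|].
      + apply Rmult_le_pos; apply Cmod_ge_0.
      + apply Rmult_le_compat_r; [apply Cmod_ge_0|apply HY].
    - rewrite !(pow_swap h _ n). field. assert (X := h_pow n); lra. }
  assert (stepA : forall n, Cmod (A (S n)) * h ^ S n
     <= h * (Cmod (A n) * h ^ n) + s0 * M * Cmod (f (S n))).
  { intros n. change (A (S n)) with (A n + RtoC (sgm (S n)) * (Q z (S n) * f (S n)))%C.
    assert (T := Cmod_triangle (A n) (RtoC (sgm (S n)) * (Q z (S n) * f (S n)))%C).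
    specialize (termA (S n)). assert (X := h_pow (S n)).
    assert (E : s0 * M * Cmod (f (S n)) * / h ^ S n * h ^ S n = s0 * M * Cmod (f (S n)))
      by (field; lra).
    rewrite <- E. replace (h * (Cmod (A n) * h ^ n)) with (Cmod (A n) * h ^ S n) by (simpl; ring).
    rewrite <- Rmult_plus_distr_r. apply Rmult_le_compat_r; lra. }
  assert (boundA : forall n, Cmod (A n) * h ^ n <= KA * phi).
  { assert (EK : KA * (1 - h) = s0 * M) by (unfold KA; field; lra).
    induction n as [|n IH].
    - change (A 0%nat) with (RtoC 0 + RtoC (sgm 0) * (Q z 0 * f 0%nat))%C. rewrite Cplus_0_l.
      specialize (termA 0%nat). specialize (Hphi 0%nat). simpl in *. rewrite Rinv_1 in termA.
      rewrite Rmult_1_r in *. eapply Rle_trans; [exact termA|].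
      assert (Hf0 := Cmod_ge_0 (f 0%nat)).
      apply Rmult_le_compat; try lra; nra.
    - eapply Rle_trans; [apply stepA|]. specialize (Hphi (S n)).
      assert (s0 * M * Cmod (f (S n)) <= s0 * M * phi) by (apply Rmult_le_compat_l; nra).
      rewrite <- EK in H0 at 2. nra. }
  (* The weight [h ^ n] merely compensates the growth of the terms of [A]; the decay to 0 comes from
     the entries of the square-summable [f]. *)
  assert (limA : is_lim_seq (fun n => Cmod (A n) * h ^ n) 0).
  { apply contraction_lim_0 with (e := fun n => s0 * M * Cmod (f (S n))) (1 := hh).
    - intros n. apply Rmult_le_pos; [apply Cmod_ge_0|left; apply h_pow].
    - exact stepA.
    - apply is_lim_seq_scal0. exact (proj1 (is_lim_seq_incr_1 (fun n => Cmod (f n)) _) (l2_lim_0 f Hf)). }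
  assert (stepG : forall N eps, (forall m, (N <= m)%nat -> Cmod (f m) <= eps) ->
    forall j, Cmod (G (N + S j)%nat - G (N + j)%nat) <= (s0 * KY * eps * (h ^ 5) ^ N) * (h ^ 5) ^ j).
  { intros N eps He j. rewrite Nat.add_succ_r. unfold G. simpl Csum.
    match goal with |- Cmod (Cminus (Cplus ?x ?y) ?x) <= _ =>
      replace (Cminus (Cplus x y) x) with y by ring end.
    eapply Rle_trans; [apply termG|]. rewrite pow_add, <- Rmult_assoc.
    apply Rmult_le_compat_r; [apply pow_le; lra|].
    apply Rmult_le_compat_r; [apply pow_le; lra|].
    apply Rmult_le_compat_l; [nra|]. apply He; lia. }
  destruct (Cgeom_cauchy (fun j => G (0 + j)%nat) _ _ h5 (stepG 0%nat phi (fun m _ => Hphi m)))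
    as [beta Hbeta].
  assert (limG : Clim G beta).
  { red. eapply is_lim_seq_squeeze0.
    2:{ apply is_lim_seq_scal0, is_lim_seq_geom. rewrite Rabs_right; [apply h5|lra]. }
    intros n; split; [apply Cmod_ge_0|apply Hbeta]. }
  set (B := fun n => Cminus beta (G (S n))).
  (* Applied twice: with [N = 0] and the norm of [f] for the uniform bound, and with [N] large and
     [eps] small for the limit. *)
  assert (boundB : forall N eps, (forall m, (N <= m)%nat -> Cmod (f m) <= eps) -> 0 <= eps ->
    forall n, (N <= n)%nat -> Cmod (B n) <= KB * eps * (h ^ 5) ^ n).
  { intros N eps He He0 n Hn.
    assert (L : Clim (fun j => G (N + j)%nat) beta).
    { red. eapply is_lim_seq_ext; [|apply (proj1 (is_lim_seq_incr_n _ N _) limG)].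
      intros j; cbv beta. now rewrite Nat.add_comm. }
    assert (T := Clim_geom_tail _ _ _ _ h5 L (stepG N eps He) (S n - N)%nat). cbv beta in T.
    replace (N + (S n - N))%nat with (S n) in T by lia.
    unfold B. replace (beta - G (S n))%C with (- (G (S n) - beta))%C by ring.
    rewrite Cmod_opp. eapply Rle_trans; [exact T|].
    replace (2 * (s0 * KY * eps * (h ^ 5) ^ N) / (1 - h ^ 5) * (h ^ 5) ^ (S n - N))
      with (KB * eps * (h ^ 5) ^ S n).
    - apply Rmult_le_compat_l; [nra|]. simpl.
      assert (0 <= (h ^ 5) ^ n) by (apply pow_le; lra). simpl in *. nra.
    - replace (S n) with (N + (S n - N))%nat at 1 by lia. rewrite pow_add. unfold KB. field. lra. }
  assert (limB : is_lim_seq (fun n => Cmod (B n) * / (h ^ 5) ^ n) 0).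
  { apply is_lim_seq_0_eps.
    - intros n. apply Rmult_le_pos; [apply Cmod_ge_0|]. left; apply Rinv_0_lt_compat, pow_lt, h_pow.
    - intros eps He. assert (He' : 0 < eps / KB) by (apply Rdiv_lt_0_compat; lra).
      destruct (is_lim_seq_0_eventually _ _ (l2_lim_0 f Hf) He') as [N HN].
      exists N. intros n Hn.
      assert (Bn : Cmod (B n) <= KB * (eps / KB) * (h ^ 5) ^ n).
      { apply (boundB N); [|lra|exact Hn]. intros m Hm. specialize (HN m Hm).
        rewrite Rabs_right in HN; [lra|apply Rle_ge, Cmod_ge_0]. }
      replace (KB * (eps / KB)) with eps in Bn by (field; lra).
      assert (X : 0 < (h ^ 5) ^ n) by apply pow_lt, h_pow.
      apply Rmult_le_reg_r with ((h ^ 5) ^ n); [exact X|].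
      rewrite Rmult_assoc, Rinv_l by lra. lra. }
  set (y := fun n => Cplus (Cmult (Y n) (A n)) (Cmult (Q z n) (B n))).
  (* Division by [(h ^ 4) ^ n], matching the growth of [b n], leaves the two scaled quantities
     already shown to be bounded and to tend to 0; the latter puts [u] in the domain. *)
  assert (Ucommon : forall n, Cmod (RtoC (sgm n) * y n) * / (h ^ 4) ^ n
    <= s0 * (KY * (Cmod (A n) * h ^ n) + M * (Cmod (B n) * / (h ^ 5) ^ n))).
  { intros n. rewrite Cmod_mult, Cmod_R. assert (X := h_pow n).
    assert (Y1 : Cmod (y n) <= KY * (h ^ 6) ^ n * Cmod (A n) + M * Cmod (B n)).
    { unfold y. eapply Rle_trans; [apply Cmod_triangle|]. rewrite !Cmod_mult.
      apply Rplus_le_compat; apply Rmult_le_compat_r; try apply Cmod_ge_0; [apply HY|apply HM]. }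
    assert (Hs := sgm_le n). fold s0 in Hs.
    assert (X4 : 0 < / (h ^ 4) ^ n) by apply Rinv_0_lt_compat, pow_lt, h_pow.
    apply Rle_trans with (s0 * / h ^ n * (KY * (h ^ 6) ^ n * Cmod (A n) + M * Cmod (B n)) * / (h ^ 4) ^ n).
    - apply Rmult_le_compat_r; [lra|].
      apply Rmult_le_compat; [apply Rabs_pos|apply Cmod_ge_0|exact Hs|exact Y1].
    - right. rewrite !(pow_swap h _ n). field. lra. }
  exists (fun n => Cmult (RtoC (sgm n)) (y n)). split; [|split].
  - assert (FY : forall n, flux y n = Cplus (Cmult (D n) (A n)) (Cmult z (Cmult (P z n) (B n)))).
    { intros n. rewrite <- HD. unfold flux.
      replace (z * (P z n * B n))%C with ((z * P z n) * B n)%C by ring.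
      rewrite <- (Qn_diff _ _ lam_pos mu_pos z n).
      replace (y (S n)) with (Y (S n) * A n + Q z (S n) * B n)%C.
      - unfold y. ring.
      - unfold y. change (A (S n)) with (A n + RtoC (sgm (S n)) * (Q z (S n) * f (S n)))%C.
        unfold B. change (G (S (S n))) with (G (S n) + RtoC (sgm (S n)) * (Y (S n) * f (S n)))%C.
        ring. }
    intros n. destruct n as [|n].
    + rewrite jacobi_flux_0, FY, HD0, sgm_0. unfold y, B.
      change (A 0%nat) with (RtoC 0 + RtoC (sgm 0) * (Q z 0 * f 0%nat))%C.
      change (G 1%nat) with (RtoC 0 + RtoC (sgm 0) * (Y 0%nat * f 0%nat))%C.
      rewrite sgm_0. unfold Qn, Rn; simpl. ring.
    + apply (sgm_cancel (S n)). rewrite jacobi_flux_S, !FY.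
      change (A (S n)) with (A n + RtoC (sgm (S n)) * (Q z (S n) * f (S n)))%C.
      assert (EB : B n = (B (S n) + RtoC (sgm (S n)) * (Y (S n) * f (S n)))%C).
      { unfold B. change (G (S (S n))) with (G (S n) + RtoC (sgm (S n)) * (Y (S n) * f (S n)))%C. ring. }
      assert (W := HW (S n)).
      assert (EP : P z n = (P z (S n) - RtoC (wt (S n)) * Q z (S n))%C) by (rewrite Rn_S; ring).
      assert (ED : D n = (D (S n) - z * (RtoC (wt (S n)) * Y (S n)))%C) by (rewrite HDS; ring).
      unfold y. change (A (S n)) with (A n + RtoC (sgm (S n)) * (Q z (S n) * f (S n)))%C.
      rewrite EB, EP, ED. rewrite <- (sgm_sqr (S n)), RtoC_mult.
      set (s := RtoC (sgm (S n))) in *. set (g := f (S n)).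
      set (d := D (S n)) in *. set (p := P z (S n)) in *.
      set (Qs := Q z (S n)) in *. set (Ys := Y (S n)) in *.
      (* With everything expressed at index [S n], the coefficient of [s * g] is the Wronskian,
         which equals 1. *)
      transitivity (s * (z * (s * (Ys * (A n + s * (Qs * g)) + Qs * B (S n)))) + s * g * (d * Qs - z * (p * Ys)))%C.
      * ring.
      * rewrite W. ring.
  - intros n. assert (X4 : 0 < (h ^ 4) ^ n) by apply pow_lt, h_pow.
    assert (X5 : 0 < (h ^ 5) ^ n) by apply pow_lt, h_pow.
    assert (U := Ucommon n). assert (UA := boundA n).
    assert (UB := boundB 0%nat phi (fun m _ => Hphi m) phi0 n ltac:(lia)).
    assert (UB' : Cmod (B n) * / (h ^ 5) ^ n <= KB * phi).
    { apply Rmult_le_reg_r with ((h ^ 5) ^ n); [exact X5|].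
      rewrite Rmult_assoc, Rinv_l by lra. lra. }
    apply Rmult_le_reg_r with (/ (h ^ 4) ^ n); [apply Rinv_0_lt_compat, X4|].
    rewrite Rmult_assoc, Rinv_r, Rmult_1_r by lra.
    eapply Rle_trans; [exact U|].
    rewrite Rmult_assoc. apply Rmult_le_compat_l; [lra|].
    assert (KY * (Cmod (A n) * h ^ n) <= KY * (KA * phi)) by (apply Rmult_le_compat_l; lra).
    assert (M * (Cmod (B n) * / (h ^ 5) ^ n) <= M * (KB * phi)) by (apply Rmult_le_compat_l; lra).
    lra.
  - eapply is_lim_seq_squeeze0.
    2:{ apply (is_lim_seq_scal0 s0), is_lim_seq_plus0;
          [apply (is_lim_seq_scal0 KY), limA|apply (is_lim_seq_scal0 M), limB]. }
    intros n. split; [|apply Ucommon].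
    apply Rmult_le_pos; [apply Cmod_ge_0|]. left; apply Rinv_0_lt_compat, pow_lt, h_pow.
Qed.

(** A formal solution is a multiple of [pvec z], whose entries stay away from 0: [sgm] is bounded
    below and [Q z] has a nonzero limit. *)
Lemma formal_eigen_decay_0 z e : F z <> RtoC 0 -> (forall n, J e n = Cmult z (e n)) ->
  is_lim_seq (fun n => Cmod (e n)) 0 -> forall n, e n = RtoC 0.
Proof.
  intros HFz He L.
  assert (E := formal_eigen_unique z e He).
  destruct (Qn_bounded_below z HFz) as (c & N & Hc & HN).
  set (k := sqrt (/ C0) * c).
  assert (k0 : 0 < k).
  { apply Rmult_lt_0_compat; [|exact Hc]. apply sqrt_lt_R0, Rinv_0_lt_compat, C0_pos. }
  assert (A : Cmod (e 0%nat) * k <= 0).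
  { refine (is_lim_seq_le_loc (fun _ => Cmod (e 0%nat) * k) (fun n => Cmod (e n))
      (Finite _) (Finite 0) _ (is_lim_seq_const _) L).
    exists N. intros n Hn. rewrite (E n), Cmod_mult. apply Rmult_le_compat_l; [apply Cmod_ge_0|].
    unfold pvec. rewrite Cmod_mult, Cmod_R. unfold k.
    apply Rmult_le_compat; [apply sqrt_pos|lra|apply sgm_ge|apply HN, Hn]. }
  assert (E0 : e 0%nat = RtoC 0).
  { apply Cmod_eq_0. assert (B := Cmod_ge_0 (e 0%nat)). nra. }
  intros n. rewrite (E n), E0. ring.
Qed.

(** Variation of parameters gives surjectivity. For the bound, a given [u] and the constructed
    solution with the same right side differ by a square-summable formal eigenvector, which is 0, so
    [u] inherits the estimate. *)
Lemma in_resolvent_set_nonzero z : F z <> RtoC 0 -> in_resolvent_set (jacobi_operator a b) z.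
Proof.
  intros HFz. destruct (resolvent_solution z HFz) as (K & K0 & HK).
  assert (h4 : 0 <= h ^ 4 < 1).
  { split; [left; apply h_pow|]. apply pow_lt_1_compat; [lra|lia]. }
  assert (Hl2 : forall f u, (forall n, Cmod (u n) <= K * l2norm f * (h ^ 4) ^ n) ->
    l2 u /\ l2norm u <= sqrt (/ (1 - (h ^ 4) ^ 2)) * (K * l2norm f)).
  { intros f u Hu. apply l2_geom; [exact h4| |exact Hu].
    apply Rmult_le_pos; [lra|apply l2norm_nonneg]. }
  split.
  - intros f Hf. destruct (HK f Hf) as (u & Hu & Bu & Lu).
    destruct (Hl2 f u Bu) as [l2u _].
    exists u, (fun n => Cplus (Cmult z (u n)) (f n)). split.
    + assert (Hbu : forall n w, 0 <= Cmod (Cmult (RtoC (b n)) w) <= C0 * (Cmod w * / (h ^ 4) ^ n)).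
      { intros n w. split; [apply Cmod_ge_0|].
        rewrite Cmod_mult, Cmod_R, Rabs_right by (apply Rle_ge; left; apply b_pos).
        replace (C0 * (Cmod w * / (h ^ 4) ^ n)) with (C0 * / (h ^ 4) ^ n * Cmod w) by ring.
        apply Rmult_le_compat_r; [apply Cmod_ge_0|apply b_le]. }
      apply jacobi_operator_intro.
      * exact l2u.
      * apply l2_plus; [apply l2_scal, l2u|exact Hf].
      * intros n. symmetry. apply Hu.
      * apply is_lim_seq_squeeze0 with (1 := fun n => Hbu n (u n)).
        apply is_lim_seq_scal0, Lu.
      * apply is_lim_seq_squeeze0 with (1 := fun n => Hbu n (u (S n))).
        apply is_lim_seq_scal0.
        apply is_lim_seq_ext with (fun n => h ^ 4 * (Cmod (u (S n)) * / (h ^ 4) ^ S n)).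
        -- intros n. assert (X := h_pow 4). assert (X' : 0 < (h ^ 4) ^ n) by apply pow_lt, X.
           change ((h ^ 4) ^ S n) with (h ^ 4 * (h ^ 4) ^ n). field. split; lra.
        -- apply is_lim_seq_scal0.
           exact (proj1 (is_lim_seq_incr_1 (fun n => Cmod (u n) * / (h ^ 4) ^ n) _) Lu).
    + intros n. unfold seq_sub, seq_scal. ring.
  - exists (sqrt (/ (1 - (h ^ 4) ^ 2)) * K). intros u v HT.
    assert (HJ := jacobi_operator_action a b u v HT). destruct HT as (l2u & l2v & _).
    set (f := seq_sub v (seq_scal z u)).
    assert (Hf : l2 f) by (apply l2_sub; [exact l2v|apply l2_scal, l2u]).
    destruct (HK f Hf) as (u' & Hu' & Bu & _). destruct (Hl2 f u' Bu) as [l2u' Nu'].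
    assert (E : forall n, u n = u' n).
    { intros n. set (e := fun n => Cminus (u n) (Cmult (RtoC 1) (u' n))).
      assert (E : e n = RtoC 0).
      { apply (formal_eigen_decay_0 z e HFz).
        - intros m. unfold e. rewrite jacobi_action_minus, Hu', <- HJ.
          unfold f, seq_sub, seq_scal. ring.
        - eapply is_lim_seq_ext; [|apply (l2_lim_0 _ (l2_sub _ _ l2u l2u'))].
          intros m; cbv beta. unfold seq_sub, e. f_equal. ring. }
      unfold e in E. replace (u n) with (u n - 1 * u' n + u' n)%C by ring. rewrite E. ring. }
    replace (l2norm u) with (l2norm u').
    + rewrite Rmult_assoc. exact Nu'.
    + unfold l2norm. f_equal. apply Series_ext. intros n; now rewrite E.
Qed.

Lemma birth_death_characteristic_function :
  is_characteristic_function (jacobi_operator a b) F.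
Proof.
  assert (Hq := q_range).
  exists (fun k => / rlim lam mu k).
  assert (Hp : forall k, 0 < rlim lam mu k) by (apply rlim_pos with F; assumption).
  assert (HZ := F_zero_iff lam mu lam_pos mu_pos F HF).
  split.
  - split; [apply Rinv_0_lt_compat, Hp|]. split; [|split; [|split]].
    + intros k. apply Rinv_lt_contravar; [apply Rmult_lt_0_compat; apply Hp|].
      apply rlim_decr with F q C0; assumption.
    + intros z. rewrite <- HZ. split.
      * intros Hs. destruct (excluded_middle_informative (F z = RtoC 0)) as [E|N]; [exact E|].
        exfalso; apply Hs, in_resolvent_set_nonzero, N.
      * apply eigenvalue_in_spectrum.
    + intros k. apply eigenvalue_simple, HZ. exists k; reflexivity.
    + apply ex_series_ext with (rlim lam mu); [intros k; now rewrite Rinv_inv|].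
      apply ex_series_rlim with F; assumption.
  - intros z. apply Clim_filterlim.
    eapply Clim_ext; [|apply (rlim_product lam mu lam_pos mu_pos F HF z)].
    intros n. apply Cprod_ext. intros k _. unfold zfac. f_equal. unfold Cdiv.
    rewrite <- RtoC_Rinv, Rinv_inv. reflexivity.
Qed.

End Spectrum.

(** * The rates of the theorem *)

(** Comparability with 1. It is stable under products, inverses and shifts, so the orders of the
    rates can be read off factor by factor. *)
Definition pinched (f : nat -> R) : Prop :=
  exists l u, 0 < l /\ forall n, l <= f n <= u.

Lemma pinched_const c : 0 < c -> pinched (fun _ => c).
Proof. intros H; exists c, c; split; [exact H|intros; lra]. Qed.

Lemma pinched_mult f g : pinched f -> pinched g -> pinched (fun n => f n * g n).
Proof.
  intros (l & u & Hl & H) (l' & u' & Hl' & H'). exists (l * l'), (u * u').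
  split; [nra|]. intros n; specialize (H n); specialize (H' n).
  split; apply Rmult_le_compat; lra.
Qed.

Lemma pinched_inv f : pinched f -> pinched (fun n => / f n).
Proof.
  intros (l & u & Hl & H). exists (/ u), (/ l). specialize (H 0%nat) as H0.
  split; [apply Rinv_0_lt_compat; lra|]. intros n; specialize (H n).
  split; apply Rinv_le_contravar; lra.
Qed.

Lemma pinched_S f : pinched f -> pinched (fun n => f (S n)).
Proof. intros (l & u & Hl & H); exists l, u; split; [exact Hl|]. intros n; apply H. Qed.

Lemma pinched_ext f g : (forall n, f n = g n) -> pinched f -> pinched g.
Proof.
  intros E (l & u & Hl & H). exists l, u; split; [exact Hl|]. intros n; rewrite <- E; apply H.
Qed.


Section Q_Pochhammer.

Context (q : R) (hq : 0 < q < 1).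

Lemma qpow_range n : 0 < q ^ n <= 1.
Proof.
  split; [apply pow_lt; lra|]. rewrite <- (pow1 n). apply pow_incr; lra.
Qed.

Lemma qpoch_range x n : 0 <= x < 1 -> 0 < qpoch x q n <= 1.
Proof.
  intros Hx. induction n as [|n IH]; simpl; [lra|].
  assert (Hn := qpow_range n).
  assert (0 < 1 - x * q ^ n <= 1) by nra. nra.
Qed.

Lemma qpoch_decr x n : 0 <= x < 1 -> qpoch x q (S n) <= qpoch x q n.
Proof.
  intros Hx. simpl. assert (A := qpoch_range x n Hx). assert (Hn := qpow_range n).
  assert (0 <= x * q ^ n) by nra. nra.
Qed.

Lemma qpoch_shift x m n : qpoch x q (m + n) = qpoch x q m * qpoch (x * q ^ m) q n.
Proof.
  induction n as [|n IH]; [rewrite Nat.add_0_r; simpl; ring|].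
  rewrite Nat.add_succ_r. simpl. rewrite IH, pow_add. ring.
Qed.

Lemma qpoch_Cprod x n : RtoC (qpoch x q n) = Cprod (fun k => RtoC (1 - x * q ^ k)) n.
Proof. induction n as [|n IH]; simpl; [reflexivity|]. now rewrite RtoC_mult, IH. Qed.

Lemma qpoch_inf_correct x : 0 <= x < 1 -> is_lim_seq (qpoch x q) (qpoch_inf x q).
Proof.
  intros Hx. apply Lim_seq_correct', ex_finite_lim_seq_decr with 0.
  - intros n. apply qpoch_decr, Hx.
  - intros n. left; apply qpoch_range, Hx.
Qed.

Lemma qpoch_inf_le x n : 0 <= x < 1 -> qpoch_inf x q <= qpoch x q n.
Proof.
  intros Hx. apply (is_lim_seq_decr_compare (qpoch x q)); [apply qpoch_inf_correct, Hx|].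
  intros m. apply qpoch_decr, Hx.
Qed.

Lemma qpoch_inf_pos x : 0 <= x < 1 -> 0 < qpoch_inf x q.
Proof.
  intros Hx.
  destruct (Cprod_bounded_below (fun k => RtoC (1 - x * q ^ k)) (fun k => x * q ^ k)) as (c & Hc & Hev).
  - intros k. apply RtoC_neq_0. assert (Hn := qpow_range k). assert (x * q ^ k < 1) by nra. lra.
  - intros k. rewrite <- RtoC_minus, Cmod_R.
    replace (1 - x * q ^ k - 1) with (- (x * q ^ k)) by ring.
    rewrite Rabs_Ropp, Rabs_right; [lra|]. assert (Hn := qpow_range k). nra.
  - apply ex_series_Rgeom; lra.
  - apply Rlt_le_trans with c; [exact Hc|].
    refine (is_lim_seq_le_loc (fun _ => c) (qpoch x q) c (qpoch_inf x q) _
      (is_lim_seq_const c) (qpoch_inf_correct x Hx)).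
    destruct Hev as [N HN]. exists N. intros n Hn. specialize (HN n Hn).
    rewrite <- qpoch_Cprod, Cmod_R, Rabs_right in HN; [exact HN|].
    apply Rle_ge; left; apply qpoch_range, Hx.
Qed.

Lemma qpoch_inf_shift x m : 0 <= x < 1 -> qpoch_inf x q = qpoch x q m * qpoch_inf (x * q ^ m) q.
Proof.
  intros Hx. assert (Hm := qpow_range m). assert (Hx' : 0 <= x * q ^ m < 1) by nra.
  apply (is_lim_seq_eq (fun n => qpoch x q (n + m))).
  - apply (proj1 (is_lim_seq_incr_n (qpoch x q) m _)), qpoch_inf_correct, Hx.
  - eapply is_lim_seq_ext; [intros n; rewrite Nat.add_comm; symmetry; apply qpoch_shift|].
    apply (is_lim_seq_scal_l _ _ (Finite (qpoch_inf (x * q ^ m) q))), qpoch_inf_correct, Hx'.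
Qed.

Lemma qpoch_inf_rec x : 0 <= x < 1 -> qpoch_inf x q = (1 - x) * qpoch_inf (x * q) q.
Proof. intros Hx. rewrite (qpoch_inf_shift x 1 Hx). simpl. rewrite !Rmult_1_r. ring. Qed.

Lemma qpoch_inf_1 : qpoch_inf 1 q = 0.
Proof.
  unfold qpoch_inf. rewrite (is_lim_seq_unique _ 0); [reflexivity|].
  apply is_lim_seq_ext_loc with (fun _ => 0); [|apply is_lim_seq_const].
  exists 1%nat. intros n Hn. induction Hn as [|n Hn IH]; simpl; [ring|]. rewrite <- IH. ring.
Qed.

Lemma qpoch_inf_lim_1 x : 0 <= x < 1 -> is_lim_seq (fun n => qpoch_inf (x * q ^ n) q) 1.
Proof.
  intros Hx. assert (Hp := qpoch_inf_pos x Hx).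
  apply is_lim_seq_ext with (fun n => qpoch_inf x q / qpoch x q n).
  - intros n. rewrite (qpoch_inf_shift x n Hx). field.
    assert (A := qpoch_range x n Hx); lra.
  - replace (Finite 1) with (Finite (qpoch_inf x q / qpoch_inf x q)) by (f_equal; field; lra).
    apply is_lim_seq_div'; [apply is_lim_seq_const|apply qpoch_inf_correct, Hx|lra].
Qed.

Lemma qpoch_pinched x : 0 <= x < 1 -> pinched (qpoch x q).
Proof.
  intros Hx. exists (qpoch_inf x q), 1. split; [apply qpoch_inf_pos, Hx|].
  intros n. split; [apply qpoch_inf_le, Hx|apply qpoch_range, Hx].
Qed.

Lemma one_sub_qpow_pinched x : 0 <= x < 1 -> pinched (fun n => 1 - x * q ^ n).
Proof.
  intros Hx. exists (1 - x), 1. split; [lra|]. intros n. assert (Hn := qpow_range n). nra.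
Qed.

(** [L * q ^ n] has decrements [L * (1 - q) * q ^ k]. Both sequences tend to 0, so comparing
    decrements from [n] to infinity compares the values at [n]. *)
Lemma geom_increment_lower w L n : is_lim_seq w 0 ->
  (forall k, (n <= k)%nat -> L * (1 - q) * q ^ k <= w k - w (S k)) -> L * q ^ n <= w n.
Proof.
  intros Hw H.
  assert (A : forall j, w (n + j)%nat - L * q ^ (n + j) <= w n - L * q ^ n).
  { induction j as [|j IH]; [rewrite Nat.add_0_r; lra|].
    eapply Rle_trans; [|exact IH]. rewrite Nat.add_succ_r. simpl.
    specialize (H (n + j)%nat ltac:(lia)). lra. }
  assert (L0 : is_lim_seq (fun j => w (n + j)%nat - L * q ^ (n + j)) 0).
  { assert (G : is_lim_seq (fun k => w k + (- L) * q ^ k) 0).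
    { apply is_lim_seq_plus0; [exact Hw|]. apply is_lim_seq_scal0, is_lim_seq_geom.
      rewrite Rabs_right; lra. }
    apply (is_lim_seq_incr_n _ n) in G. eapply is_lim_seq_ext; [|exact G].
    intros j; cbv beta. rewrite Nat.add_comm. ring. }
  assert (B := is_lim_seq_le _ _ _ (Finite _) A L0 (is_lim_seq_const (w n - L * q ^ n))).
  simpl in B. lra.
Qed.

Lemma geom_increment_upper w L n : is_lim_seq w 0 ->
  (forall k, (n <= k)%nat -> w k - w (S k) <= L * (1 - q) * q ^ k) -> w n <= L * q ^ n.
Proof.
  intros Hw H. enough (- L * q ^ n <= - w n) by lra.
  apply (geom_increment_lower (fun k => - w k)).
  - eapply is_lim_seq_ext; [|apply (is_lim_seq_scal0 (-1)), Hw]. intros k; simpl; ring.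
  - intros k Hk. specialize (H k Hk). lra.
Qed.

(** * The ratio gamma, its complement and the rates, with [a = q^(alpha+1)] *)

Context (a : R) (ha : 0 < a < 1).

Definition gam (n : nat) : R := qpoch_inf (q ^ n) q / qpoch_inf (a * q ^ n) q.
Definition wgt (n : nat) : R := 1 - gam n.

Local Lemma aq_range n : 0 <= a * q ^ n < 1.
Proof. assert (Hn := qpow_range n). nra. Qed.

Local Lemma qS_range n : 0 <= q ^ S n < 1.
Proof. simpl. assert (Hn := qpow_range n). nra. Qed.

(** One factor is split off each infinite product; at [n = 0] both sides vanish instead. *)
Lemma gam_rec n : gam n * (1 - a * q ^ n) = gam (S n) * (1 - q ^ n).
Proof.
  unfold gam. assert (A := aq_range n). assert (A' := aq_range (S n)).
  assert (P := qpoch_inf_pos _ A'). rewrite (qpoch_inf_rec (a * q ^ n) A).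
  replace (a * q ^ n * q) with (a * q ^ S n) by (simpl; ring).
  destruct n as [|n].
  - simpl pow. rewrite qpoch_inf_1. unfold Rdiv. ring.
  - rewrite (qpoch_inf_rec (q ^ S n)) by apply qS_range.
    replace (q ^ S n * q) with (q ^ S (S n)) by (simpl; ring). field. lra.
Qed.

Lemma gam_0 : gam 0 = 0.
Proof. unfold gam. simpl pow. rewrite qpoch_inf_1. unfold Rdiv; ring. Qed.

Lemma gam_S_pos n : 0 < gam (S n).
Proof. apply Rdiv_lt_0_compat; apply qpoch_inf_pos; [apply qS_range|apply aq_range]. Qed.

Lemma gam_step n : gam (S n) - gam n = gam (S n) * ((1 - a) * q ^ n / (1 - a * q ^ n)).
Proof.
  assert (A := aq_range n). assert (R := gam_rec n).
  replace (gam n) with (gam n * (1 - a * q ^ n) / (1 - a * q ^ n)) by (field; lra).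
  rewrite R. field. lra.
Qed.

Lemma gam_incr n : gam n <= gam (S n).
Proof.
  assert (A := aq_range n). assert (B := gam_S_pos n). assert (Hn := qpow_range n).
  assert (E := gam_step n).
  assert (0 <= (1 - a) * q ^ n / (1 - a * q ^ n)).
  { apply Rmult_le_pos; [nra|left; apply Rinv_0_lt_compat; lra]. }
  nra.
Qed.

Lemma gam_mono m n : (m <= n)%nat -> gam m <= gam n.
Proof.
  intros H; induction H as [|n H IH]; [lra|]. assert (A := gam_incr n). lra.
Qed.

Lemma gam_lim : is_lim_seq gam 1.
Proof.
  apply is_lim_seq_incr_1. replace (Finite 1) with (Finite (1 / 1)) by (f_equal; field).
  unfold gam. apply is_lim_seq_div'; [| |lra].
  - apply is_lim_seq_ext with (fun n => qpoch_inf (q * q ^ n) q); [reflexivity|].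
    apply qpoch_inf_lim_1; lra.
  - apply (proj1 (is_lim_seq_incr_1 (fun n => qpoch_inf (a * q ^ n) q) _)), qpoch_inf_lim_1; lra.
Qed.

Lemma gam_le_1 n : gam n <= 1.
Proof. apply (is_lim_seq_incr_compare gam); [apply gam_lim|apply gam_incr]. Qed.

Lemma wgt_lim : is_lim_seq wgt 0.
Proof.
  unfold wgt. replace (Finite 0) with (Finite (1 - 1)) by (f_equal; ring).
  apply is_lim_seq_minus'; [apply is_lim_seq_const|apply gam_lim].
Qed.

(** From [n] on the increments of [gam] are at least [gam (S n) * (1 - a) * q ^ k], since [gam]
    increases and [1 - a * q ^ k] is at most 1. With [wgt_upper] this determines the order of [wgt]
    and its constant [(1 - a) / (1 - q)]. *)
Lemma wgt_lower n : gam (S n) * (1 - a) / (1 - q) * q ^ n <= wgt n.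
Proof.
  apply geom_increment_lower; [apply wgt_lim|]. intros k Hk.
  replace (wgt k - wgt (S k)) with (gam (S k) - gam k) by (unfold wgt; ring).
  rewrite gam_step. assert (A := aq_range k). assert (Hn := qpow_range k).
  assert (G := gam_mono (S n) (S k) ltac:(lia)). assert (G0 := gam_S_pos n).
  replace (gam (S n) * (1 - a) / (1 - q) * (1 - q) * q ^ k)
    with (gam (S n) * ((1 - a) * q ^ k)) by (field; lra).
  apply Rmult_le_compat; [lra|nra|exact G|].
  apply Rmult_le_reg_r with (1 - a * q ^ k); [lra|].
  unfold Rdiv. rewrite (Rmult_assoc _ (/ _)), Rinv_l by lra.
  assert (0 <= (1 - a) * q ^ k) by nra. nra.
Qed.

Lemma wgt_upper n : wgt n <= (1 - a) / ((1 - a * q ^ n) * (1 - q)) * q ^ n.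
Proof.
  apply geom_increment_upper; [apply wgt_lim|]. intros k Hk.
  replace (wgt k - wgt (S k)) with (gam (S k) - gam k) by (unfold wgt; ring).
  rewrite gam_step. assert (A := aq_range k). assert (An := aq_range n).
  assert (Hn := qpow_range k).
  assert (G := gam_le_1 (S k)). assert (G0 := gam_S_pos k).
  replace ((1 - a) / ((1 - a * q ^ n) * (1 - q)) * (1 - q) * q ^ k)
    with (1 * ((1 - a) * q ^ k / (1 - a * q ^ n))) by (field; lra).
  assert (0 <= (1 - a) * q ^ k) by nra.
  apply Rmult_le_compat; [lra| |exact G|].
  - apply Rmult_le_pos; [assumption|left; apply Rinv_0_lt_compat; lra].
  - apply Rmult_le_compat_l; [assumption|]. apply Rinv_le_contravar; [lra|].
    assert (q ^ k <= q ^ n); [|nra].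
    replace k with (n + (k - n))%nat by lia. rewrite pow_add.
    assert (B := qpow_range n). assert (B' := qpow_range (k - n)). nra.
Qed.

Lemma wgt_pos n : 0 < wgt n.
Proof.
  eapply Rlt_le_trans; [|apply wgt_lower].
  apply Rmult_lt_0_compat; [|apply qpow_range].
  apply Rdiv_lt_0_compat; [|lra]. apply Rmult_lt_0_compat; [apply gam_S_pos|lra].
Qed.

Definition nwgt (n : nat) : R := wgt n / q ^ n.

Lemma wgt_nwgt n : wgt n = nwgt n * q ^ n.
Proof. unfold nwgt. field. assert (Hn := qpow_range n). lra. Qed.

Lemma nwgt_bounds n : gam (S n) * (1 - a) / (1 - q) <= nwgt n <= (1 - a) / ((1 - a * q ^ n) * (1 - q)).
Proof.
  assert (Hn := qpow_range n). assert (L := wgt_lower n). assert (U := wgt_upper n).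
  assert (E : nwgt n * q ^ n = wgt n) by (symmetry; apply wgt_nwgt).
  split; apply Rmult_le_reg_r with (q ^ n); lra.
Qed.

Lemma nwgt_lim : is_lim_seq nwgt ((1 - a) / (1 - q)).
Proof.
  apply is_lim_seq_le_le with (1 := nwgt_bounds).
  - replace (Finite ((1 - a) / (1 - q))) with (Finite (1 * ((1 - a) / (1 - q)))) by (f_equal; ring).
    apply is_lim_seq_ext with (fun n => gam (S n) * ((1 - a) / (1 - q))); [intros n; field; lra|].
    apply is_lim_seq_mult'; [|apply is_lim_seq_const].
    exact (proj1 (is_lim_seq_incr_1 gam _) gam_lim).
  - replace (Finite ((1 - a) / (1 - q))) with (Finite ((1 - a) / ((1 - a * 0) * (1 - q))))
      by (f_equal; field; lra).
    apply is_lim_seq_div'; [apply is_lim_seq_const| |nra].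
    apply is_lim_seq_mult'; [|apply is_lim_seq_const].
    apply is_lim_seq_minus'; [apply is_lim_seq_const|].
    apply is_lim_seq_mult'; [apply is_lim_seq_const|].
    apply is_lim_seq_geom. rewrite Rabs_right; lra.
Qed.

Lemma nwgt_pinched : pinched nwgt.
Proof.
  exists (gam 1 * (1 - a) / (1 - q)), (1 / (1 - q)). split.
  - apply Rdiv_lt_0_compat; [|lra]. apply Rmult_lt_0_compat; [apply gam_S_pos|lra].
  - intros n. destruct (nwgt_bounds n) as [L U].
    assert (G := gam_mono 1 (S n) ltac:(lia)). assert (A := aq_range n). split.
    + eapply Rle_trans; [|exact L]. unfold Rdiv. rewrite !Rmult_assoc.
      apply Rmult_le_compat_r; [|exact G].
      apply Rmult_le_pos; [lra|left; apply Rinv_0_lt_compat; lra].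
    + eapply Rle_trans; [exact U|].
      replace ((1 - a) / ((1 - a * q ^ n) * (1 - q))) with ((1 - a) / (1 - a * q ^ n) * / (1 - q))
        by (field; lra).
      unfold Rdiv at 2. apply Rmult_le_compat_r; [left; apply Rinv_0_lt_compat; lra|].
      apply Rmult_le_reg_r with (1 - a * q ^ n); [lra|].
      unfold Rdiv. rewrite Rmult_assoc, Rinv_l by lra. assert (Hn := qpow_range n). nra.
Qed.

(** The rates of the theorem, with [r_n = wgt (S n) / wgt n]; the factor [q] in [muq] comes from
    [q^(-2n-alpha) = q / (a * q^(2n))]. *)
Definition lamq (n : nat) : R := (1 - a * q ^ n) * wgt n / (wgt (S n) * (a * (q ^ n) ^ 2)).
Definition muq (n : nat) : R := q * (1 - q ^ n) * wgt (S n) / (wgt n * (a * (q ^ n) ^ 2)).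

Lemma lamq_pos n : 0 < lamq n.
Proof.
  assert (A := aq_range n). assert (W := wgt_pos n). assert (W' := wgt_pos (S n)).
  assert (Hn := qpow_range n).
  apply Rdiv_lt_0_compat; [nra|]. apply Rmult_lt_0_compat; [exact W'|].
  apply Rmult_lt_0_compat; [lra|]. apply pow_lt; lra.
Qed.

Lemma muq_pos n : 0 < muq (S n).
Proof.
  assert (A := qS_range n). assert (W := wgt_pos (S n)). assert (W' := wgt_pos (S (S n))).
  assert (Hn := qpow_range (S n)).
  apply Rdiv_lt_0_compat; [apply Rmult_lt_0_compat; nra|]. apply Rmult_lt_0_compat; [exact W|].
  apply Rmult_lt_0_compat; [lra|]. apply pow_lt; lra.
Qed.

Lemma muq_0 : muq 0 = 0.
Proof. unfold muq, Rdiv. simpl pow. ring. Qed.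

Local Lemma a_range : 0 <= a < 1. Proof. lra. Qed.
Local Lemma q_range' : 0 <= q < 1. Proof. lra. Qed.

Local Notation wt := (bdpi lamq muq).

Lemma wgt_0 : wgt 0 = 1.
Proof. unfold wgt. rewrite gam_0. ring. Qed.

(** The quotients [lamq k / muq (S k)] contribute [wgt k / wgt (k+2)], whose product telescopes to
    [wgt 0 * wgt 1 / (wgt n * wgt (S n))] with [wgt 0 = 1]. *)
Lemma wt_formula n : wt n = wgt 1 * q ^ n * qpoch a q n / (qpoch q q n * (wgt n * wgt (S n))).
Proof.
  induction n as [|n IH].
  - simpl. rewrite wgt_0. field. assert (W := wgt_pos 1). lra.
  - change (wt (S n)) with (wt n * lamq n / muq (S n)). rewrite IH. unfold lamq, muq.
    assert (W := wgt_pos n). assert (W1 := wgt_pos (S n)). assert (W2 := wgt_pos (S (S n))).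
    assert (P := qpoch_range q n q_range'). assert (Hn := qpow_range n).
    assert (A := aq_range n). assert (A' := qS_range n). simpl in *. field.
    repeat split; nra.
Qed.

Lemma wt_pinched : pinched (fun n => wt n * q ^ n).
Proof.
  apply pinched_ext with (fun n => wgt 1 * (qpoch a q n * (/ qpoch q q n * (/ nwgt n * (/ nwgt (S n) * / q))))).
  - intros n. rewrite wt_formula, (wgt_nwgt n), (wgt_nwgt (S n)).
    assert (W := wgt_pos n). assert (W1 := wgt_pos (S n)). rewrite wgt_nwgt in W, W1.
    assert (P := qpoch_range q n q_range'). assert (Hn := qpow_range n).
    assert (Hn1 := qpow_range (S n)). simpl pow in *. field. repeat split; nra.
  - apply pinched_mult; [apply pinched_const, wgt_pos|].
    apply pinched_mult; [apply qpoch_pinched, a_range|].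
    apply pinched_mult; [apply pinched_inv, qpoch_pinched, q_range'|].
    apply pinched_mult; [apply pinched_inv, nwgt_pinched|].
    apply pinched_mult; [apply pinched_inv, (pinched_S nwgt), nwgt_pinched|].
    apply pinched_const, Rinv_0_lt_compat; lra.
Qed.

Lemma lamq_pinched : pinched (fun n => lamq n * (q ^ n) ^ 2).
Proof.
  apply pinched_ext with (fun n => (1 - a * q ^ n) * (nwgt n * (/ nwgt (S n) * (/ (a * q))))).
  - intros n. unfold lamq. rewrite (wgt_nwgt n), (wgt_nwgt (S n)).
    assert (W1 := wgt_pos (S n)). rewrite wgt_nwgt in W1. assert (Hn := qpow_range n).
    simpl pow in *. field. repeat split; nra.
  - apply pinched_mult; [apply one_sub_qpow_pinched, a_range|].
    apply pinched_mult; [apply nwgt_pinched|].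
    apply pinched_mult; [apply pinched_inv, (pinched_S nwgt), nwgt_pinched|].
    apply pinched_const, Rinv_0_lt_compat; nra.
Qed.

Lemma muq_pinched : pinched (fun n => muq (S n) * (q ^ n) ^ 2).
Proof.
  apply pinched_ext with (fun n => (1 - q * q ^ n) * (nwgt (S (S n)) * (/ nwgt (S n) * / a))).
  - intros n. unfold muq. rewrite (wgt_nwgt (S (S n))), (wgt_nwgt (S n)).
    assert (W1 := wgt_pos (S n)). rewrite wgt_nwgt in W1. assert (Hn := qpow_range n).
    simpl pow in *. field. repeat split; nra.
  - apply pinched_mult; [apply one_sub_qpow_pinched, q_range'|].
    apply pinched_mult; [apply (pinched_S (fun n => nwgt (S n))), pinched_S, nwgt_pinched|].
    apply pinched_mult; [apply pinched_inv, (pinched_S nwgt), nwgt_pinched|].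
    apply pinched_const, Rinv_0_lt_compat; lra.
Qed.

(** Supplies the growth hypotheses of the spectral argument with a single constant; [C0] is a sum of
    positive bounds and so dominates each of them. *)
Lemma rate_bounds : exists C0, 0 < C0 /\
  (forall n, wt n <= C0 * / q ^ n) /\ (forall n, / C0 * / q ^ n <= wt n) /\
  (forall n, / (lamq n * wt n) <= C0 * (q ^ 3) ^ n) /\
  (forall n, lamq n <= C0 * / (q ^ 2) ^ n) /\ (forall n, muq (S n) <= C0 * / (q ^ 2) ^ n).
Proof.
  destruct wt_pinched as (l1 & u1 & p1 & B1). destruct lamq_pinched as (l2 & u2 & p2 & B2).
  destruct muq_pinched as (l3 & u3 & p3 & B3).
  assert (B10 := B1 0%nat). assert (B20 := B2 0%nat). assert (B30 := B3 0%nat).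
  set (C0 := u1 + / l1 + / (l2 * l1) + u2 + u3).
  assert (i1 : 0 < / l1) by (apply Rinv_0_lt_compat; lra).
  assert (i2 : 0 < / (l2 * l1)) by (apply Rinv_0_lt_compat; nra).
  assert (Hdiv : forall x y c, 0 < y -> x * y <= c -> x <= c * / y).
  { intros x y c Hy H. apply Rmult_le_reg_r with y; [exact Hy|].
    rewrite Rmult_assoc, Rinv_l; lra. }
  exists C0. assert (HC : 0 < C0) by (unfold C0; lra).
  split; [exact HC|]. split; [|split; [|split; [|split]]]; intros n;
    assert (Hn := qpow_range n); specialize (B1 n); specialize (B2 n); specialize (B3 n).
  - apply Hdiv; [lra|]. unfold C0; lra.
  - apply Rmult_le_reg_r with (q ^ n); [lra|]. rewrite Rmult_assoc, Rinv_l, Rmult_1_r by lra.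
    apply Rle_trans with l1; [|lra]. rewrite <- (Rinv_inv l1).
    apply Rinv_le_contravar; [exact i1|unfold C0; lra].
  - rewrite pow_swap.
    replace (/ (lamq n * wt n)) with (/ ((lamq n * (q ^ n) ^ 2) * (wt n * q ^ n)) * (q ^ n) ^ 3).
    + apply Rmult_le_compat_r; [apply pow_le; lra|].
      apply Rle_trans with (/ (l2 * l1)); [|unfold C0; lra].
      apply Rinv_le_contravar; [nra|]. apply Rmult_le_compat; lra.
    + assert (L := lamq_pos n). assert (W := bdpi_pos lamq muq lamq_pos muq_pos n).
      field. repeat split; lra.
  - rewrite pow_swap. apply Hdiv; [apply pow_lt; lra|]. unfold C0; lra.
  - rewrite pow_swap. apply Hdiv; [apply pow_lt; lra|]. unfold C0; lra.
Qed.

End Q_Pochhammer.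

(** * q-Laguerre polynomials and the limit *)

Lemma Csum_scal c f n : Csum (fun k => Cmult c (f k)) n = Cmult c (Csum f n).
Proof. induction n as [|n IH]; simpl; [ring|]. rewrite IH; ring. Qed.

Lemma Csum_plus f g n : Csum (fun k => Cplus (f k) (g k)) n = Cplus (Csum f n) (Csum g n).
Proof. induction n as [|n IH]; simpl; [ring|]. rewrite IH; ring. Qed.

Lemma Csum_ext f g n : (forall k, (k < n)%nat -> f k = g k) -> Csum f n = Csum g n.
Proof.
  induction n as [|n IH]; intros H; simpl; [reflexivity|]. rewrite IH, (H n); auto.
Qed.

Lemma Csum_recl f n : Csum f (S n) = Cplus (f 0%nat) (Csum (fun k => f (S k)) n).
Proof.
  induction n as [|n IH]; [simpl; ring|].
  change (Csum f (S (S n))) with (Csum f (S n) + f (S n))%C. rewrite IH. simpl. ring.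
Qed.

Lemma Csum_zero_tail f m n : (m <= n)%nat -> (forall k, (m <= k)%nat -> f k = RtoC 0) ->
  Csum f n = Csum f m.
Proof.
  intros H Hf; induction H as [|n H IH]; [reflexivity|]. simpl. rewrite IH, Hf by exact H. ring.
Qed.

Lemma RtoC_Rdiv x y : RtoC (x / y) = Cdiv (RtoC x) (RtoC y).
Proof. unfold Rdiv, Cdiv. now rewrite RtoC_mult, RtoC_Rinv. Qed.

Lemma Re_Csum f n : Re (Csum f n) = Rsum (fun k => Re (f k)) n.
Proof. induction n as [|n IH]; simpl; [reflexivity|]. unfold Re in *. now rewrite IH. Qed.

Lemma Im_Csum f n : Im (Csum f n) = Rsum (fun k => Im (f k)) n.
Proof. induction n as [|n IH]; simpl; [reflexivity|]. unfold Im in *. now rewrite IH. Qed.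

Lemma ex_series_qpow_square q X : 0 < q < 1 -> 0 < X -> ex_series (fun k => q ^ (k * (k - 1)) * X ^ k).
Proof.
  intros Hq HX.
  assert (Hp : forall k, 0 < q ^ (k * (k - 1)) * X ^ k).
  { intros k. apply Rmult_lt_0_compat; apply pow_lt; lra. }
  apply ex_series_ext with (fun k => Rabs (q ^ (k * (k - 1)) * X ^ k)).
  { intros k. apply Rabs_right, Rle_ge. left; apply Hp. }
  apply ex_series_DAlembert with 0; [lra|intros k; specialize (Hp k); lra|].
  apply is_lim_seq_ext with (fun k => X * (q ^ 2) ^ k).
  - intros k. replace (S k * (S k - 1))%nat with (k * (k - 1) + 2 * k)%nat by (destruct k; simpl; lia).
    rewrite pow_add, (pow_mult q 2 k). change (X ^ S k) with (X * X ^ k).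
    assert (A : 0 < q ^ (k * (k - 1))) by (apply pow_lt; lra). assert (B : 0 < X ^ k) by (apply pow_lt; lra).
    replace (q ^ (k * (k - 1)) * (q ^ 2) ^ k * (X * X ^ k) / (q ^ (k * (k - 1)) * X ^ k))
      with (X * (q ^ 2) ^ k) by (field; lra).
    symmetry; apply Rabs_right, Rle_ge. apply Rmult_le_pos; [lra|]. apply pow_le, pow2_ge_0.
  - apply is_lim_seq_scal0, is_lim_seq_geom. rewrite Rabs_right; [simpl; nra|apply Rle_ge, pow2_ge_0].
Qed.

Section Laguerre.

Context (q : R) (hq : 0 < q < 1) (a : R) (ha : 0 < a < 1).

Local Notation B := (a * q).

Local Lemma B_range : 0 <= B < 1. Proof. nra. Qed.
Local Lemma q_range1 : 0 <= q < 1. Proof. lra. Qed.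

Local Lemma oneB_pos k : 0 < 1 - B * q ^ k.
Proof. assert (H := qpow_range q hq k). assert (A := B_range). nra. Qed.

Local Lemma oneq_pos k : 0 < 1 - q * q ^ k.
Proof. assert (H := qpow_range q hq k). nra. Qed.

(** The q-Laguerre coefficient is split as [lcof n k * phicof k]: [phicof] is the coefficient of
    0phi1, and [lcof] carries the dependence on the degree, with a limit that is the same for every
    [k]. The value 0 for [k > n] lets sums of different degrees run over a common range. *)
Definition lcof (n k : nat) : R := if (k <=? n)%nat then qpoch B q n / qpoch q q (n - k) else 0.
Definition phicof (k : nat) : R := q ^ (k * (k - 1)) / (qpoch B q k * qpoch q q k).

(* The q-Laguerre polynomial of order [alpha + 1], where [a = q^(alpha+1)]. *)
Definition Lag (z : C) (n : nat) : C :=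
  Csum (fun k => Cmult (RtoC (lcof n k * phicof k)) (Cpow (Copp (Cmult (RtoC B) z)) k)) (S n).

Definition Lagprev (z : C) (n : nat) : C := match n with O => RtoC 0 | S m => Lag z m end.

Lemma lcof_ge n k : (n < k)%nat -> lcof n k = 0.
Proof. intros H; unfold lcof. destruct (Nat.leb_spec k n); [lia|reflexivity]. Qed.

Lemma lcof_le k d : lcof (k + d) k = qpoch B q (k + d) / qpoch q q d.
Proof.
  unfold lcof. destruct (Nat.leb_spec k (k + d)); [|lia]. do 2 f_equal. lia.
Qed.

Lemma Lag_sum z n N : (S n <= N)%nat -> Lag z n =
  Csum (fun k => Cmult (RtoC (lcof n k * phicof k)) (Cpow (Copp (Cmult (RtoC B) z)) k)) N.
Proof.
  intros H. symmetry. apply Csum_zero_tail; [exact H|].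
  intros k Hk. rewrite lcof_ge by lia. rewrite Rmult_0_l. ring.
Qed.

Lemma phicof_S k : phicof (S k) * ((1 - B * q ^ k) * (1 - q * q ^ k)) = phicof k * (q ^ k) ^ 2.
Proof.
  unfold phicof. replace (S k * (S k - 1))%nat with (k * (k - 1) + 2 * k)%nat by (destruct k; simpl; lia).
  rewrite pow_add, (pow_mult q 2 k), (pow_swap q 2 k). simpl qpoch.
  assert (P1 := qpoch_range q hq B k B_range). assert (P2 := qpoch_range q hq q k q_range1).
  assert (H1 := oneB_pos k). assert (H2 := oneq_pos k). field. repeat split; lra.
Qed.

Lemma lcof_rec_0 n :
  (1 - q * q ^ S n) / q * (lcof (S (S n)) 0 - lcof (S n) 0)
  - (1 - a * q ^ S n) * (lcof (S n) 0 - lcof n 0) = 0.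
Proof.
  assert (L := lcof_le 0). simpl Nat.add in L. rewrite !L. simpl.
  assert (P2 := qpoch_range q hq q n q_range1).
  assert (H1 := oneq_pos n). assert (H2 := oneq_pos (S n)). simpl in H2. field. repeat split; lra.
Qed.

(** Comparison of coefficients in the q-Laguerre recurrence. The cases [k > n + 1], [k = n + 1] and
    [k = n] are separated from [k < n] because there some of the [lcof] are cut off to 0. *)
Lemma lcof_rec n k :
  phicof (S k) * ((1 - q * q ^ S n) / q * (lcof (S (S n)) (S k) - lcof (S n) (S k))
    - (1 - a * q ^ S n) * (lcof (S n) (S k) - lcof n (S k))) * B
  = a * (q ^ S n) ^ 2 * (lcof (S n) k * phicof k).
Proof.
  assert (E := phicof_S k). assert (Hk := qpow_range q hq k).
  assert (HB : 0 < 1 - B * q ^ k) by (assert (A := B_range); nra).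
  assert (HQ : 0 < 1 - q * q ^ k) by nra.
  set (D := (1 - B * q ^ k) * (1 - q * q ^ k)) in *.
  assert (HD : 0 < D) by (unfold D; apply Rmult_lt_0_compat; assumption).
  assert (E' : phicof (S k) = phicof k * (q ^ k) ^ 2 / D).
  { rewrite <- E. field. lra. }
  rewrite E'. clear E E'.
  assert (Hcases : (S n < k)%nat \/ k = S n \/ k = n \/ exists d, n = (S k + d)%nat).
  { destruct (Nat.lt_ge_cases (S n) k); [auto|]. destruct (Nat.eq_dec k (S n)); [auto|].
    destruct (Nat.eq_dec k n); [auto|]. do 3 right. exists (n - S k)%nat. lia. }
  destruct Hcases as [H|[->|[->|[d ->]]]].
  - rewrite !(lcof_ge _ (S k)) by lia. rewrite (lcof_ge (S n) k) by lia. ring.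
  - rewrite (lcof_ge (S n) (S (S n))), (lcof_ge n (S (S n))) by lia.
    assert (L0 : forall m, lcof m m = qpoch B q m).
    { intros m. replace m with (m + 0)%nat at 1 by lia. rewrite lcof_le, Nat.add_0_r.
      simpl. field. }
    rewrite !L0. change (qpoch B q (S (S n))) with (qpoch B q (S n) * (1 - B * q ^ S n)).
    unfold D. field. split; [lra|]. split; lra.
  - rewrite (lcof_ge n (S n)) by lia.
    replace (lcof (S n) n) with (lcof (n + 1) n) by (f_equal; lia).
    replace (lcof (S (S n)) (S n)) with (lcof (S n + 1) (S n)) by (f_equal; lia).
    replace (lcof (S n) (S n)) with (lcof (S n + 0) (S n)) by (f_equal; lia).
    rewrite !lcof_le. rewrite Nat.add_0_r, !Nat.add_1_r. simpl.
    unfold D. simpl in *. field. repeat split; nra.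
  - replace (lcof (S (S (S k + d))) (S k)) with (lcof (S k + S (S d)) (S k)) by (f_equal; lia).
    replace (lcof (S (S k + d)) (S k)) with (lcof (S k + S d) (S k)) by (f_equal; lia).
    replace (lcof (S (S k + d)) k) with (lcof (k + S (S d)) k) by (f_equal; lia).
    rewrite !lcof_le.
    replace (k + S (S d))%nat with (S (S (k + d))) by lia.
    replace (S k + S (S d))%nat with (S (S (S (k + d)))) by lia.
    replace (S k + S d)%nat with (S (S (k + d))) by lia.
    replace (S k + d)%nat with (S (k + d)) by lia.
    simpl. rewrite pow_add.
    assert (Hd := qpow_range q hq d). assert (P := qpoch_range q hq q d q_range1).
    set (x := q ^ k) in *. set (y := q ^ d) in *.
    assert (0 < 1 - q * y) by nra. assert (0 < 1 - q * (q * y)) by nra.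
    unfold D. field. repeat split; lra.
Qed.

Lemma Lag_rec_S z n :
  Cminus (Cmult (RtoC ((1 - q * q ^ S n) / q)) (Cminus (Lag z (S (S n))) (Lag z (S n))))
    (Cmult (RtoC (1 - a * q ^ S n)) (Cminus (Lag z (S n)) (Lag z n)))
  = Copp (Cmult z (Cmult (RtoC (a * (q ^ S n) ^ 2)) (Lag z (S n)))).
Proof.
  set (N := S (S (S n))).
  set (x := Copp (Cmult (RtoC B) z)).
  set (T := fun m k => Cmult (RtoC (lcof m k * phicof k)) (Cpow x k)).
  set (u := RtoC ((1 - q * q ^ S n) / q)). set (v := RtoC (1 - a * q ^ S n)).
  assert (E2 : Lag z (S (S n)) = Csum (T (S (S n))) N) by (apply Lag_sum; unfold N; lia).
  assert (E1 : Lag z (S n) = Csum (T (S n)) N) by (apply Lag_sum; unfold N; lia).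
  assert (E0 : Lag z n = Csum (T n) N) by (apply Lag_sum; unfold N; lia).
  transitivity (Csum (fun k => Cplus (Cplus (Cmult u (T (S (S n)) k)) (Cmult (Copp (Cplus u v)) (T (S n) k)))
    (Cmult v (T n k))) N).
  { rewrite !Csum_plus, !Csum_scal, E2, E1, E0. ring. }
  (* The factor [z] on the right raises degrees by one: the constant term on the left has to vanish,
     and power [k + 1] on the left is matched with power [k] on the right. *)
  clear E2 E1 E0. unfold N. rewrite Csum_recl.
  assert (H0 : Cplus (Cplus (Cmult u (T (S (S n)) 0%nat)) (Cmult (Copp (Cplus u v)) (T (S n) 0%nat)))
    (Cmult v (T n 0%nat)) = RtoC 0).
  { transitivity (RtoC (((1 - q * q ^ S n) / q * (lcof (S (S n)) 0 - lcof (S n) 0)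
      - (1 - a * q ^ S n) * (lcof (S n) 0 - lcof n 0)) * phicof 0)).
    - unfold T, u, v. repeat (rewrite RtoC_mult || rewrite RtoC_minus). simpl Cpow. ring.
    - rewrite lcof_rec_0, Rmult_0_l. reflexivity. }
  rewrite H0, Cplus_0_l.
  rewrite (Csum_ext _ (fun k => Cmult (Copp (Cmult z (RtoC (a * (q ^ S n) ^ 2)))) (T (S n) k))).
  - rewrite Csum_scal. unfold Lag. fold x. fold (T (S n)). ring.
  - intros k _. cbv beta. assert (E := lcof_rec n k).
    apply (f_equal RtoC) in E. unfold T. rewrite Cpow_S. unfold x at 1 3 5.
    set (p := Cpow x k).
    transitivity (Copp (Cmult z (Cmult (RtoC (phicof (S k) * ((1 - q * q ^ S n) / q * (lcof (S (S n)) (S k) - lcof (S n) (S k))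
       - (1 - a * q ^ S n) * (lcof (S n) (S k) - lcof n (S k))) * B)) p))).
    + unfold u, v. repeat (rewrite RtoC_mult || rewrite RtoC_minus). ring.
    + rewrite E. rewrite !RtoC_mult. ring.
Qed.

(** The convention [Lagprev z 0 = 0] matters at [n = 0], since its coefficient [1 - a] there is not
    zero. *)
Lemma Lag_rec z n :
  Cminus (Cmult (RtoC ((1 - q * q ^ n) / q)) (Cminus (Lag z (S n)) (Lag z n)))
    (Cmult (RtoC (1 - a * q ^ n)) (Cminus (Lag z n) (Lagprev z n)))
  = Copp (Cmult z (Cmult (RtoC (a * (q ^ n) ^ 2)) (Lag z n))).
Proof.
  destruct n as [|n]; [|apply Lag_rec_S].
  assert (q0 : RtoC q <> RtoC 0) by (apply RtoC_neq_0; lra).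
  assert (q1 : (1 - RtoC q)%C <> RtoC 0) by (rewrite <- RtoC_minus; apply RtoC_neq_0; lra).
  assert (b1 : (1 - RtoC a * RtoC q)%C <> RtoC 0).
  { rewrite <- RtoC_mult, <- RtoC_minus; apply RtoC_neq_0. assert (A := B_range); lra. }
  unfold Lag, Lagprev, lcof, phicof. simpl.
  unfold Rdiv. repeat (rewrite ?RtoC_mult, ?RtoC_minus, ?RtoC_Rinv, ?RtoC_plus).
  field. repeat split; assumption.
Qed.

Lemma Lag_0 z : Lag z 0 = RtoC 1.
Proof.
  unfold Lag, lcof, phicof. simpl. replace (1 / 1 * (1 / (1 * 1))) with 1 by field. ring.
Qed.

(** * Birth-and-death polynomials as gauged q-Laguerre polynomials *)

Local Notation w := (wgt q a).
Local Notation lam := (lamq q a).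
Local Notation mu := (muq q a).

(** Determined by [bdpi n = w 1 / (kap n * (w n * w (S n)))]. *)
Definition kap (n : nat) : R := qpoch q q n / (q ^ n * qpoch a q n).

(* The associated sums [Rn] solve, up to the factor [1 / w (n+1)], the
   q-Laguerre recurrence: the rates [lam], [mu] come from a second factorization
   of the q-Laguerre Jacobi matrix. *)
Lemma QR_Laguerre z n :
  Qn lam mu z n = Cmult (RtoC (kap n)) (Cminus (Cmult (RtoC (w n)) (Lag z n)) (Cmult (RtoC (w (S n))) (Lagprev z n)))
  /\ Rn lam mu z n = Cmult (RtoC (w 1 / w (S n))) (Lag z n).
Proof.
  assert (W := wgt_pos q hq a ha).
  induction n as [|n [IHQ IHR]].
  - unfold Qn, Rn; simpl QR; cbn [fst snd]. rewrite Lag_0. unfold kap, Lagprev.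
    rewrite (wgt_0 q). simpl pow; simpl qpoch. specialize (W 1%nat).
    split.
    + replace (1 / (1 * 1)) with 1 by field. ring.
    + replace (w 1 / w 1) with 1 by (field; lra). ring.
  - assert (A := qpoch_range q hq a n ltac:(lra)). assert (Qq := qpoch_range q hq q n q_range1).
    assert (Hn := qpow_range q hq n).
    assert (a1 : 0 < 1 - a * q ^ n) by nra. assert (q1 : 0 < 1 - q * q ^ n) by nra.
    assert (Wn := W n). assert (W1 := W (S n)). assert (W2 := W (S (S n))). assert (W01 := W 1%nat).
    assert (Estep : Qn lam mu z (S n) = Cmult (RtoC (kap (S n)))
      (Cminus (Cmult (RtoC (w (S n))) (Lag z (S n))) (Cmult (RtoC (w (S (S n)))) (Lag z n)))).
    { rewrite Qn_S, IHQ, IHR.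
      assert (Ek : kap (S n) = kap n * (1 - q * q ^ n) / (q * (1 - a * q ^ n))).
      { unfold kap. simpl. field. repeat split; lra. }
      assert (El : w 1 / w (S n) / (lam n * bdpi lam mu n)
        = kap n * (w (S n) * (a * (q ^ n) ^ 2)) / (1 - a * q ^ n)).
      { rewrite (wt_formula q hq a ha). unfold lamq, kap. field. repeat split; lra. }
      (* The shifted sequence [w (n+1)] solves the recurrence of [Lag] at [z = 0]. In the Casoratian
         of the two solutions the terms without [z] therefore cancel, and only the term with [Rn] is
         left. *)
      assert (Ew : (1 - a * q ^ n) * (w n - w (S n)) = (1 - q * q ^ n) / q * (w (S n) - w (S (S n)))).
      { unfold wgt. assert (G1 := gam_rec q hq a ha n). assert (G2 := gam_step q hq a ha (S n)).
        assert (G0 := gam_step q hq a ha n).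
        assert (a2 : 0 < 1 - a * q ^ S n) by (simpl; nra).
        assert (G3 := gam_rec q hq a ha (S n)).
        replace (1 - gam q a n - (1 - gam q a (S n))) with (gam q a (S n) - gam q a n) by ring.
        replace (1 - gam q a (S n) - (1 - gam q a (S (S n)))) with (gam q a (S (S n)) - gam q a (S n)) by ring.
        rewrite G0, G2.
        replace (gam q a (S n)) with (gam q a (S (S n)) * (1 - q ^ S n) / (1 - a * q ^ S n))
          by (rewrite <- G3; field; lra).
        simpl in *. field. repeat split; lra. }
      assert (HL := Lag_rec z n).
      transitivity (Cminus (Cmult (RtoC (kap n)) (Cminus (Cmult (RtoC (w n)) (Lag z n)) (Cmult (RtoC (w (S n))) (Lagprev z n))))
        (Cmult z (Cmult (RtoC (w 1 / w (S n) / (lam n * bdpi lam mu n))) (Lag z n)))).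
      { rewrite (RtoC_Rdiv (w 1 / w (S n)) (lam n * bdpi lam mu n)). unfold Cdiv. ring. }
      rewrite El, Ek.
      set (s1 := Lag z (S n)) in *. set (s := Lag z n) in *. set (s0 := Lagprev z n) in *.
      assert (k1 : kap n * (w (S n) * (a * (q ^ n) ^ 2)) / (1 - a * q ^ n)
        = (kap n * w (S n) / (1 - a * q ^ n)) * (a * (q ^ n) ^ 2)) by (field; lra).
      rewrite k1, RtoC_mult.
      replace (z * (RtoC (kap n * w (S n) / (1 - a * q ^ n)) * RtoC (a * (q ^ n) ^ 2) * s))%C
        with (- (RtoC (kap n * w (S n) / (1 - a * q ^ n)) * - (z * (RtoC (a * (q ^ n) ^ 2) * s))))%C by ring.
      rewrite <- HL.
      assert (n1 : RtoC (1 - a * q ^ n) <> RtoC 0) by (apply RtoC_neq_0; lra).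
      assert (nq : RtoC q <> RtoC 0) by (apply RtoC_neq_0; lra).
      assert (Ew' := f_equal RtoC Ew).
      rewrite !RtoC_mult, !RtoC_minus in Ew'.
      unfold Rdiv in *. rewrite !RtoC_mult, !RtoC_Rinv, !RtoC_mult in *.
      set (A1 := RtoC (1 - a * q ^ n)) in *. set (B1 := RtoC (1 - q * q ^ n)) in *.
      set (k := RtoC (kap n)). set (w0 := RtoC (w n)) in *. set (w1 := RtoC (w (S n))) in *.
      set (w2 := RtoC (w (S (S n)))) in *. set (qc := RtoC q) in *.
      assert (EA : (RtoC 1 - RtoC a * RtoC (q ^ n))%C = A1) by (unfold A1; now rewrite RtoC_minus, RtoC_mult).
      assert (EB : (RtoC 1 - qc * RtoC (q ^ n))%C = B1) by (unfold B1, qc; now rewrite RtoC_minus, RtoC_mult).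
      rewrite ?EA, ?EB in Ew'.
      apply (f_equal (fun t => (k * s * / A1 * t)%C)) in Ew'.
      transitivity (k * s * / A1 * (A1 * (w0 - w1)) + k * w1 * / A1 * (B1 * / qc * (s1 - s)) + k * w1 * s - k * w1 * s)%C.
      + field. split; assumption.
      + rewrite Ew'. field. split; assumption. }
    split; [exact Estep|].
    rewrite Rn_S, IHR, Estep. simpl Lagprev.
    assert (Ewt : bdpi lam mu (S n) = w 1 / (kap (S n) * (w (S n) * w (S (S n))))).
    { rewrite (wt_formula q hq a ha). unfold kap.
      assert (A' := qpoch_range q hq a (S n) ltac:(lra)). assert (Qq' := qpoch_range q hq q (S n) q_range1).
      assert (Hn' := qpow_range q hq (S n)). field. repeat split; lra. }
    assert (Kp : 0 < kap (S n)).
    { unfold kap. assert (A' := qpoch_range q hq a (S n) ltac:(lra)).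
      assert (Qq' := qpoch_range q hq q (S n) q_range1). assert (Hn' := qpow_range q hq (S n)).
      apply Rdiv_lt_0_compat; [lra|]. apply Rmult_lt_0_compat; lra. }
    rewrite Ewt. unfold Rdiv. rewrite !RtoC_mult, !RtoC_Rinv, !RtoC_mult. field.
    repeat split; apply RtoC_neq_0; lra.
Qed.

(** * The limit of the polynomials *)

Definition phiF (z : C) : C := phi01 B q (Copp (Cmult (RtoC B) z)).

Lemma phicof_pos k : 0 < phicof k.
Proof.
  unfold phicof. assert (P1 := qpoch_range q hq B k B_range). assert (P2 := qpoch_range q hq q k q_range1).
  apply Rdiv_lt_0_compat; [apply pow_lt; lra|nra].
Qed.

Lemma ex_series_phi x : ex_series (fun k => Cmod (Cmult (RtoC (phicof k)) (Cpow x k))).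
Proof.
  set (c := / (qpoch_inf B q * qpoch_inf q q)).
  assert (I1 := qpoch_inf_pos q hq B B_range). assert (I2 := qpoch_inf_pos q hq q q_range1).
  (* Adding 1 to [Cmod x] keeps the base positive for the ratio test when [x = 0]. *)
  apply @ex_series_le with (fun k => c * (q ^ (k * (k - 1)) * (Cmod x + 1) ^ k)).
  - intros k. unfold norm; simpl norm; unfold abs; simpl abs.
    rewrite Rabs_right by (apply Rle_ge, Cmod_ge_0).
    rewrite Cmod_mult, Cmod_R, Cmod_pow, Rabs_right by (apply Rle_ge; left; apply phicof_pos).
    rewrite <- Rmult_assoc. assert (Hx := Cmod_ge_0 x).
    apply Rmult_le_compat; [left; apply phicof_pos|apply pow_le, Hx| |apply pow_incr; lra].
    unfold phicof, Rdiv. rewrite Rmult_comm.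
    assert (A : 0 < q ^ (k * (k - 1))) by (apply pow_lt; lra).
    apply Rmult_le_compat_r; [lra|]. apply Rinv_le_contravar; [nra|].
    apply Rmult_le_compat; [lra|lra|apply qpoch_inf_le..]; auto using B_range, q_range1.
  - apply ex_series_Rmult, ex_series_qpow_square; [exact hq|]. assert (Hx := Cmod_ge_0 x). lra.
Qed.

Lemma lcof_lim k : is_lim_seq (fun n => lcof n k) (qpoch_inf B q / qpoch_inf q q).
Proof.
  assert (I2 := qpoch_inf_pos q hq q q_range1).
  apply (is_lim_seq_incr_n _ k).
  apply is_lim_seq_ext with (fun n => qpoch B q (n + k) / qpoch q q n).
  - intros n. rewrite Nat.add_comm, lcof_le. reflexivity.
  - apply is_lim_seq_div'; [|apply qpoch_inf_correct, q_range1; exact hq|lra].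
    apply (proj1 (is_lim_seq_incr_n _ k _)), qpoch_inf_correct, B_range; exact hq.
Qed.

Lemma lcof_bound n k : 0 <= lcof n k <= / qpoch_inf q q.
Proof.
  assert (I2 := qpoch_inf_pos q hq q q_range1).
  assert (I3 : 0 < / qpoch_inf q q) by (apply Rinv_0_lt_compat, I2).
  unfold lcof. destruct (k <=? n)%nat; [|lra].
  assert (P1 := qpoch_range q hq B n B_range). assert (P2 := qpoch_range q hq q (n - k) q_range1).
  assert (I4 := qpoch_inf_le q hq q (n - k) q_range1).
  assert (P3 : 0 < / qpoch q q (n - k)) by (apply Rinv_0_lt_compat; lra).
  assert (P4 : / qpoch q q (n - k) <= / qpoch_inf q q) by (apply Rinv_le_contravar; lra).
  unfold Rdiv. nra.
Qed.

(** Dominated convergence over the coefficients: [lcof n k] is at most [/ qpoch_inf q q], and its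
    limit does not depend on [k] and factors out of the series. *)
Lemma Lag_lim z : Clim (Lag z) (Cmult (RtoC (qpoch_inf B q / qpoch_inf q q)) (phiF z)).
Proof.
  set (x := Copp (Cmult (RtoC B) z)). set (g := fun k => Cmult (RtoC (phicof k)) (Cpow x k)).
  set (theta := qpoch_inf B q / qpoch_inf q q).
  assert (Ex : forall n k, Cmult (RtoC (lcof n k * phicof k)) (Cpow x k) = Cmult (RtoC (lcof n k)) (g k)).
  { intros n k. unfold g. rewrite RtoC_mult. ring. }
  (* [pr] stands for [Re] and for [Im], since complex series are summed componentwise. *)
  assert (Main : forall pr : C -> R, (forall c, Rabs (pr c) <= Cmod c) ->
    (forall r c, pr (Cmult (RtoC r) c) = r * pr c) ->
    (forall f n, pr (Csum f n) = Rsum (fun k => pr (f k)) n) ->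
    is_lim_seq (fun n => pr (Lag z n)) (theta * Series (fun k => pr (g k)))).
  { intros pr Hle Hsc Hsum.
    apply is_lim_seq_ext with (fun n => Series (fun k => lcof n k * pr (g k))).
    - intros n. unfold Lag. fold x. rewrite Hsum. symmetry.
      rewrite (is_series_unique _ _ (Series_finite (fun k => lcof n k * pr (g k)) (S n)
        (fun k Hk => eq_trans (f_equal (fun t => t * pr (g k)) (lcof_ge n k Hk)) (Rmult_0_l _)))).
      apply Rsum_ext. intros k _. now rewrite Ex, Hsc.
    - rewrite <- Series_scal_l.
      apply tannery with (M := fun k => / qpoch_inf q q * Cmod (g k)).
      + intros k. apply (is_lim_seq_mult' _ _ theta (pr (g k))); [apply lcof_lim|apply is_lim_seq_const].
      + intros n k. rewrite Rabs_mult. assert (Lb := lcof_bound n k). rewrite (Rabs_right (lcof n k)) by lra.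
        apply Rmult_le_compat; [lra|apply Rabs_pos|lra|apply Hle].
      + apply ex_series_Rmult, ex_series_phi. }
  apply Clim_components.
  - assert (A := Main Re re_le_Cmod). replace (Re (RtoC theta * phiF z)) with (theta * Series (fun k => Re (g k))).
    + apply A; [|apply Re_Csum]. intros r [c d]; simpl. ring.
    + unfold phiF, phi01, CSeries. simpl. rewrite Rmult_0_l, Rminus_0_r. reflexivity.
  - assert (A := Main Im im_le_Cmod). replace (Im (RtoC theta * phiF z)) with (theta * Series (fun k => Im (g k))).
    + apply A; [|apply Im_Csum]. intros r [c d]; simpl. ring.
    + unfold phiF, phi01, CSeries. simpl. rewrite Rmult_0_l, Rplus_0_r. reflexivity.
Qed.

(** Since [w n] behaves like a constant times [q ^ n], the two coefficients of the Casoratian tend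
    to [c] and [q * c]. The limit is [c * (1 - q) * theta] times [phiF z]. *)
Lemma Qn_lim z : Clim (Qn lam mu z) (phiF z).
Proof.
  apply Clim_incr_1.
  set (theta := qpoch_inf B q / qpoch_inf q q).
  set (c := qpoch_inf q q / qpoch_inf a q * ((1 - a) / (1 - q))).
  assert (Ia := qpoch_inf_pos q hq a ltac:(lra)). assert (Iq := qpoch_inf_pos q hq q q_range1).
  assert (IB := qpoch_inf_pos q hq B B_range).
  assert (Lr : is_lim_seq (fun n => qpoch q q n / qpoch a q n) (qpoch_inf q q / qpoch_inf a q)).
  { apply is_lim_seq_div'; [apply qpoch_inf_correct, q_range1; exact hq|
      apply qpoch_inf_correct; [exact hq|lra]|lra]. }
  assert (L1 : is_lim_seq (fun n => kap n * w n) c).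
  { apply is_lim_seq_ext with (fun n => qpoch q q n / qpoch a q n * nwgt q a n).
    - intros n. rewrite (wgt_nwgt q hq). unfold kap. field.
      assert (A := qpoch_range q hq a n ltac:(lra)). assert (Hn := qpow_range q hq n). lra.
    - apply is_lim_seq_mult'; [exact Lr|apply nwgt_lim; assumption]. }
  assert (L2 : is_lim_seq (fun n => kap n * w (S n)) (q * c)).
  { apply is_lim_seq_ext with (fun n => q * (qpoch q q n / qpoch a q n * nwgt q a (S n))).
    - intros n. rewrite (wgt_nwgt q hq). unfold kap. simpl pow. field.
      assert (A := qpoch_range q hq a n ltac:(lra)). assert (Hn := qpow_range q hq n). lra.
    - apply (is_lim_seq_scal_l _ q (Finite c)).
      apply is_lim_seq_mult'; [exact Lr|].
      exact (proj1 (is_lim_seq_incr_1 (nwgt q a) _) (nwgt_lim q hq a ha)). }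
  apply is_lim_seq_incr_1 in L1. apply is_lim_seq_incr_1 in L2.
  apply Clim_ext with (fun n => (RtoC (kap (S n) * w (S n)) * Lag z (S n)
    - RtoC (kap (S n) * w (S (S n))) * Lag z n)%C).
  { intros n. rewrite (proj1 (QR_Laguerre z (S n))). simpl Lagprev. rewrite !RtoC_mult. ring. }
  replace (phiF z) with (RtoC c * (RtoC theta * phiF z) - RtoC (q * c) * (RtoC theta * phiF z))%C.
  - apply Clim_minus; apply Clim_mult.
    + apply Clim_RtoC, L1.
    + apply (proj1 (Clim_incr_1 _ _)), Lag_lim.
    + apply Clim_RtoC, L2.
    + apply Lag_lim.
  (* The normalization is [(a; q)_inf = (1 - a) * (a q; q)_inf]. *)
  - assert (E : c * theta - q * c * theta = 1).
    { unfold c, theta. assert (H := qpoch_inf_rec q hq a ltac:(lra)). rewrite H in *.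
      field. repeat split; nra. }
    transitivity (RtoC (c * theta - q * c * theta) * phiF z)%C.
    + rewrite RtoC_minus, !RtoC_mult. ring.
    + rewrite E. ring.
Qed.

End Laguerre.

(** * The principal branch of the power function *)

Definition polar (r t : R) : C := Cmult (RtoC r) (cos t, sin t).

Lemma Cmod_polar r t : 0 <= r -> Cmod (polar r t) = r.
Proof.
  intros Hr. unfold polar. rewrite Cmod_mult, Cmod_R, Rabs_right by lra.
  unfold Cmod; simpl. replace (cos t * (cos t * 1) + sin t * (sin t * 1)) with 1.
  - rewrite sqrt_1; ring.
  - assert (H := sin2_cos2 t). unfold Rsqr in H. lra.
Qed.

Lemma polar_mult r t r' t' : Cmult (polar r t) (polar r' t') = polar (r * r') (t + t').
Proof.
  unfold polar, Cmult, RtoC; simpl. rewrite cos_plus, sin_plus. f_equal; ring.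
Qed.

(** On [(-PI, PI]] the sign of [sin t] decides whether [acos] recovers [t] or [- t]. *)
Lemma Carg_polar r t : 0 < r -> - PI < t <= PI -> Carg (polar r t) = t.
Proof.
  intros Hr Ht. unfold Carg. rewrite Cmod_polar by lra.
  assert (E1 : Re (polar r t) = r * cos t) by (unfold polar; simpl; ring).
  assert (E2 : Im (polar r t) = r * sin t) by (unfold polar; simpl; ring).
  rewrite E1, E2. replace (r * cos t / r) with (cos t) by (field; lra).
  destruct (Rle_dec 0 (r * sin t)) as [H|H].
  - apply acos_cos. split; [|lra]. destruct (Rle_or_lt 0 t) as [|Hn]; [assumption|].
    assert (0 < sin (- t)) by (apply sin_gt_0; lra). rewrite sin_neg in *. nra.
  - rewrite <- cos_neg, acos_cos; [ring|]. split; [|lra].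
    destruct (Rle_or_lt t 0) as [|Hp]; [lra|].
    assert (0 <= sin t) by (apply sin_ge_0; lra). nra.
Qed.

Lemma Carg_spec z : z <> RtoC 0 -> - PI < Carg z <= PI /\ z = polar (Cmod z) (Carg z).
Proof.
  intros Hz. assert (Hr : 0 < Cmod z) by (apply Cmod_gt_0, Hz).
  assert (HP := PI_RGT_0).
  set (x := Re z / Cmod z). set (y := Im z / Cmod z).
  assert (Ex : Re z = Cmod z * x) by (unfold x; field; lra).
  assert (Ey : Im z = Cmod z * y) by (unfold y; field; lra).
  assert (Exy : x ^ 2 + y ^ 2 = 1).
  { assert (A := Cmod2_alt z). rewrite Ex, Ey in A.
    assert (Cmod z ^ 2 * (x ^ 2 + y ^ 2) = Cmod z ^ 2 * 1) by lra.
    apply Rmult_eq_reg_l with (Cmod z ^ 2); [assumption|]. apply pow_nonzero; lra. }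
  assert (Hx : -1 <= x <= 1) by (assert (0 <= y ^ 2) by apply pow2_ge_0; nra).
  assert (Hb := acos_bound x). assert (Hc := cos_acos x Hx). assert (Hs := sin_acos x Hx).
  assert (Ess : 1 - x² = y²) by (unfold Rsqr; lra). rewrite Ess in Hs.
  assert (Ez : z = (Re z, Im z)) by (destruct z; reflexivity).
  unfold Carg. fold x. destruct (Rle_dec 0 (Im z)) as [H|H].
  - split; [lra|]. rewrite sqrt_Rsqr in Hs.
    + unfold polar. rewrite Hc, Hs, Ez at 1. rewrite Ex, Ey.
      unfold Cmult, RtoC; simpl. f_equal; ring.
    + unfold y. apply Rmult_le_pos; [exact H|left; apply Rinv_0_lt_compat, Hr].
  - assert (Hy : y < 0).
    { unfold y. apply Rmult_lt_reg_r with (Cmod z); [exact Hr|].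
      unfold Rdiv. rewrite Rmult_assoc, Rinv_l; lra. }
    assert (E : sqrt y² = - y).
    { replace (y²) with ((- y)²) by (unfold Rsqr; ring). apply sqrt_Rsqr; lra. }
    rewrite E in Hs. split.
    (* The lower bound is strict, since [acos x = PI] would force the imaginary part to vanish. *)
    + split; [|lra]. assert (acos x <> PI); [|lra].
      intros C. rewrite C, sin_PI in Hs. lra.
    + unfold polar. rewrite cos_neg, sin_neg, Hc, Hs, Ez at 1. rewrite Ex, Ey.
      unfold Cmult, RtoC; simpl. f_equal; ring.
Qed.

Lemma Crpow_polar r t s : 0 < r -> - PI < t <= PI -> Crpow (polar r t) s = polar (Rpower r s) (s * t).
Proof. intros Hr Ht. unfold Crpow. rewrite Carg_polar, Cmod_polar by lra. reflexivity. Qed.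

Lemma Csqrt_polar r t : 0 < r -> - PI < t <= PI -> Csqrt (polar r t) = polar (sqrt r) (t / 2).
Proof.
  intros Hr Ht. unfold Csqrt. rewrite Crpow_polar by assumption.
  replace (1 / 2) with (/ 2) by field. rewrite Rpower_sqrt by exact Hr. f_equal. field.
Qed.

Theorem theorem5p10 (q alpha : R) (hq : 0 < q < 1) (halpha : -1 < alpha) :
  is_characteristic_function (Jtilde q alpha)
    (fun z : C =>
       phi01 (Rpower q (alpha + 2)) q
         (Copp (Cmult (RtoC (Rpower q (alpha + 2))) z)))
  /\
  (forall z : C, z <> RtoC 0 ->
     phi01 (Rpower q (alpha + 2)) q
       (Copp (Cmult (RtoC (Rpower q (alpha + 2))) z))
     = Cmult
         (Cmult (RtoC (qpoch_inf q q / qpoch_inf (Rpower q (alpha + 2)) q))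
                (Crpow z (- (alpha + 1) / 2)))
         (qBesselJ2 (alpha + 1) q (Cmult (RtoC 2) (Csqrt z)))).
Proof.
  set (a := Rpower q (alpha + 1)).
  assert (a0 : 0 < a) by apply exp_pos.
  assert (ha : 0 < a < 1).
  { split; [exact a0|]. unfold a, Rpower. apply Rlt_le_trans with (exp 0); [|rewrite exp_0; lra].
    apply exp_increasing.
    assert (ln q < 0) by (rewrite <- ln_1; apply ln_increasing; lra). nra. }
  assert (Eb : Rpower q (alpha + 2) = a * q).
  { replace (alpha + 2) with (alpha + 1 + 1) by ring.
    rewrite Rpower_plus, Rpower_1 by lra. reflexivity. }
  assert (En : forall n, Rpower q (INR n) = q ^ n) by (intros n; apply Rpower_pow; lra).
  assert (Ean : forall n, Rpower q (INR n + (alpha + 1)) = a * q ^ n).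
  { intros n. rewrite Rpower_plus, En. apply Rmult_comm. }
  split.
  - assert (Egam : forall n, qgamma q (INR n) (alpha + 1) = gam q a n).
    { intros n. unfold qgamma, gam. now rewrite En, Ean. }
    assert (Er : forall n, rcoef q alpha n = wgt q a (S n) / wgt q a n).
    { intros n. unfold rcoef, wgt. now rewrite <- S_INR, !Egam. }
    assert (E2n : forall n, Rpower q (- 2 * INR n) = / (q ^ n) ^ 2).
    { intros n. replace (- 2 * INR n) with (- (INR n + INR n)) by ring.
      rewrite Rpower_Ropp, Rpower_plus, En. f_equal. ring. }
    assert (W := wgt_pos q hq a ha). assert (Hn := qpow_range q hq).
    assert (El : lambda_t q alpha = lamq q a).
    { apply functional_extensionality; intros n. unfold lambda_t, lamq. rewrite Er.
      replace (- 2 * INR n - alpha - 1) with (- 2 * INR n + - (alpha + 1)) by ring.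
      replace (INR n + alpha + 1) with (INR n + (alpha + 1)) by ring.
      rewrite Rpower_plus, Rpower_Ropp, E2n, Ean. fold a.
      specialize (Hn n). assert (W0 := W n). assert (W1 := W (S n)). field. repeat split; lra. }
    assert (Em : mu_t q alpha = muq q a).
    { apply functional_extensionality; intros n. unfold mu_t, muq. rewrite Er.
      replace (- 2 * INR n - alpha) with (- 2 * INR n + (- (alpha + 1) + 1)) by ring.
      rewrite !Rpower_plus, Rpower_Ropp, Rpower_1, E2n by lra. fold a.
      specialize (Hn n). assert (W0 := W n). assert (W1 := W (S n)). field. repeat split; lra. }
    unfold Jtilde. rewrite El, Em, Eb.
    destruct (rate_bounds q hq a ha) as (C0 & HC0 & B1 & B2 & B3 & B4 & B5).
    assert (Hs : sqrt q ^ 2 = q) by (apply pow2_sqrt; lra).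
    (* With [h = sqrt q] the bounds in [q] become bounds in even powers of [h]. *)
    apply (birth_death_characteristic_function (lamq q a) (muq q a)) with (h := sqrt q) (C0 := C0).
    + apply lamq_pos; assumption.
    + apply muq_pos; assumption.
    + apply muq_0; assumption.
    + intros z. apply (Qn_lim q hq a ha z).
    + split; [apply sqrt_lt_R0; lra|]. rewrite <- sqrt_1. apply sqrt_lt_1; lra.
    + exact HC0.
    + rewrite Hs. exact B1.
    + rewrite Hs. exact B2.
    + rewrite Hs. exact B3.
    + replace (sqrt q ^ 4) with (q ^ 2) by (rewrite <- Hs at 1; ring). exact B4.
    + replace (sqrt q ^ 4) with (q ^ 2) by (rewrite <- Hs at 1; ring). exact B5.
  - intros z Hz. destruct (Carg_spec z Hz) as [Ht Ez].
    assert (Hr : 0 < Cmod z) by (apply Cmod_gt_0, Hz).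
    set (r := Cmod z) in *. set (t := Carg z) in *.
    assert (Hr2 : 0 < sqrt r) by (apply sqrt_lt_R0, Hr).
    assert (HP := PI_RGT_0).
    unfold qBesselJ2. replace (alpha + 1 + 1) with (alpha + 2) by ring. rewrite Eb.
    assert (N2 : RtoC 2 <> RtoC 0) by (apply RtoC_neq_0; lra).
    assert (N4 : RtoC 4 <> RtoC 0) by (apply RtoC_neq_0; lra).
    replace (Cdiv (Cmult (RtoC 2) (Csqrt z)) (RtoC 2)) with (Csqrt z) by (field; exact N2).
    replace (Cdiv (Cmult (RtoC (a * q)) (Cpow (Cmult (RtoC 2) (Csqrt z)) 2)) (RtoC 4))
      with (Cmult (RtoC (a * q)) z).
    (* Halving the argument keeps it in the principal range, so no multiple of [2 * PI] intervenes
       and the two powers are exact inverses. *)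
    + assert (E1 : Cmult (Crpow z (- (alpha + 1) / 2)) (Crpow (Csqrt z) (alpha + 1)) = RtoC 1).
      { rewrite Ez, Csqrt_polar, !Crpow_polar, polar_mult by lra.
        replace (- (alpha + 1) / 2 * t + (alpha + 1) * (t / 2)) with 0 by field.
        replace (Rpower r (- (alpha + 1) / 2) * Rpower (sqrt r) (alpha + 1)) with 1.
        - unfold polar. rewrite cos_0, sin_0. unfold Cmult, RtoC; simpl. f_equal; ring.
        - rewrite <- (Rpower_sqrt r Hr), Rpower_mult, <- Rpower_plus.
          replace (- (alpha + 1) / 2 + / 2 * (alpha + 1)) with 0 by field.
          symmetry; apply Rpower_O, Hr. }
      assert (I1 := qpoch_inf_pos q hq q ltac:(lra)).
      assert (I2 := qpoch_inf_pos q hq (a * q) ltac:(nra)).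
      assert (E2 : qpoch_inf q q / qpoch_inf (a * q) q * (qpoch_inf (a * q) q / qpoch_inf q q) = 1)
        by (field; lra).
      set (Phi := phi01 _ _ _).
      transitivity (RtoC (qpoch_inf q q / qpoch_inf (a * q) q * (qpoch_inf (a * q) q / qpoch_inf q q))
        * (Crpow z (- (alpha + 1) / 2) * Crpow (Csqrt z) (alpha + 1)) * Phi)%C.
      * rewrite E1, E2. ring.
      * rewrite RtoC_mult. ring.
    + assert (Esq : Cmult (Csqrt z) (Csqrt z) = z).
      { rewrite Ez, Csqrt_polar, polar_mult, sqrt_sqrt by lra. f_equal. field. }
      rewrite <- Esq at 1. simpl Cpow.
      replace (RtoC 4) with (Cmult (RtoC 2) (RtoC 2)) by (rewrite <- RtoC_mult; f_equal; ring).
      field.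
Qed.
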